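(* Let $I=(I_-,I_+)\subset\mathbb R$ be a nonempty open interval with closure $\overline I=[I_-,I_+]\subset[-\infty,\infty]$, and let $\lambda_\pm:\overline I\to[0,\infty)$ be continuous functions such that $\lambda_-$ is nonincreasing, $\lambda_+$ is nondecreasing, $\lambda_+(I_-)>0$ and $\lambda_-(I_+)>0$. Then the Stigler-Luckock model with demand and supply functions $\lambda_-,\lambda_+$ is positive recurrent if and only if the unique solution $(f_-,f_+)$ to Luckock's equation satisfies $f_-(I_-)\wedge f_+(I_+)>0$. If the Stigler-Luckock model is positive recurrent, then it has an invariant law $\nu$ that is concentrated on $\mathcal S^{\rm fin}_{\rm ord}$. Moreover, in this case, the process $(X_k)_{k\ge0}$ started in any initial law that is concentrated on $\mathcal S^{\rm fin}_{\rm ord}$ satisfies $$\big\|\mathbb P[X_k\in\,\cdot\,]-\nu\big\|\to0\quad\text{as }k\to\infty,$$ where $\|\cdot\|$ denotes the total variation norm.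
   Context: **Luckock's equation.** If $f:\overline I\to\mathbb R$ is continuous and of bounded variation, $\mathrm df$ denotes the signed measure on $\overline I$ (without atoms) with $\mathrm df((x,y])=f(y)-f(x)$; $g\,\mathrm df$ is $\mathrm df$ weighted with the density $g$. A solution to Luckock's equation is a pair $(f_-,f_+)$ of continuous functions of bounded variation on $\overline I$ such that $f_-\,\mathrm d\lambda_++\lambda_-\,\mathrm df_+=0$, $f_+\,\mathrm d\lambda_-+\lambda_+\,\mathrm df_-=0$, and $f_-(I_+)=1=f_+(I_-)$. Under the stated hypotheses on $\lambda_\pm$ it is a fact that there is exactly one solution. **Stigler-Luckock model.** Let $\mu_\pm$ be the finite measures on $\overline I$ with $\mu_-([x,I_+])=\lambda_-(x)$ and $\mu_+([I_-,x])=\lambda_+(x)$ for $x\in\overline I$. Let $\mu$ be the finite measure on $\overline I\times\{-,+\}$ with $\mu(A\times\{\sigma\})=\mu_\sigma(A)$, let $|\mu|$ be its total mass, and $\overline\mu:=|\mu|^{-1}\mu$. A counting measure is a finite or countable sum of delta measures. $\mathcal S_{\rm ord}$ is the set of all $\mathcal X=\mathcal X^+-\mathcal X^-$, where $\mathcal X^\pm$ are counting measures on $I$ such that: there are no $x\le y$ in $I$ with $\mathcal X^+(\{x\})>0$ and $\mathcal X^-(\{y\})>0$; and $\mathcal X^-((x,I_+))<\infty$ and $\mathcal X^+((I_-,x))<\infty$ for all $x\in I$. $\mathcal S^{\rm fin}_{\rm ord}$ is the set of $\mathcal X\in\mathcal S_{\rm ord}$ for which $\mathcal X^-$ and $\mathcal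 X^+$ are finite measures; it is equipped with the topology in which $\mathcal X(n)\to\mathcal X$ iff $\mathcal X^\pm(n)\Rightarrow\mathcal X^\pm$ weakly, and with the associated Borel $\sigma$-algebra. Put $$M_-(\mathcal X):=\max(\{I_-\}\cup\{x\in I:\mathcal X(\{x\})<0\}),\quad M_+(\mathcal X):=\min(\{I_+\}\cup\{x\in I:\mathcal X(\{x\})>0\}).$$ For $(u,\sigma)\in\overline I\times\{-,+\}$ the Luckock map $L_{u,\sigma}:\mathcal S_{\rm ord}\to\mathcal S_{\rm ord}$ is: $L_{u,-}(\mathcal X)=\mathcal X-\delta_{u\wedge M_+(\mathcal X)}$ if $u\wedge M_+(\mathcal X)\in I$; $L_{u,+}(\mathcal X)=\mathcal X+\delta_{u\vee M_-(\mathcal X)}$ if $u\vee M_-(\mathcal X)\in I$; and $L_{u,\sigma}(\mathcal X)=\mathcal X$ otherwise. The (discrete-time) Stigler-Luckock model is the Markov chain $X_k:=L_{U_k,\sigma_k}(X_{k-1})$ $(k\ge1)$, where $(U_k,\sigma_k)_{k\ge1}$ are i.i.d. with law $\overline\mu$, independent of $X_0$. **Positive recurrence.** Let $X_0=0$ (the empty state) and $\tau:=\inf\{k>0:X_k=0\}$. The model is called positive recurrent if $\mathbb E[\tau]<\infty$. *)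

(* Defs.v *)
(* MathComp-Analysis, over an arbitrary realType. *)
From HB Require Import structures.
From mathcomp Require Export all_boot all_order all_algebra.
From mathcomp Require Export all_classical all_reals all_analysis.
From mathcomp Require Export finmap measurable_realfun.
Export Order.TTheory GRing.Theory Num.Theory.
Export numFieldNormedType.Exports.

Set Implicit Arguments.
Unset Strict Implicit.
Unset Printing Implicit Defensive.

Local Open Scope classical_set_scope.
Local Open Scope ring_scope.
Local Open Scope ereal_scope.

Section Intervals.
Context {R : realType}.

Definition open_itv (Im Ip : \bar R) : set R := [set x | Im < x%:E < Ip].

Definition closed_itv (Im Ip : \bar R) : set (\bar R) := `[Im, Ip]%classic.

(* The variation of f along the subdivision Im :: s of [Im, Ip]; the library's
   [variation] only covers functions on R, not on \bar R. *)
Definition ereal_variation (Im Ip : \bar R) (f : \bar R -> R)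
    (s : seq (\bar R)) : R :=
  let F := f \o nth Ip (Im :: s) in
  (\sum_(0 <= n < size s) `|F n.+1 - F n|)%R.

Definition ereal_bounded_variation (Im Ip : \bar R) (f : \bar R -> R) : Prop :=
  exists M : R, forall s, itv_partition Im Ip s ->
    (ereal_variation Im Ip f s <= M)%R.

End Intervals.

Section Luckock_equation.
Context {R : realType} (Im Ip : \bar R).
Local Notation Ibar := (closed_itv Im Ip).

(* nu is the signed measure df on Ibar, seen as a charge on \bar R that
   vanishes off Ibar. *)
Definition is_diff_charge (f : \bar R -> R)
    (nu : {charge set \bar R -> \bar R}) : Prop :=
  [/\ forall x y, Ibar x -> Ibar y -> x <= y ->
        nu `]x, y]%classic = (f y - f x)%:E,
      forall x, nu [set x] = 0 &
      forall A, measurable A -> A `<=` ~` Ibar -> nu A = 0].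

(* The signed measure g dnu on Ibar; it is computed from the Jordan parts of nu,
   which do not depend on the chosen Hahn decomposition. *)
Definition weighted_charge (g : \bar R -> R)
    (nu : {charge set \bar R -> \bar R}) (A : set (\bar R)) : \bar R :=
  let: exist P exN := cid (Hahn_decomposition nu) in
  let: exist N nuPN := cid exN in
  \int[jordan_pos nuPN]_(x in A `&` Ibar) (g x)%:E
  - \int[jordan_neg nuPN]_(x in A `&` Ibar) (g x)%:E.

Definition luckock_solution (lm lp fm fp : \bar R -> R) : Prop :=
  [/\ {within Ibar, continuous fm} /\ ereal_bounded_variation Im Ip fm,
      {within Ibar, continuous fp} /\ ereal_bounded_variation Im Ip fp,
      exists dlm dlp dfm dfp : {charge set \bar R -> \bar R},
        [/\ is_diff_charge lm dlm /\ is_diff_charge lp dlp,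
            is_diff_charge fm dfm /\ is_diff_charge fp dfp,
            forall A, measurable A ->
              weighted_charge fm dlp A + weighted_charge lm dfp A = 0 &
            forall A, measurable A ->
              weighted_charge fp dlm A + weighted_charge lp dfm A = 0] &
      fm Ip = 1%R /\ fp Im = 1%R].

End Luckock_equation.

Section States.
Context {R : realType}.

(* A counting measure is defined on all subsets of R; measurability is only
   needed to integrate against it. *)
Definition counting_measure (I : set R) (m : set R -> \bar R) : Prop :=
  exists (D : set nat) (x : nat -> R),
    (forall n, D n -> I (x n)) /\
    forall A, m A = \esum_(n in D) \d_(x n) A.

(* The formal difference X = X^+ - X^-, given by the pair (X^+, X^-). Both parts
   may have infinite mass, so that their difference as a set function need not
   make sense. *)
Record conf := Conf { cpos : set R -> \bar R; cneg : set R -> \bar R }.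

Definition mass (X : conf) (x : R) : \bar R := cpos X [set x] - cneg X [set x].

(* X + \d_z and X - \d_z. The two parts of an ordered configuration have no
   common atom, so a unit mass added at an atom of the part of opposite sign
   cancels one unit there. *)
Definition add_delta (z : R) (X : conf) : conf :=
  if 0 < cneg X [set z] then Conf (cpos X) (fun A => cneg X A - \d_z A)
  else Conf (fun A => cpos X A + \d_z A) (cneg X).

Definition sub_delta (z : R) (X : conf) : conf :=
  if 0 < cpos X [set z] then Conf (fun A => cpos X A - \d_z A) (cneg X)
  else Conf (cpos X) (fun A => cneg X A + \d_z A).

Lemma counting_measure0 I : counting_measure I (fun=> 0).
Proof.
exists set0, (fun=> 0%R); split=> [n []|A].
by rewrite esum_set0.
Qed.

Lemma counting_measure_ge0 I m A : counting_measure I m -> 0 <= m A.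
Proof. by move=> [D [x [_ ->]]]; exact: esum_ge0. Qed.

Lemma counting_measure_add I m z : I z -> counting_measure I m ->
  counting_measure I (fun A => m A + \d_z A).
Proof.
move=> Iz [D [x [Dx mE]]].
exists ([set 0%N] `|` S @` D), (fun n => if n is k.+1 then x k else z).
split=> [n [->//|[k Dk <-]]|A]; first exact: Dx.
rewrite (esumID [set 0%N]); last by move=> i _; exact: measure_ge0.
have -> : ([set 0%N] `|` S @` D) `&` [set 0%N] = [set 0%N].
  by apply/seteqP; split=> [n []//|n ->]; split=> //; left.
have -> : ([set 0%N] `|` S @` D) `&` ~` [set 0%N] = S @` D.
  apply/seteqP; split=> [n [[]//]|n [k Dk <-]].
  by split=> //; right; exists k.
rewrite esum_set1 ?measure_ge0// esum_image; last first.
  by move=> i j _ _ [].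
by rewrite addeC mE.
Qed.

Lemma counting_measure_sub I m z : counting_measure I m -> 0 < m [set z] ->
  counting_measure I (fun A => m A - \d_z A).
Proof.
move=> [D [x [Dx mE]]] mz.
have [n0 [Dn0 xn0]] : exists n, D n /\ x n = z.
  apply: contrapT => /forallNP abs; move: mz; rewrite mE esum1 ?ltxx// => n Dn.
  rewrite diracE memNset// => /= xnz.
  by apply: (abs n).
exists (D `&` ~` [set n0]), x; split=> [n [/Dx]//|A].
rewrite mE (esumID [set n0]); last by move=> i _; exact: measure_ge0.
have -> : D `&` [set n0] = [set n0].
  by apply/seteqP; split=> [n []//|n ->].
rewrite esum_set1 ?measure_ge0// xn0 addeAC subee ?add0e//.
Qed.

Section Ordered.
Variables Im Ip : \bar R.
Local Notation I := (open_itv Im Ip).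

Definition ordered_conf (X : conf) : Prop :=
  [/\ counting_measure I (cpos X) /\ counting_measure I (cneg X),
      ~ (exists x y, [/\ I x, I y, (x <= y)%R,
           0 < cpos X [set x] & 0 < cneg X [set y]]),
      forall x, I x -> cneg X [set y | x%:E < y%:E < Ip] < +oo &
      forall x, I x -> cpos X [set y | Im < y%:E < x%:E] < +oo].

(* M_- and M_+. The supremum and the infimum are attained, by the finiteness
   conditions in [ordered_conf]. *)
Definition Mminus (X : conf) : \bar R :=
  ereal_sup ([set Im] `|` [set x%:E | x in [set x | I x /\ mass X x < 0]]).

Definition Mplus (X : conf) : \bar R :=
  ereal_inf ([set Ip] `|` [set x%:E | x in [set x | I x /\ 0 < mass X x]]).

(* The sign sigma is a boolean: true stands for + and false for -. *)
Definition luckock_conf (w : \bar R * bool) (X : conf) : conf :=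
  let z := if w.2 then maxe w.1 (Mminus X) else mine w.1 (Mplus X) in
  if Im < z < Ip
  then if w.2 then add_delta (fine z) X else sub_delta (fine z) X
  else X.

Lemma ordered_conf0 : ordered_conf (Conf (fun=> 0) (fun=> 0)).
Proof.
split=> /=.
- by split; exact: counting_measure0.
- by move=> [x [y [_ _ _]]]; rewrite ltxx.
- by move=> x _; exact: ltry.
- by move=> x _; exact: ltry.
Qed.

Let fin_num_itv (z : \bar R) : Im < z < Ip -> (fine z)%:E = z.
Proof.
case: z => [r|/andP[_]|/andP[]]//=; first by rewrite ltNge leey.
by rewrite ltNge leNye.
Qed.

Let dirac_add_fin (m : set R -> \bar R) z A :
  m A < +oo -> m A + \d_z A < +oo.
Proof. by move=> mA; rewrite lte_add_pinfty// diracE ltry. Qed.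

Let dirac_sub_fin (m : set R -> \bar R) z A :
  m A < +oo -> m A - \d_z A < +oo.
Proof. by apply: le_lt_trans; rewrite geeDl// oppe_le0 diracE lee_fin. Qed.

Let dirac_sub_gt0 (m : set R -> \bar R) z A :
  0 < m A - \d_z A -> 0 < m A.
Proof. by move/lt_le_trans; apply; rewrite geeDl// oppe_le0 diracE lee_fin. Qed.

Let dirac_add_gt0 (m : set R -> \bar R) z x :
  0 < m [set x] + \d_z [set x] -> 0 < m [set x] \/ x = z.
Proof.
have [->|xz] := pselect (x = z); first by right.
rewrite diracE memNset ?adde0; first by left.
by move=> zx; apply: xz.
Qed.

Lemma luckock_conf_ordered w X : ordered_conf X -> ordered_conf (luckock_conf w X).
Proof.
move=> oX; rewrite /luckock_conf; case: w => u [] /=; case: ifPn => // Iz.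
- have := oX => -[[cp cn] oo fn fp].
  set z := maxe _ _ in Iz *; have zE : (fine z)%:E = z by exact: fin_num_itv.
  have IzR : I (fine z) by rewrite /open_itv /= zE.
  have Mz : Mminus X <= z by rewrite le_max lexx orbT.
  rewrite /add_delta; case: ifPn => [nz|nz]; split => //=.
  + by split=> //; exact: counting_measure_sub.
  + move=> [x [y [Ix Iy xy px /dirac_sub_gt0 ny]]].
    by apply: oo; exists x, y.
  + by move=> x Ix; apply/dirac_sub_fin/fn.
  + by split=> //; exact: counting_measure_add.
  + move=> [x [y [Ix Iy xy /dirac_add_gt0[px|xz] ny]]].
      by apply: oo; exists x, y.
    have py0 : cpos X [set y] = 0.
      apply/eqP; rewrite eq_le (counting_measure_ge0 _ cp) andbT leNgt.
      by apply/negP => py; apply: oo; exists y, y.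
    have yz : y%:E <= z.
      apply: le_trans Mz; apply: ereal_sup_ubound; right; exists y => //.
      by split=> //; rewrite /mass py0 add0e oppe_lt0.
    have yz' : y = fine z.
      by apply/eqP; rewrite eq_le -{2}xz xy andbT -lee_fin zE.
    by move: nz; rewrite -yz' ny.
  + by move=> x Ix; apply/dirac_add_fin/fp.
- have := oX => -[[cp cn] oo fn fp].
  set z := mine _ _ in Iz *; have zE : (fine z)%:E = z by exact: fin_num_itv.
  have IzR : I (fine z) by rewrite /open_itv /= zE.
  have Mz : z <= Mplus X by rewrite ge_min lexx orbT.
  rewrite /sub_delta; case: ifPn => [pz|pz]; split => //=.
  + by split=> //; exact: counting_measure_sub.
  + move=> [x [y [Ix Iy xy /dirac_sub_gt0 px ny]]].
    by apply: oo; exists x, y.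
  + by move=> x Ix; apply/dirac_sub_fin/fp.
  + by split=> //; exact: counting_measure_add.
  + move=> [x [y [Ix Iy xy px /dirac_add_gt0[ny|yz]]]].
      by apply: oo; exists x, y.
    have nx0 : cneg X [set x] = 0.
      apply/eqP; rewrite eq_le (counting_measure_ge0 _ cn) andbT leNgt.
      by apply/negP => nx; apply: oo; exists x, x.
    have zx : z <= x%:E.
      apply: (le_trans Mz); apply: ereal_inf_lbound; right; exists x => //.
      by split=> //; rewrite /mass nx0 oppe0 adde0.
    have zx' : x = fine z.
      by apply/eqP; rewrite eq_le -{1}yz xy -lee_fin zE.
    by move: pz; rewrite -zx' px.
  + by move=> x Ix; apply/dirac_add_fin/fn.
Qed.

Record Sord := MkSord { Sord_conf :> conf; Sord_ordered : ordered_conf Sord_conf }.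

Definition Sord0 : Sord := MkSord ordered_conf0.

Definition luckock_map (w : \bar R * bool) (X : Sord) : Sord :=
  MkSord (luckock_conf_ordered w (Sord_ordered X)).

HB.instance Definition _ := gen_eqMixin Sord.
HB.instance Definition _ := gen_choiceMixin Sord.
HB.instance Definition _ := isPointed.Build Sord Sord0.

Definition Sfin : set Sord :=
  [set X | cpos X setT < +oo /\ cneg X setT < +oo].

Definition bounded_continuous_on (f : R -> R) : Prop :=
  {within I, continuous f} /\
  exists M : R, forall x, I x -> (`|f x| <= M)%R.

(* Weak convergence of X^+ and X^-: the initial topology of these evaluations,
   for the topology of pointwise convergence on their codomain. *)
Definition Sfin_eval (X : Sfin) :
    {ptws {f | bounded_continuous_on f} -> (R * R)%type} :=
  fun f => (fine (\int[cpos (val X)]_(x in I) (sval f x)%:E),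
            fine (\int[cneg (val X)]_(x in I) (sval f x)%:E)).

Definition Sfin_borel : set_system Sfin :=
  <<s (open : set_system (initial_topology Sfin_eval)) >>.

(* Sord is only given the sigma-algebra generated by the Borel subsets of Sfin
   (so that the complement of Sfin is an atom): a law on Sord that is
   concentrated on Sfin is the same as a Borel law on Sfin. *)
Definition Sord_generators : set_system Sord :=
  [set (val : Sfin -> Sord) @` B | B in Sfin_borel].

HB.instance Definition _ := @isMeasurable.Build (sigma_display Sord_generators)
  Sord <<s Sord_generators >> (@sigma_algebra0 _ setT Sord_generators)
  (@sigma_algebraC _ Sord_generators)
  (@sigma_algebra_bigcup _ setT Sord_generators).

Lemma measurable_Sfin : measurable Sfin.
Proof.
apply: sub_sigma_algebra; exists setT; first by apply: sub_sigma_algebra; exact: openT.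
apply/seteqP; split=> [X [Y _ <-]|X SX]; first exact: set_valP.
by exists (exist _ X (mem_set SX)).
Qed.

End Ordered.
End States.

Arguments luckock_map {R Im Ip}.
Arguments Sfin {R} Im Ip.

Section Stigler_Luckock.
Context {R : realType}.
Variables Im Ip : \bar R.
Local Notation E := (\bar R * bool)%type.

(* mu is the measure on Ibar x {-, +} built from the demand and supply functions
   lm and lp, seen as a measure on \bar R * bool. *)
Definition is_stigler_luckock_measure (lm lp : \bar R -> R)
    (mu : {measure set E -> \bar R}) : Prop :=
  exists mum mup : {finite_measure set \bar R -> \bar R},
    [/\ mum (~` closed_itv Im Ip) = 0 /\ mup (~` closed_itv Im Ip) = 0,
        forall x, closed_itv Im Ip x -> mum `[x, Ip]%classic = (lm x)%:E,
        forall x, closed_itv Im Ip x -> mup `[Im, x]%classic = (lp x)%:E &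
        forall A, measurable A ->
          mu (A `*` [set false]) = mum A /\ mu (A `*` [set true]) = mup A].

Definition normalized (mu : {measure set E -> \bar R}) (A : set E) : \bar R :=
  ((fine (mu setT))^-1)%:E * mu A.

Section Process.
Context d (T : measurableType d) (P : probability T R).

(* W k is the pair (U_{k+1}, sigma_{k+1}): the random input of step k+1. *)
Definition iid_inputs (mu : {measure set E -> \bar R})
    (W : nat -> {RV P >-> E}) : Prop :=
  (forall k A, measurable A -> distribution P (W k) A = normalized mu A) /\
  (forall (F : {fset nat}) (A : nat -> set E), (forall k, measurable (A k)) ->
     P (\bigcap_(k in [set` F]) (W k @^-1` A k)) =
     \prod_(k <- F) P (W k @^-1` A k)).

Definition independent_of_inputs (X0 : {RV P >-> Sord Im Ip})
    (W : nat -> {RV P >-> E}) : Prop :=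
  forall A B, measurable A ->
    <<s \bigcup_k preimage_set_system setT (W k) measurable >> B ->
    P (X0 @^-1` A `&` B) = P (X0 @^-1` A) * P B.

Fixpoint process (W : nat -> T -> E) (X0 : T -> Sord Im Ip) (k : nat) (w : T) :
    Sord Im Ip :=
  if k is k'.+1 then luckock_map (W k' w) (process W X0 k' w) else X0 w.

Definition return_time (W : nat -> T -> E) (w : T) : \bar R :=
  ereal_inf [set k%:R%:E | k in
    [set k | (0 < k)%N /\ process W (fun=> Sord0 Im Ip) k w = Sord0 Im Ip]].

(* The law of the return time depends only on the common law of the inputs, not
   on the probability space that carries them. *)
Definition positive_recurrent (W : nat -> {RV P >-> E}) : Prop :=
  \int[P]_w return_time W w < +oo.

End Process.

Definition invariant_law (mu : {measure set E -> \bar R})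
    (nu : probability (Sord Im Ip) R) : Prop :=
  forall A, measurable A ->
    \int[nu]_X normalized mu [set w | A (luckock_map w X)] = nu A.

End Stigler_Luckock.

Arguments return_time {R} Im Ip {d T}.
Arguments positive_recurrent {R} Im Ip {d T P}.

Definition total_variation_norm d (T : measurableType d) (R : realType)
    (m : set T -> \bar R) : \bar R :=
  ereal_sup [set v | exists n (F : nat -> set T),
    [/\ forall i, measurable (F i), trivIset setT F &
        v = \sum_(i < n) `|m (F i)|]].

(* Main.v *)
Require Import Defs.
From mathcomp Require Import ring lra.
Set Implicit Arguments.
Unset Strict Implicit.
Unset Printing Implicit Defensive.
Local Open Scope classical_set_scope.
Local Open Scope ring_scope.
Local Open Scope ereal_scope.

(** Give a resting sell order at [x] the weight [wplus x] and a resting buy order the weight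
    [wminus x], and ask that the mean change of the total weight in one step depend on the book only
    through which of its sides are empty. If the best sell order is at [M], incoming buy orders
    contribute the [mum]-integral of [wminus] over [[Im, M[] minus [lm M * wplus M]. This does not
    depend on [M] when d(lm wplus) = - wminus dlm, and incoming sell orders lead likewise to d(lp
    wminus) = - wplus dlp. Both hold for [wplus = al + Gm] and [wminus = be + Gp], where [Gm] and
    [Gp] integrate the two parts of the differential of 1/(lp lm) and al + be = [slack], so that
    wplus + wminus = 1/(lp lm) ([GmGp], [integral_wminus], [integral_wplus], [state_drift]).

    One degree of freedom is left. Taking [wplus Ip = 0] makes the drift blind to an empty sell
    side: as long as there is a buy order, [pot_buy] drifts by a negative multiple of [buy_margin],
    and because its sell weights are nonpositive it can be positive only if there is a buy order.
    [pot_sell] is the mirror image. Luckock's equation is solved by the same integrals: lm fp + lp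
    fm is a constant k, and so are fm/lm - k Gm and fp/lp - k Gp. Evaluating at the endpoints shows
    that [fm Im] and [fp Ip] are positive multiples of [buy_margin] and [sell_margin]
    ([luckock_margins]). The criterion is therefore that both margins are positive.

    The expected return time is the sum of the probabilities of not having returned by time n
    ([integral_return_time]), computed by iterating the transition operator restricted to the
    complement of the target. If both margins are positive, the sum of the squared positive parts of
    the two potentials has a drift bounded by a constant minus a multiple of the number of orders
    ([lyapunov_drift]). Market orders have positive probability and remove orders one by one, so
    Foster's criterion ([foster]) yields a finite mean hitting time. It is applied to two books fed
    with the same inputs and to the event that both are empty ([summable_coupling]); for two equal
    books this is positive recurrence. If a margin is not positive, the positive part of the
    corresponding potential is a submartingale with bounded steps that leaves 0 at a positive rate.
    Then survival to time n has probability at least a constant over n, and the sum diverges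
    ([survival_not_summable]).

    Under positive recurrence, the expected occupation measure of an excursion from the empty book,
    divided by the mean return time, is invariant and lives on [Sfin]
    ([exists_invariant_probability]). Two coupled books that have once been empty together agree
    forever after, so the distance between their laws is bounded by the probability that this has
    not yet happened; that probability tends to 0 by summability, and dominated convergence extends
    this to arbitrary initial laws on [Sfin] ([process_converges]). *)

Lemma measure_unique_prod d1 d2 (T1 : measurableType d1) (T2 : measurableType d2)
    (R : realType) (m1 m2 : {measure set (T1 * T2) -> \bar R}) :
  m1 setT < +oo ->
  (forall A B, measurable A -> measurable B -> m1 (A `*` B) = m2 (A `*` B)) ->
  forall S, measurable S -> m1 S = m2 S.
Proof.
move=> m1oo m12 S mS.
pose G := [set A `*` B | A in @measurable _ T1 & B in @measurable _ T2].
apply: (measure_unique G (fun=> setT)) => //.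
- exact: measurable_prod_measurableType.
- move=> _ _ [A mA [B mB <-]] [A' mA' [B' mB' <-]].
  exists (A `&` A'); first exact: measurableI.
  by exists (B `&` B'); [exact: measurableI|rewrite setXI].
- by move=> i; exists setT => //; exists setT => //; rewrite setXTT.
- exact: bigcup_const.
- by move=> _ [A mA [B mB <-]]; exact: m12.
Qed.

(** * Markov chains driven by i.i.d. inputs *)

Section random_recursion.
Context (R : realType) dE (E : measurableType dE) dZ (Z : measurableType dZ).
Variables (m : probability E R) (f : E * Z -> Z).
Hypothesis mf : measurable_fun [set: E * Z] f.

(** The one-step transition operator of the chain, acting on functions. *)
Definition step_op (F : Z -> \bar R) (z : Z) : \bar R := \int[m]_w F (f (w, z)).

Let mFf (F : Z -> \bar R) : measurable_fun setT F ->
  measurable_fun [set: E * Z] (F \o f).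
Proof. by move=> mF; exact: measurableT_comp. Qed.

Let mFfz (F : Z -> \bar R) z : measurable_fun setT F -> measurable_fun [set: E] (fun w => F (f (w, z))).
Proof. by move=> mF; exact: (measurable_fun_pair1 _ (mFf mF)). Qed.

Lemma measurable_step z : measurable_fun [set: E] (fun w => f (w, z)).
Proof. exact: (measurable_fun_pair1 _ mf). Qed.

Lemma step_op_ge0 F z : (forall x, 0 <= F x) -> 0 <= step_op F z.
Proof. by move=> F0; exact: integral_ge0. Qed.

Lemma measurable_step_op (F  : Z -> \bar R): measurable_fun setT F -> (forall z, 0 <= F z) ->
  measurable_fun setT (step_op F).
Proof.
move=> mF F0.
by have := @measurable_fun_fubini_tonelli_G _ _ E Z R m (F \o f) (mFf mF)
  (fun x => F0 (f x)).
Qed.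

Lemma le_step_op (F G : Z -> \bar R) z : measurable_fun setT F -> measurable_fun setT G ->
  (forall x, 0 <= F x) -> (forall w, F (f (w, z)) <= G (f (w, z))) ->
  step_op F z <= step_op G z.
Proof.
move=> mF mG F0 FG; apply: ge0_le_integral => //; try exact: mFfz.
Qed.

Lemma step_opD (F G : Z -> \bar R) z : measurable_fun setT F -> measurable_fun setT G ->
  (forall x, 0 <= F x) -> (forall x, 0 <= G x) ->
  step_op (fun x => F x + G x) z = step_op F z + step_op G z.
Proof. by move=> mF mG F0 G0; rewrite /step_op ge0_integralD//; exact: mFfz. Qed.

Lemma step_opZ (F  : Z -> \bar R)c z : measurable_fun setT F -> (forall x, 0 <= F x) -> (0 <= c)%R ->
  step_op (fun x => c%:E * F x) z = c%:E * step_op F z.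
Proof. by move=> mF F0 c0; rewrite /step_op ge0_integralZl//; exact: mFfz. Qed.

Lemma step_op_cst c z : step_op (fun=> c%:E) z = c%:E.
Proof. by rewrite /step_op integral_cst//= probability_setT mule1. Qed.

Lemma measurable_iter_step_op (F  : Z -> \bar R)n : measurable_fun setT F -> (forall z, 0 <= F z) ->
  measurable_fun setT (iter n step_op F) /\ (forall z, 0 <= iter n step_op F z).
Proof.
move=> mF F0; elim: n => [|n [mn n0]]//=; split; first exact: measurable_step_op.
by move=> z; exact: step_op_ge0.
Qed.

Section chain.
Context d (T : measurableType d) (P : probability T R).
Variables (W : nat -> {RV P >-> E}) (Z0 : T -> Z).
Hypothesis mZ0 : measurable_fun setT Z0.
Hypothesis W_law : forall k A, measurable A -> P (W k @^-1` A) = m A.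

Definition cylinder (F : {fset nat}) (A : nat -> set E) : set T :=
  \bigcap_(k in [set` F]) (W k @^-1` A k).

Hypothesis W_indep : forall (F : {fset nat}) (A : nat -> set E),
  (forall k, measurable (A k)) ->
  P (cylinder F A) = \prod_(k <- F) P (W k @^-1` A k).
Hypothesis Z0_indep : forall (F : {fset nat}) (A : nat -> set E) B,
  (forall k, measurable (A k)) -> measurable B ->
  P (Z0 @^-1` B `&` cylinder F A) = P (Z0 @^-1` B) * P (cylinder F A).

Fixpoint chain (k : nat) (w : T) : Z :=
  if k is k'.+1 then f (W k' w, chain k' w) else Z0 w.

Let mW k : measurable_fun setT (W k : T -> E).
Proof. exact: measurable_funPT. Qed.

Lemma measurable_chain k : measurable_fun setT (chain k).
Proof.
elim: k => [|k IH]//=; apply: measurableT_comp => //.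
exact: measurable_fun_pair.
Qed.

Let mchain_pre k B : measurable B -> measurable (chain k @^-1` B).
Proof. by move=> mB; rewrite -[X in measurable X]setTI; exact: measurable_chain. Qed.

Let mW_pre k B : measurable B -> measurable (W k @^-1` B).
Proof. by move=> mB; rewrite -[X in measurable X]setTI; exact: mW. Qed.

Lemma measurable_cylinder F A : (forall k, measurable (A k)) -> measurable (cylinder F A).
Proof.
move=> mA; apply: fin_bigcap_measurable; first exact: finite_fset.
by move=> k _; exact: mW_pre.
Qed.

Let mWZ k : measurable_fun setT (fun w => (W k w, chain k w)).
Proof. by apply: measurable_fun_pair => //; exact: measurable_chain. Qed.

(** The state at time [k] is built from [Z0] and the inputs before [k] only. In the induction step
    it suffices to treat rectangles for the pair ([W k], [chain k]), and there the condition on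
    [W k] can be moved into the cylinder. *)
Lemma chain_indep k (F : {fset nat}) (A : nat -> set E) B :
  (forall j, j \in F -> (k <= j)%N) -> (forall j, measurable (A j)) ->
  measurable B ->
  P (chain k @^-1` B `&` cylinder F A) = P (chain k @^-1` B) * P (cylinder F A).
Proof.
elim: k F A B => [|k IH] F A B Fk mA mB; first exact: Z0_indep.
have mC := measurable_cylinder F mA.
have PC : P (cylinder F A) \is a fin_num by exact: fin_num_measure.
have [c cE] : exists c : {nonneg R}, c%:num%:E = P (cylinder F A).
  by exists (NngNum (fine_ge0 (measure_ge0 P (cylinder F A)))); rewrite /= fineK.
have rect D B' : measurable D -> measurable B' ->
    P ((W k @^-1` D `&` chain k @^-1` B') `&` cylinder F A) =
    P (chain k @^-1` B') * m D * P (cylinder F A).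
  move=> mD mB'.
  (* The condition on [W k] becomes one more coordinate of the cylinder, to which the induction
     hypothesis at time [k] applies. *)
  pose A' j := if j == k then D else A j.
  have kF : k \notin F by apply/negP => /Fk; rewrite ltnn.
  have mA' j : measurable (A' j) by rewrite /A'; case: ifP.
  have cylE : cylinder (k |` F)%fset A' = W k @^-1` D `&` cylinder F A.
    apply/seteqP; split=> w /=.
      move=> h; split.
        by have := h k; rewrite /= /A' eqxx; apply; rewrite /= !inE eqxx.
      move=> j /= jF; have := h j; rewrite /= !inE jF orbT /A' => /(_ isT).
      by case: eqP => // jk; rewrite -jk jF in kF.
    move=> [Dw h] j; rewrite /= !inE /A'; case: eqP => [->//|_ /= jF].
    exact: h.
  have -> : (W k @^-1` D `&` chain k @^-1` B') `&` cylinder F A =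
      chain k @^-1` B' `&` cylinder (k |` F)%fset A'.
    by rewrite cylE setIA (setIC (chain k @^-1` _)).
  rewrite IH//; last first.
    by move=> j; rewrite !inE => /orP[/eqP->//|/Fk]; exact: ltnW.
  rewrite -muleA; congr (_ * _); rewrite W_indep// big_fsetU1//=.
  rewrite {1}/A' eqxx W_law// W_indep//; congr (_ * _).
  rewrite [RHS]big_seq [LHS]big_seq.
  apply: eq_bigr => j jF; rewrite /A'; case: eqP => // jk.
  by rewrite -jk jF in kF.
have mSf : measurable (f @^-1` B).
  by rewrite -[X in measurable X]setTI; exact: mf.
(* The law of the pair restricted to the cylinder and its full law scaled by the mass [c] of the
   cylinder agree on rectangles, hence on the preimage of [B] under [f]. *)
pose WZ : {mfun T >-> (E * Z)%type} := mfun_Sub (mem_set (mWZ k)).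
have := @measure_unique_prod _ _ _ _ _
  (pushforward (mrestr P mC) WZ) (mscale c (pushforward P WZ)) _ _ _ mSf.
rewrite /= /pushforward /mscale /mrestr /= cE => -> //; first by rewrite muleC.
  by rewrite preimage_setT setTI ltey_eq PC.
move=> D B' mD mB'.
have preE : (fun w => (W k w, chain k w)) @^-1` (D `*` B') =
   W k @^-1` D `&` chain k @^-1` B' by apply/seteqP; split.
rewrite preE rect// muleC; congr (_ * _).
pose A' j := if j == k then D else setT : set E.
have := IH [fset k]%fset A' B' _ _ mB'.
have mA' j : measurable (A' j) by rewrite /A'; case: ifP.
have -> : cylinder [fset k]%fset A' = W k @^-1` D.
  apply/seteqP; split=> w /=.
    by move=> /(_ k); rewrite /= !inE eqxx /A' eqxx; apply.
  by move=> Dw j; rewrite /= !inE => /eqP ->; rewrite /A' eqxx.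
move=> h; rewrite /pushforward preE [in RHS]setIC h//; first by rewrite W_law.
by move=> j; rewrite !inE => /eqP->.
Qed.

(** The Markov property: by [chain_indep] the joint law of [W k] and [chain k] is a product, and
    Tonelli integrates out the input first. *)
Lemma integral_chainS k (F : Z -> \bar R) : measurable_fun setT F ->
  (forall z, 0 <= F z) ->
  \int[P]_w F (chain k.+1 w) = \int[P]_w step_op F (chain k w).
Proof.
move=> mF F0.
pose WZ : {mfun T >-> (E * Z)%type} := mfun_Sub (mem_set (mWZ k)).
pose CH : {RV P >-> Z} := mfun_Sub (mem_set (measurable_chain k)).
have /= h := @ge0_integral_pushforward _ _ _ _ R WZ _ P setT (F \o f).
transitivity (\int[pushforward P WZ]_(y in setT) (F \o f) y).
  by rewrite h//; exact: mFf.
transitivity (\int[m \x (distribution P CH)]_y (F \o f) y).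
  apply: eq_measure_integral => S mS _; apply/esym.
  apply: product_measure_unique => // A B mA mB.
  pose A' j := if j == k then A else setT : set E.
  have := @chain_indep k [fset k]%fset A' B _ _ mB.
  have mA' j : measurable (A' j) by rewrite /A'; case: ifP.
  have -> : cylinder [fset k]%fset A' = W k @^-1` A.
    apply/seteqP; split=> w /=.
      by move=> /(_ k); rewrite /= !inE eqxx /A' eqxx; apply.
    by move=> Aw j; rewrite /= !inE => /eqP ->; rewrite /A' eqxx.
  rewrite /pushforward/= /distribution /pushforward /=.
  have -> : (fun w => (W k w, chain k w)) @^-1` (A `*` B) =
    chain k @^-1` B `&` W k @^-1` A by apply/seteqP; split => w [].
  move=> -> //; first by rewrite W_law// muleC.
  by move=> j; rewrite !inE => /eqP->.
rewrite fubini_tonelli2; [|exact: mFf|by move=> x; exact: F0].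
have /= -> := @ge0_integral_pushforward _ _ _ _ R CH _ P setT (step_op F); first by [].
- exact: measurable_chain.
- exact: measurableT.
- exact: measurable_step_op.
- by move=> y _; exact: step_op_ge0.
Qed.

Lemma integral_chain k (F : Z -> \bar R) : measurable_fun setT F ->
  (forall z, 0 <= F z) ->
  \int[P]_w F (chain k w) = \int[P]_w (iter k step_op F) (Z0 w).
Proof.
elim: k F => [|k IH] F mF F0 //.
rewrite integral_chainS// IH; [|exact: measurable_step_op|by move=> z; exact: step_op_ge0].
by rewrite iterSr.
Qed.

End chain.
End random_recursion.

(** * Taboo kernels, survival probabilities and Foster's criterion *)

Section taboo.
Context (R : realType) dE (E : measurableType dE) dZ (Z : measurableType dZ).
Variables (m : probability E R) (f : E * Z -> Z).
Hypothesis mf : measurable_fun [set: E * Z] f.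
Variable D : set Z.
Hypothesis mD : measurable D.

Local Notation nnmfun F := (measurable_fun setT F /\ forall z, 0 <= F z).

(** The kernel of the chain killed on entering [D]. Only the position after the step is tested, so a
    chain may start in [D]; this is what makes return times accessible. *)
Definition taboo_op (F : Z -> \bar R) : Z -> \bar R := step_op m f (F \_ (~` D)).

Lemma nnmfun_restrict (F : Z -> \bar R) (A : set Z) : measurable A ->
  nnmfun F -> nnmfun (F \_ A).
Proof.
move=> mA [mF F0]; split; last by move=> z; rewrite patchE; case: ifP.
by apply/(measurable_restrictT _ mA); exact: measurable_funTS.
Qed.

Let nnT (F : Z -> \bar R) : nnmfun F -> nnmfun (F \_ (~` D)).
Proof. by apply: nnmfun_restrict; exact: measurableC. Qed.

Lemma nnmfun_taboo (F : Z -> \bar R) : nnmfun F -> nnmfun (taboo_op F).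
Proof.
move=> /nnT[mF F0]; split; first exact: measurable_step_op.
by move=> z; exact: step_op_ge0.
Qed.

Lemma nnmfun_iter_taboo (F : Z -> \bar R) n : nnmfun F -> nnmfun (iter n taboo_op F).
Proof. by elim: n => // n IH /IH; rewrite iterS; exact: nnmfun_taboo. Qed.

Lemma le_taboo (F G : Z -> \bar R) z : nnmfun F -> nnmfun G ->
  (forall z, F z <= G z) -> taboo_op F z <= taboo_op G z.
Proof.
move=> /nnT[mF F0] /nnT[mG G0] FG; apply: le_step_op => // w.
by rewrite !patchE; case: ifP.
Qed.

Lemma le_iter_taboo (F G : Z -> \bar R) n z : nnmfun F -> nnmfun G ->
  (forall z, F z <= G z) -> iter n taboo_op F z <= iter n taboo_op G z.
Proof.
move=> nF nG FG; elim: n z => // n IH z; rewrite !iterS.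
by apply: le_taboo => //; exact: nnmfun_iter_taboo.
Qed.

Lemma tabooD (F G : Z -> \bar R) : nnmfun F -> nnmfun G ->
  taboo_op (F \+ G) = taboo_op F \+ taboo_op G.
Proof.
move=> /nnT[mF F0] /nnT[mG G0]; apply/funext => z /=.
rewrite /taboo_op -step_opD//; congr step_op; apply/funext => x.
by rewrite !patchE; case: ifP => //; rewrite add0e.
Qed.

Lemma nnmfunD (F G : Z -> \bar R) : nnmfun F -> nnmfun G -> nnmfun (F \+ G).
Proof.
move=> [mF F0] [mG G0]; split; first exact: emeasurable_funD.
by move=> z /=; exact: adde_ge0.
Qed.

Lemma nnmfunZ (F : Z -> \bar R) c : (0 <= c)%R -> nnmfun F -> nnmfun (fun z => c%:E * F z).
Proof.
move=> c0 [mF F0]; split; last by move=> z /=; rewrite mule_ge0.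
by apply: emeasurable_funM.
Qed.

Lemma nnmfun_cst (c : R) : (0 <= c)%R -> nnmfun (fun _ : Z => c%:E).
Proof. by move=> c0; split. Qed.

Lemma iter_tabooD (F G : Z -> \bar R) n : nnmfun F -> nnmfun G ->
  iter n taboo_op (F \+ G) = iter n taboo_op F \+ iter n taboo_op G.
Proof.
move=> nF nG; elim: n => // n IH.
by rewrite !iterS IH tabooD//; exact: nnmfun_iter_taboo.
Qed.

Lemma iter_tabooDE (F G : Z -> \bar R) n z : nnmfun F -> nnmfun G ->
  iter n taboo_op F z + iter n taboo_op G z = iter n taboo_op (F \+ G) z.
Proof. by move=> nF nG; rewrite iter_tabooD. Qed.

Lemma tabooZ (F : Z -> \bar R) c : (0 <= c)%R -> nnmfun F ->
  taboo_op (fun z => c%:E * F z) = fun z => c%:E * taboo_op F z.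
Proof.
move=> c0 /nnT[mF F0]; apply/funext => z.
rewrite /taboo_op -step_opZ//; congr step_op; apply/funext => x.
by rewrite !patchE; case: ifP => //; rewrite mule0.
Qed.

Lemma iter_tabooZ (F : Z -> \bar R) c n : (0 <= c)%R -> nnmfun F ->
  iter n taboo_op (fun z => c%:E * F z) = fun z => c%:E * iter n taboo_op F z.
Proof.
move=> c0 nF; elim: n => // n IH.
by rewrite !iterS IH tabooZ//; exact: nnmfun_iter_taboo.
Qed.

Lemma taboo_le_step (F : Z -> \bar R) z : nnmfun F -> taboo_op F z <= step_op m f F z.
Proof.
move=> nF; have [mG G0] := nnT nF; case: nF => mF F0.
by apply: le_step_op => // w; rewrite patchE; case: ifP.
Qed.

(** The probability that the chain started from [z] avoids [D] at the times 1, ..., n; the starting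
    point does not count. *)
Definition survival (n : nat) (z : Z) : \bar R := iter n taboo_op (cst 1%:E) z.

Let nn1 : nnmfun (cst 1%:E : Z -> \bar R).
Proof. exact: (@nnmfun_cst 1%R). Qed.

Lemma nnmfun_survival n : nnmfun (survival n).
Proof. exact: nnmfun_iter_taboo. Qed.

Lemma survival_le1 n z : survival n z <= 1.
Proof.
rewrite /survival; elim: n z => // n IH z; rewrite iterS.
apply: (le_trans (y := taboo_op (cst 1%:E) z)).
  by apply: le_taboo => //; exact: nnmfun_iter_taboo.
by apply: le_trans (taboo_le_step z nn1) _; rewrite step_op_cst.
Qed.

Lemma survival_fin_num n z : survival n z \is a fin_num.
Proof.
have [_ s0] := nnmfun_survival n.
rewrite ge0_fin_numE//; apply: le_lt_trans (survival_le1 n z) _.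
exact: ltry.
Qed.

Lemma survival_nonincr n z : survival n.+1 z <= survival n z.
Proof.
rewrite /survival iterSr; apply: le_iter_taboo => //; first exact: nnmfun_taboo.
by move=> x; exact: (survival_le1 1).
Qed.

Lemma survival_taboo k n z : iter k taboo_op (survival n) z = survival (k + n) z.
Proof. by rewrite /survival iterD. Qed.

(* If some event [A] of inputs either hits [D] or lowers the rank [N], then
   [j.+1] such inputs in a row hit [D] from rank at most [j]. *)
Lemma survival_le_rank (N : Z -> \bar R) (p : R) : (0 <= p <= 1)%R ->
  (forall j z, N z <= j%:R%:E -> exists A : set E,
     [/\ measurable A, p%:E <= m A &
      forall w, A w -> D (f (w, z)) \/ (0 < j)%N /\ N (f (w, z)) <= j.-1%:R%:E]) ->
  forall j z, N z <= j%:R%:E -> survival j.+1 z <= (1 - p ^+ j.+1)%:E.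
Proof.
move=> /andP[p0 p1] H.
(* Inputs in [A], of mass at least [p], lose at least the fraction [c] of their survival
   probability. *)
have key j z A c : measurable A -> p%:E <= m A -> (0 <= c <= 1)%R ->
    (forall w, A w -> D (f (w, z)) \/ survival j (f (w, z)) <= (1 - c)%:E) ->
    survival j.+1 z <= (1 - p * c)%:E.
  move=> mA pA /andP[c0 c1] AD.
  suff h : survival j.+1 z + c%:E * m A <= 1.
    rewrite EFinB leeBrDr//; apply: le_trans h; rewrite leeD2l//.
    by rewrite mulrC EFinM lee_wpmul2l// lee_fin.
  have [mG G0] := nnT (nnmfun_survival j).
  have -> : m A = \int[m]_w (\1_A w)%:E by rewrite integral_indic// setIT.
  rewrite -ge0_integralZl//; last first.
    by apply/measurable_EFinP; exact: measurable_indic.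
  have mi : measurable_fun setT (fun w => c%:E * (\1_A w)%:E).
    by apply: emeasurable_funM => //; apply/measurable_EFinP; exact: measurable_indic.
  rewrite /survival iterS /taboo_op /step_op -ge0_integralD//; last 2 first.
    exact: (measurable_fun_pair1 z (measurableT_comp mG mf)).
    by move=> w _; rewrite mule_ge0.
  apply: (@le_trans _ _ (\int[m]_w cst 1 w)); last first.
    by rewrite integral_cst//= probability_setT mule1.
  apply: ge0_le_integral => //.
  - by move=> w _; rewrite adde_ge0 ?mule_ge0.
  - apply: emeasurable_funD => //.
    exact: (measurable_fun_pair1 z (measurableT_comp mG mf)).
  move=> w _; rewrite patchE indicE.
  have s1 := survival_le1 j (f (w, z)).
  have [Aw|Aw] := boolP (w \in A); last first.
    by rewrite mule0 adde0; case: ifP.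
  rewrite mule1; have := AD w (set_mem Aw).
  case: ifPn => [/set_mem nD [//|h]|_ _]; last by rewrite add0e lee_fin.
  by rewrite -leeBrDr// -EFinB.
elim=> [|j IH] z Nz; have [A [mA pA AD]] := H _ _ Nz.
  rewrite expr1 -[X in (1 - X)%R]mulr1; apply: (key _ _ A) => //.
    by rewrite ler01 lexx.
  by move=> w /AD[|[//]]; left.
rewrite exprS; apply: (key _ _ A) => //.
  by rewrite exprn_ge0// exprn_ile1.
by move=> w /AD[|[_ /IH]]; [left|right].
Qed.

(* Foster's criterion *)
Lemma foster (V N : Z -> \bar R) (C delta p : R) :
  nnmfun V -> nnmfun N -> (0 <= C)%R -> (0 < delta)%R -> (0 < p <= 1)%R ->
  (forall z, step_op m f V z + delta%:E * N z <= V z + C%:E) ->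
  (forall j z, N z <= j%:R%:E -> exists A : set E,
     [/\ measurable A, p%:E <= m A &
      forall w, A w -> D (f (w, z)) \/ (0 < j)%N /\ N (f (w, z)) <= j.-1%:R%:E]) ->
  forall z, V z < +oo -> \sum_(0 <= n <oo) survival n z < +oo.
Proof.
move=> nV nN C0 d0 /andP[p0 p1] drift rk z Vz.
(* In the final estimate the partial sum [S n] comes back on the right with the coefficient C /
   (delta K); at most 1/2, it can be absorbed on the left. *)
have [K [K0 CK]] : exists K : nat, (0 < K)%N /\ (C / (delta * K%:R) <= 2^-1)%R.
  exists (Num.bound (2 * C / delta)).+1; split => //.
  have := archi_boundP (divr_ge0 (mulr_ge0 (ler0n R 2) C0) (ltW d0)).
  set x := (2 * C / delta)%R; set M := Num.bound _ => xM.
  rewrite ler_pdivrMr ?mulr_gt0// -ler_pdivrMl// invrK.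
  have -> : (2 * C = x * delta)%R by rewrite /x divfK// gt_eqF.
  by rewrite mulrC ler_pM2l// -natr1; apply: ltW; rewrite (lt_le_trans xM)// lerDl.
(* [a], [v] and [u] are the expectations of 1, [V] and [N] at time [n] over the paths that have
   avoided [D] so far; [b] below is that of the indicator of [B]. *)
pose a n := fine (survival n z).
pose v n := fine (iter n taboo_op V z).
pose u n := fine (iter n taboo_op N z).
pose B := [set x | N x <= K%:R%:E].
have mB : measurable B.
  by rewrite -[B]setTI; apply: emeasurable_fun_infty_c => //; case: nN.
pose iB : Z -> \bar R := EFin \o \1_B.
have nB : nnmfun iB.
  split; first by apply/measurable_EFinP; exact: measurable_indic.
  by move=> x /=; rewrite lee_fin.
pose b n := fine (iter n taboo_op iB z).
have aE n : survival n z = (a n)%:E by rewrite fineK// survival_fin_num.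
have a0 n : (0 <= a n)%R.
  by rewrite -lee_fin -aE; have [_ ->] := nnmfun_survival n.
have bE n : iter n taboo_op iB z = (b n)%:E.
  have [_ i0] := nnmfun_iter_taboo n nB.
  rewrite fineK// ge0_fin_numE//; apply: le_lt_trans (ltry (a n)); rewrite -aE.
  by apply: le_iter_taboo => // x /=; rewrite lee_fin indicE; case: (_ \in _).
(* The drift condition averaged over the surviving paths; killing at the next step only lowers the
   term in [V]. *)
have step n : iter n.+1 taboo_op V z + delta%:E * iter n taboo_op N z <=
    iter n taboo_op V z + C%:E * survival n z.
  have nd : nnmfun (fun z => delta%:E * N z) by apply: nnmfunZ => //; exact: ltW.
  have nC : nnmfun (fun z => C%:E * (cst 1%:E : Z -> \bar R) z) by exact: (nnmfunZ C0 nn1).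
  have -> : delta%:E * iter n taboo_op N z = iter n taboo_op (fun z => delta%:E * N z) z.
    by rewrite iter_tabooZ//; exact: ltW.
  rewrite iterSr /survival.
  have -> : C%:E * iter n taboo_op (cst 1%:E) z =
      iter n taboo_op (fun z => C%:E * cst 1%:E z) z by rewrite iter_tabooZ.
  rewrite (iter_tabooDE n z (nnmfun_taboo nV) nd).
  rewrite (iter_tabooDE n z nV nC).
  apply: le_iter_taboo => [||x]; try by [apply: nnmfunD => //; exact: nnmfun_taboo].
  rewrite mule1; apply: le_trans (drift x); rewrite leeD2r//.
  exact: taboo_le_step.
have iV0 n : 0 <= iter n taboo_op V z by have [] := nnmfun_iter_taboo n nV.
have iN0 n : 0 <= iter n taboo_op N z by have [] := nnmfun_iter_taboo n nN.
have iVoo n : iter n taboo_op V z < +oo.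
  elim: n => // n IH; apply: (@le_lt_trans _ _ (iter n taboo_op V z + C%:E * survival n z)).
    apply: le_trans (step n); rewrite leeDl// mule_ge0// lee_fin; exact: ltW.
  by rewrite lte_add_pinfty// aE -EFinM ltry.
have vE n : iter n taboo_op V z = (v n)%:E by rewrite fineK// ge0_fin_numE.
have uE n : iter n taboo_op N z = (u n)%:E.
  rewrite fineK// ge0_fin_numE//.
  have : delta%:E * iter n taboo_op N z < +oo.
    apply: (@le_lt_trans _ _ (iter n taboo_op V z + C%:E * survival n z)).
      by apply: le_trans (step n); rewrite leeDr.
    by rewrite lte_add_pinfty// aE -EFinM ltry.
  case: (iter n taboo_op N z) (iN0 n) => // [r _ _|_]; first exact: ltry.
  by rewrite gt0_muley ?lte_fin.
have stepR n : (v n.+1 + delta * u n <= v n + C * a n)%R.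
  by have := step n; rewrite !vE uE aE -!EFinM -!EFinD lee_fin.
have q0 : (0 < p ^+ K.+1)%R by rewrite exprn_gt0.
(* From [B] the set [D] is reached within K+1 steps with probability at least p^(K+1), so every
   visit to [B] is paid for by a loss of survival. *)
have hit n : (a (n + K.+1)%N + p ^+ K.+1 * b n <= a n)%R.
  rewrite -lee_fin EFinD EFinM -!aE -bE -survival_taboo.
  have -> : (p ^+ K.+1)%:E * iter n taboo_op iB z =
      iter n taboo_op (fun z => (p ^+ K.+1)%:E * iB z) z.
    by rewrite iter_tabooZ//; exact: ltW.
  have nq : nnmfun (fun z => (p ^+ K.+1)%:E * iB z) by apply: nnmfunZ => //; exact: ltW.
  rewrite (iter_tabooDE n z (nnmfun_survival K.+1) nq).
  apply: le_iter_taboo => // [|x].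
    exact: (nnmfunD (nnmfun_survival _) nq).
  change (survival K.+1 x + (p ^+ K.+1)%:E * (\1_B x)%:E <= 1).
  rewrite indicE; have [xB|xB] := boolP (x \in B); last first.
    by rewrite mule0 adde0 survival_le1.
  rewrite mule1 -leeBrDr// -EFinB; apply: survival_le_rank rk _ _ (set_mem xB).
  by rewrite (ltW p0).
have Kinv : (0 <= K%:R^-1 :> R)%R by rewrite invr_ge0.
(* Markov's inequality in the form 1 <= 1_B + N / K. *)
have spl n : (a n <= b n + K%:R^-1 * u n)%R.
  rewrite -lee_fin EFinD EFinM -aE -bE -uE /survival.
  have -> : (K%:R^-1)%:E * iter n taboo_op N z =
      iter n taboo_op (fun z => (K%:R^-1)%:E * N z) z by rewrite iter_tabooZ.
  have nq : nnmfun (fun z => (K%:R^-1)%:E * N z) by apply: nnmfunZ.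
  rewrite (iter_tabooDE n z nB nq).
  apply: le_iter_taboo => // [|x]; first exact: nnmfunD.
  rewrite /= /iB /= indicE; have [xB|xB] := boolP (x \in B).
    by rewrite leeDl// mule_ge0//; case: nN.
  rewrite add0e; have : K%:R%:E < N x.
    by rewrite ltNge; apply: contra xB => h; exact: mem_set.
  case: (N x) => [r||]; rewrite ?gt0_muley ?lte_fin ?invr_gt0 ?ltr0n ?leey//.
  by move=> Kr; rewrite -EFinM lee_fin mulrC ler_pdivlMr ?ltr0n// mul1r ltW.
pose S n := (\sum_(0 <= k < n) a k)%R.
pose SB n := (\sum_(0 <= k < n) b k)%R.
pose SU n := (\sum_(0 <= k < n) u k)%R.
have v0 n : (0 <= v n)%R by rewrite -lee_fin -vE.
have u0 n : (0 <= u n)%R by rewrite -lee_fin -uE.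
have SUle n : (v n + delta * SU n <= v 0%N + C * S n)%R.
  elim: n => [|n IH]; first by rewrite /SU /S !big_geq// !mulr0.
  rewrite /SU /S !big_nat_recr//= !mulrDr -/(SU n) -/(S n).
  have := stepR n; lra.
have a1 n : (a n <= 1)%R by rewrite -lee_fin -aE survival_le1.
(* Summing [hit] telescopes with lag K+1, so the total loss is at most the sum of the first K+1
   terms of [a], each at most 1. *)
have SBle n : (p ^+ K.+1 * SB n <= K.+1%:R)%R.
  have h : (S (K.+1 + n)%N - S K.+1 + p ^+ K.+1 * SB n <= S n)%R.
    elim: n => [|n IH]; first by rewrite /SB /S addn0 subrr !big_geq// mulr0 addr0.
    rewrite addnS /SB /S !(big_nat_recr n)//= big_nat_recr//=.
    rewrite !mulrDr -/(SB n) -/(S n) -/(S (K.+1 + n)%N) -/(S K.+1).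
    have := hit n; rewrite addnC; lra.
  have h2 : (S n <= S (K.+1 + n)%N)%R.
    rewrite /S [leRHS](big_cat_nat (n := n))//=; last by rewrite leq_addl.
    by rewrite lerDl sumr_ge0.
  have h3 : (S K.+1 <= K.+1%:R)%R.
    rewrite /S; apply: le_trans (ler_sum _ (fun i _ => a1 i)) _.
    by rewrite sumr_const_nat subn0.
  lra.
have Sle n : (S n <= SB n + K%:R^-1 * SU n)%R.
  by rewrite /S /SB /SU mulr_sumr -big_split/=; apply: ler_sum.
pose M := (2 * (K.+1%:R / p ^+ K.+1 + v 0%N / (delta * K%:R)))%R.
have SM n : (S n <= M)%R.
  have dK : (0 < delta * K%:R)%R by rewrite mulr_gt0 ?ltr0n.
  have h1 : (SB n <= K.+1%:R / p ^+ K.+1)%R by rewrite ler_pdivlMr// mulrC.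
  have h2 : (K%:R^-1 * SU n <= v 0%N / (delta * K%:R) + 2^-1 * S n)%R.
    apply: (@le_trans _ _ ((v 0%N + C * S n) / (delta * K%:R))%R).
      rewrite invfM mulrA mulrC ler_wpM2r// ler_pdivlMr// mulrC.
      by have := SUle n; have := v0 n; lra.
    rewrite mulrDl lerD2l// mulrAC ler_wpM2r//.
    by rewrite sumr_ge0.
  have := Sle n; rewrite /M; lra.
apply: (@le_lt_trans _ _ M%:E); last exact: ltry.
apply: lime_le.
  by apply: is_cvg_nneseries => n _ _; have [] := nnmfun_survival n.
near=> n; rewrite (eq_bigr (fun k => (a k)%:E)); last by move=> k _; rewrite aE.
by rewrite sumEFin lee_fin; exact: SM.
Unshelve. all: by end_near.
Qed.
End taboo.

(** * Survival probabilities as probabilities of events for the trajectory *)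

Section taboo_chain.
Context (R : realType) dE (E : measurableType dE) dZ (Z : measurableType dZ).
Variables (m : probability E R) (f : E * Z -> Z).
Hypothesis mf : measurable_fun [set: E * Z] f.
Variable D : set Z.
Hypothesis mD : measurable D.

Local Notation nnmfun F := (measurable_fun setT F /\ forall z, 0 <= F z).

(* The boolean records that [D] has not been hit so far. *)
Definition killed_step (p : E * (Z * bool)) : Z * bool :=
  let z := f (p.1, p.2.1) in (z, p.2.2 && (z \notin D)).

Definition killed_fun (F : Z -> \bar R) (y : Z * bool) : \bar R :=
  if y.2 then F y.1 else 0.

Lemma measurable_killed_step : measurable_fun setT killed_step.
Proof.
have mg : measurable_fun setT (fun p : E * (Z * bool) => f (p.1, p.2.1)).
  apply: measurableT_comp => //; apply: measurable_fun_pair => //.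
  exact: measurableT_comp.
apply: measurable_fun_pair => //=.
apply: (measurable_fun_bool true); rewrite setTI.
have -> : (fun p : E * (Z * bool) => p.2.2 && (f (p.1, p.2.1) \notin D)) @^-1` [set true] =
   (fun p => p.2.2) @^-1` [set true] `&` (fun p => f (p.1, p.2.1)) @^-1` (~` D).
  apply/seteqP; split=> p /=.
    by move=> /andP[-> /negP h]; split => // Dp; apply: h; exact: mem_set.
  by move=> [-> h]; apply/negP => /set_mem.
apply: measurableI.
  rewrite -[X in measurable X]setTI; 
  exact: (measurableT_comp measurable_snd measurable_snd).
by rewrite -[X in measurable X]setTI; apply: mg => //; exact: measurableC.
Qed.

Lemma nnmfun_killed (F : Z -> \bar R) : nnmfun F ->
  measurable_fun setT (killed_fun F) /\ forall z, 0 <= killed_fun F z.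
Proof.
move=> [mF F0]; split; last by move=> [z []]; rewrite /killed_fun //=.
exact: (measurable_fun_if_pair mF (measurable_cst 0)).
Qed.

Lemma step_op_killed (F : Z -> \bar R) :
  step_op m killed_step (killed_fun F) = killed_fun (taboo_op m f D F).
Proof.
apply/funext => -[z []]; rewrite /step_op /killed_step /killed_fun /=.
  rewrite /taboo_op /step_op; apply: eq_integral => w _.
  by rewrite patchE in_setC.
by rewrite integral0_eq.
Qed.

Lemma iter_step_op_killed (F : Z -> \bar R) n :
  iter n (step_op m killed_step) (killed_fun F) = killed_fun (iter n (taboo_op m f D) F).
Proof. by elim: n => // n IH; rewrite !iterS IH step_op_killed. Qed.

Context d (T : measurableType d) (P : probability T R).
Variables (W : nat -> {RV P >-> E}) (Z0 : T -> Z).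
Hypothesis mZ0 : measurable_fun setT Z0.
Hypothesis W_law : forall k A, measurable A -> P (W k @^-1` A) = m A.
Hypothesis W_indep : forall (F : {fset nat}) (A : nat -> set E),
  (forall k, measurable (A k)) ->
  P (cylinder W F A) = \prod_(k <- F) P (W k @^-1` A k).
Hypothesis Z0_indep : forall (F : {fset nat}) (A : nat -> set E) B,
  (forall k, measurable (A k)) -> measurable B ->
  P (Z0 @^-1` B `&` cylinder W F A) = P (Z0 @^-1` B) * P (cylinder W F A).

Definition no_hit (k : nat) : set T :=
  [set w | forall j, (j < k)%N -> ~ D (chain f W Z0 j.+1 w)].

Lemma killed_chainE k w :
  chain killed_step W (fun w => (Z0 w, true)) k w = (chain f W Z0 k w, w \in no_hit k).
Proof.
elim: k => [|k IH] /=; first by rewrite mem_set.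
rewrite IH /killed_step /=; congr pair.
apply/idP/idP.
  move=> /andP[/set_mem h /negP Dk]; apply/mem_set => j.
  rewrite ltnS leq_eqVlt => /orP[/eqP->|]; last exact: h.
  by move=> Dz; apply: Dk; exact: mem_set.
move=> /set_mem h; apply/andP; split.
  by apply/mem_set => j jk; apply: h; exact: ltnW.
by apply/negP => /set_mem; exact: h.
Qed.

Lemma measurable_no_hit k : measurable (no_hit k).
Proof.
have mk := @measurable_chain _ _ _ _ _ _ measurable_killed_step _ _ P W
   (fun w => (Z0 w, true)) (measurable_fun_pair mZ0 (measurable_cst _)) k.
have -> : no_hit k = (chain killed_step W (fun w => (Z0 w, true)) k) @^-1` (setT `*` [set true]).
  apply/seteqP; split=> w /=; rewrite killed_chainE /=.
    by move=> h; split => //; exact: mem_set.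
  by move=> [_ /set_mem].
by rewrite -[X in measurable X]setTI; apply: mk => //; exact: measurableX.
Qed.

(** The chain together with its flag is again a random recursion, on [Z * bool], so [integral_chain]
    applies; [killed_fun] intertwines its operator with the taboo operator. *)
Lemma integral_no_hit k (F : Z -> \bar R) : nnmfun F ->
  \int[P]_(w in no_hit k) F (chain f W Z0 k w) =
  \int[P]_w (iter k (taboo_op m f D) F) (Z0 w).
Proof.
move=> nF; have [mK K0] := nnmfun_killed nF.
have mZ1 : measurable_fun setT (fun w => (Z0 w, true)).
  by apply: measurable_fun_pair.
have := @integral_chain _ _ _ _ _ m _ measurable_killed_step _ _ P W
  (fun w => (Z0 w, true)) mZ1 W_law W_indep _ k _ mK K0.
rewrite iter_step_op_killed /killed_fun /= => <-.
  rewrite integral_mkcond; apply: eq_integral => w _.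
  by rewrite patchE killed_chainE.
move=> F' A B mA mB.
have -> : (fun w => (Z0 w, true)) @^-1` B = Z0 @^-1` [set z | B (z, true)] by [].
apply: Z0_indep => //.
have mpair : measurable_fun setT (fun z : Z => (z, true)).
  by apply: measurable_fun_pair.
by rewrite -[X in measurable X]setTI; exact: mpair.
Qed.

Lemma probability_no_hit k : P (no_hit k) = \int[P]_w survival m f D k (Z0 w).
Proof.
rewrite -(@integral_no_hit k (cst 1)) //=.
by rewrite integral_cst ?mul1e//; exact: measurable_no_hit.
Qed.

End taboo_chain.

(** * Finite counting measures as lists *)

Section list_measure.
Context {R : realType}.

Definition ldirac (s : seq R) (A : set R) : \bar R :=
  (count (fun x => x \in A) s)%:R%:E.

Lemma ldirac_cons z s A : ldirac (z :: s) A = ldirac s A + \d_z A.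
Proof.
rewrite [RHS]addeC diracE /ldirac -EFinD.
by congr EFin; exact: natrD.
Qed.

Lemma ldirac_rem z s A : z \in s -> ldirac (rem z s) A = ldirac s A - \d_z A.
Proof.
move=> zs; have := ldirac_cons z (rem z s) A.
rewrite /ldirac -(seq.permP (perm_to_rem zs)) => ->.
by rewrite diracE -addeA subee// adde0.
Qed.

Lemma perm_ldirac s s' : perm_eq s s' -> ldirac s = ldirac s'.
Proof. by move=> /seq.permP h; apply/funext => A; rewrite /ldirac h. Qed.

Lemma ldirac_nil : ldirac [::] = fun=> 0.
Proof. by []. Qed.

Lemma ldirac_gt0 s z : (0 < ldirac s [set z]) = (z \in s).
Proof.
rewrite lte_fin ltr0n -has_count; apply/hasP/idP.
  by move=> [x xs /set_mem <-].
by move=> zs; exists z => //; exact: mem_set.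
Qed.

Lemma ldirac_ge0 s A : 0 <= ldirac s A.
Proof. by rewrite lee_fin. Qed.

Lemma ldiracT s : ldirac s setT = (size s)%:R%:E.
Proof. by rewrite /ldirac -size_filter (@eq_filter _ _ predT) ?filter_predT// => x; rewrite in_setT. Qed.

Lemma ldirac_perm s s' : ldirac s = ldirac s' -> perm_eq s s'.
Proof.
move=> h; apply/allP => x _ /=; have := congr1 (@^~ [set x]) h; rewrite /ldirac.
have e (t : seq R) : count (fun y => y \in [set x]) t = count_mem x t.
  by apply: eq_count => y; apply/idP/eqP => [/set_mem//|->]; exact: mem_set.
by rewrite !e => -[/eqP]; rewrite eqr_nat.
Qed.

Lemma ldirac_sum s A : ldirac s A = \sum_(x <- s) \d_x A.
Proof.
by elim: s => [|x s IH]; rewrite ?big_nil// big_cons ldirac_cons IH addeC.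
Qed.

Lemma integral_ldirac (s : seq R) (D : set R) (f : R -> R) :
  measurable D -> measurable_fun D f -> (forall x, x \in s -> D x) ->
  \int[ldirac s]_(x in D) (f x)%:E = (\sum_(x <- s) f x)%:E.
Proof.
move=> mD mf sD; have mfE : measurable_fun D (EFin \o f) by exact/measurable_EFinP.
pose m n : {measure set R -> \bar R} := \d_(nth 0%R s n).
have -> : ldirac s = msum m (size s).
  apply/funext => A; rewrite ldirac_sum /msum /=.
  by rewrite (big_nth 0%R) big_mkord.
have e (g : R -> \bar R) : measurable_fun D g -> (forall x, D x -> 0 <= g x) ->
    \int[msum m (size s)]_(x in D) g x = \sum_(x <- s) g x.
  move=> mg g0; rewrite ge0_integral_measure_sum//.
  rewrite (big_nth 0%R) big_mkord; apply: eq_bigr => i _.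
  by rewrite integral_dirac// diracE mem_set ?mul1e//; apply: sD; exact: mem_nth.
rewrite integralE !e//; last 2 first.
- exact: measurable_funeneg.
- exact: measurable_funepos.
under eq_bigr do rewrite funeposE -EFin_max.
under [X in _ - X]eq_bigr do rewrite funenegE -EFinN -EFin_max.
rewrite !sumEFin -EFinB; congr EFin; rewrite -sumrB; apply: eq_bigr => x _.
by have [h|h] := ltP 0%R (f x); have [h2|h2] := ltP 0%R (- f x)%R; lra.
Qed.

(** The atoms have unit mass, so an infinite index set would make the total mass infinite. *)
Lemma counting_measure_ldirac (I : set R) m : counting_measure I m -> m setT < +oo ->
  exists s : seq R, m = ldirac s /\ forall x, x \in s -> I x.
Proof.
move=> [D [x [Dx mE]]]; rewrite mE => fin.
have finD : finite_set D.
  apply: contrapT => infD.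
  suff : forall r : R, (0 < r)%R -> r%:E <= \esum_(n in D) \d_(x n) setT.
    by move=> /eqyP h; rewrite h ltxx in fin.
  move=> r r0; pose k := Num.bound r.
  have [B BD kB] := infinite_set_fset k infD.
  apply: esum_ge; exists [set` B]; first by split => //; exact: finite_fset.
  rewrite (eq_fsbigr (fun=> 1%:E)); last by move=> i _; rewrite diracT.
  rewrite fsbig_finite//= set_fsetK sumEFin lee_fin big_const_seq count_predT.
  rewrite iter_addr_0; have := archi_boundP (ltW r0); rewrite -/k => rk.
  by rewrite (le_trans (ltW rk))// ler_nat.
exists [seq x n | n <- fset_set D]; split.
  apply/funext => A; rewrite mE esum_fset//.
  by rewrite fsbig_finite// ldirac_sum big_map.
by move=> y /mapP[n]; rewrite in_fset_set// => /set_mem /Dx + ->.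
Qed.

End list_measure.

(** * The Luckock map on finite order books *)

Section states.
Context {R : realType} (Im Ip : \bar R).
Local Notation S := (Sord Im Ip).
Local Notation I := (open_itv Im Ip).

(** Sorting makes the list canonical. If the sell side is not given by a finite list, the value is
    the junk value [[::]], so statements about [sells] and [buys] assume [Sfin]. *)
Definition sells (X : S) : seq R := sort <=%R (xget [::] [set s | cpos X = ldirac s]).
Definition buys (X : S) : seq R := sort <=%R (xget [::] [set s | cneg X = ldirac s]).

Lemma sells_sorted X : sorted <=%R (sells X).
Proof. exact: sort_le_sorted. Qed.

Lemma buys_sorted X : sorted <=%R (buys X).
Proof. exact: sort_le_sorted. Qed.

Lemma sells_perm (X : S) s : cpos X = ldirac s -> perm_eq (sells X) s.
Proof.
move=> h; rewrite /sells perm_sort; apply: ldirac_perm.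
by have := @xgetI _ [::] [set s | cpos X = ldirac s] s h; rewrite /= h => <-.
Qed.

Lemma buys_perm (X : S) s : cneg X = ldirac s -> perm_eq (buys X) s.
Proof.
move=> h; rewrite /buys perm_sort; apply: ldirac_perm.
by have := @xgetI _ [::] [set s | cneg X = ldirac s] s h; rewrite /= h => <-.
Qed.

Lemma Sfin_lists (X : S) : Sfin Im Ip X ->
  exists s b, [/\ cpos X = ldirac s, cneg X = ldirac b,
    forall x, x \in s -> I x & forall x, x \in b -> I x].
Proof.
move=> [cp cn]; have [[kp kn] _ _ _] := Sord_ordered X.
have [s [hs Is]] := counting_measure_ldirac kp cp.
have [b [hb Ib]] := counting_measure_ldirac kn cn.
by exists s, b.
Qed.

Lemma Sfin_of_lists (X : S) s b : cpos X = ldirac s -> cneg X = ldirac b -> Sfin Im Ip X.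
Proof. by move=> hs hb; rewrite /Sfin /= hs hb !ldiracT !ltry. Qed.

Section fin.
Variable (X : S).
Hypothesis SX : Sfin Im Ip X.

Lemma cpos_sells : cpos X = ldirac (sells X).
Proof. by have [s [b [h _ _ _]]] := Sfin_lists SX; rewrite (perm_ldirac (sells_perm h)). Qed.

Lemma cneg_buys : cneg X = ldirac (buys X).
Proof. by have [s [b [_ h _ _]]] := Sfin_lists SX; rewrite (perm_ldirac (buys_perm h)). Qed.

Lemma sells_itv x : x \in sells X -> I x.
Proof.
have [s [b [h _ Is _]]] := Sfin_lists SX.
by rewrite (perm_mem (sells_perm h)) => /Is.
Qed.

Lemma buys_itv x : x \in buys X -> I x.
Proof.
have [s [b [_ h _ Ib]]] := Sfin_lists SX.
by rewrite (perm_mem (buys_perm h)) => /Ib.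
Qed.

Lemma buys_lt_sells x y : x \in buys X -> y \in sells X -> (x < y)%R.
Proof.
move=> xb ys; rewrite ltNge; apply/negP => yx.
have [_ oo _ _] := Sord_ordered X; apply: oo; exists y, x; split => //.
- exact: sells_itv.
- exact: buys_itv.
- by rewrite cpos_sells ldirac_gt0.
- by rewrite cneg_buys ldirac_gt0.
Qed.

Lemma mass_gt0 x : (0 < mass X x) = (x \in sells X).
Proof.
rewrite /mass cpos_sells cneg_buys; apply/idP/idP => [|xs].
  by rewrite -ldirac_gt0 => /lt_le_trans; apply; rewrite geeDl// oppe_le0 ldirac_ge0.
have : x \notin buys X by apply/negP => xb; have := buys_lt_sells xb xs; rewrite ltxx.
rewrite -!ldirac_gt0 in xs * => xb; rewrite (_ : ldirac (buys X) _ = 0) ?sube0//.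
by apply/eqP; rewrite eq_le ldirac_ge0 andbT leNgt.
Qed.

Lemma mass_lt0 x : (mass X x < 0) = (x \in buys X).
Proof.
rewrite /mass cpos_sells cneg_buys; apply/idP/idP => [|xb].
  rewrite -ldirac_gt0 => h; rewrite lt_neqAle ldirac_ge0 andbT eq_sym.
  by apply: contraTneq h => ->; rewrite sube0 -leNgt ldirac_ge0.
have : x \notin sells X by apply/negP => xs; have := buys_lt_sells xb xs; rewrite ltxx.
rewrite -!ldirac_gt0 in xb * => xs; rewrite (_ : ldirac (sells X) _ = 0).
  by rewrite sub0e oppe_lt0.
by apply/eqP; rewrite eq_le ldirac_ge0 andbT leNgt.
Qed.

Lemma Mplus_nil : sells X = [::] -> Mplus Im Ip X = Ip.
Proof.
move=> s0; apply/eqP; rewrite eq_le; apply/andP; split.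
  by apply: ereal_inf_lbound; left.
apply: le_ereal_inf_tmp => y [->//|[x [Ix]]].
by rewrite mass_gt0 s0.
Qed.

Lemma Mminus_nil : buys X = [::] -> Mminus Im Ip X = Im.
Proof.
move=> s0; apply/eqP; rewrite eq_le; apply/andP; split; last first.
  by apply: ereal_sup_ubound; left.
apply: ge_ereal_sup => y [->//|[x [Ix]]].
by rewrite mass_lt0 s0.
Qed.

Lemma Mplus_le x : x \in sells X -> Mplus Im Ip X <= x%:E.
Proof.
move=> xs; apply: ereal_inf_lbound; right; exists x => //; split.
  exact: sells_itv.
by rewrite mass_gt0.
Qed.

Lemma Mminus_ge x : x \in buys X -> x%:E <= Mminus Im Ip X.
Proof.
move=> xs; apply: ereal_sup_ubound; right; exists x => //; split.
  exact: buys_itv.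
by rewrite mass_lt0.
Qed.

Lemma Mplus_mem : sells X != [::] -> exists2 x, x \in sells X & Mplus Im Ip X = x%:E.
Proof.
have := sells_sorted X; case E: (sells X) => [//|x s] ss _.
have xs : x \in sells X by rewrite E mem_head.
exists x; first by rewrite mem_head.
apply/eqP; rewrite eq_le Mplus_le//=.
apply: le_ereal_inf_tmp => y [->|[z [Iz]]].
  by have /andP[_ /ltW] := sells_itv xs.
rewrite mass_gt0 E inE => /orP[/eqP-> <-//|zs <-]; rewrite lee_fin.
by move: ss => /=; rewrite (path_sortedE le_trans) => /andP[/allP/(_ _ zs)].
Qed.

Lemma Mminus_mem : buys X != [::] -> exists2 x, x \in buys X & Mminus Im Ip X = x%:E.
Proof.
have := buys_sorted X; case/lastP E: (buys X) => [//|s x] ss _.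
have xb : x \in buys X by rewrite E mem_rcons mem_head.
exists x; first by rewrite mem_rcons mem_head.
apply/eqP; rewrite eq_le Mminus_ge ?andbT//.
apply: ge_ereal_sup => y [->|[z [Iz]]].
  by have /andP[/ltW] := buys_itv xb.
rewrite mass_lt0 E mem_rcons inE => /orP[/eqP-> <-//|zs <-]; rewrite lee_fin.
move: ss; rewrite sorted_pairwise; last exact: le_trans.
by rewrite -cats1 pairwise_cat => /andP[/allrelP/(_ z x zs (mem_head _ _))].
Qed.

Lemma Mplus_gtIm : Im < Ip -> Im < Mplus Im Ip X.
Proof.
move=> hI; have [s0|/Mplus_mem[x /sells_itv/andP[+ _] ->//]] := eqVneq (sells X) [::].
by rewrite Mplus_nil.
Qed.

Lemma Mminus_ltIp : Im < Ip -> Mminus Im Ip X < Ip.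
Proof.
move=> hI; have [s0|/Mminus_mem[x /buys_itv/andP[_ +] ->//]] := eqVneq (buys X) [::].
by rewrite Mminus_nil.
Qed.

Lemma Mminus_lt_Mplus : Im < Ip -> Mminus Im Ip X < Mplus Im Ip X.
Proof.
move=> hI; have [s0|/Mminus_mem[x xb ->]] := eqVneq (buys X) [::].
  by rewrite Mminus_nil// Mplus_gtIm.
have [s0|/Mplus_mem[y ys ->]] := eqVneq (sells X) [::].
  by rewrite Mplus_nil//; have /andP[_] := buys_itv xb.
by rewrite lte_fin; exact: buys_lt_sells.
Qed.

(** The order executes against the best buy order, or joins the book, or has no effect. The last
    happens to a market order that meets no buy order and to a limit price at or beyond [Ip]. *)
Lemma luckock_sell u : Im < Ip ->
  [\/ exists x, [/\ x \in buys X, Mminus Im Ip X = x%:E, u <= x%:E,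
      cpos (luckock_map (u, true) X) = ldirac (sells X) &
      cneg (luckock_map (u, true) X) = ldirac (rem x (buys X))],
   [/\ Mminus Im Ip X < u, u < Ip,
      cpos (luckock_map (u, true) X) = ldirac (fine u :: sells X) &
      cneg (luckock_map (u, true) X) = ldirac (buys X)] |
   [\/ u <= Mminus Im Ip X /\ buys X = [::] | Mminus Im Ip X < u /\ Ip <= u] /\
    luckock_conf Im Ip (u, true) X = X].
Proof.
move=> hI; rewrite /= /luckock_conf /=.
have [um|mu] := leP u (Mminus Im Ip X).
  have [b0|/Mminus_mem[x xb mE]] := eqVneq (buys X) [::].
    apply: Or33; split; first by left.
    by rewrite Mminus_nil// ltxx.
  apply: Or31; exists x; rewrite -mE mE (buys_itv xb) /add_delta /=.
  rewrite cneg_buys ldirac_gt0 xb /= cpos_sells; split => //; first by rewrite -mE.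
  by apply/funext => A; rewrite ldirac_rem.
have [uI|Iu] := ltP u Ip; last first.
  by apply: Or33; rewrite andbF; split=> //; right.
have Iu : Im < u.
  have [b0|/Mminus_mem[x xb mE]] := eqVneq (buys X) [::].
    by rewrite Mminus_nil in mu.
  by apply: lt_trans mu; rewrite mE; have /andP[] := buys_itv xb.
apply: Or32; rewrite Iu /= /add_delta cneg_buys ldirac_gt0.
have uE : u = (fine u)%:E.
  rewrite fineK// fin_numE; apply/andP; split.
    by apply/eqP => h; rewrite h ltNge leNye in Iu.
  by apply/eqP => h; rewrite h ltNge leey in uI.
have /negbTE -> : fine u \notin buys X.
  by apply/negP => /Mminus_ge; rewrite -uE leNgt mu.
split=> //=; rewrite cpos_sells.
by apply/funext => A; rewrite ldirac_cons.
Qed.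

Lemma luckock_buy u : Im < Ip ->
  [\/ exists x, [/\ x \in sells X, Mplus Im Ip X = x%:E, x%:E <= u,
      cneg (luckock_map (u, false) X) = ldirac (buys X) &
      cpos (luckock_map (u, false) X) = ldirac (rem x (sells X))],
   [/\ u < Mplus Im Ip X, Im < u,
      cneg (luckock_map (u, false) X) = ldirac (fine u :: buys X) &
      cpos (luckock_map (u, false) X) = ldirac (sells X)] |
   [\/ Mplus Im Ip X <= u /\ sells X = [::] | u < Mplus Im Ip X /\ u <= Im] /\
    luckock_conf Im Ip (u, false) X = X].
Proof.
move=> hI; rewrite /= /luckock_conf /=.
have [um|mu] := leP (Mplus Im Ip X) u.
  have [b0|/Mplus_mem[x xb mE]] := eqVneq (sells X) [::].
    apply: Or33; split; first by left.
    by rewrite Mplus_nil// ltxx andbF.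
  apply: Or31; exists x; rewrite -mE mE (sells_itv xb) /sub_delta /=.
  rewrite cpos_sells ldirac_gt0 xb /= cneg_buys; split => //; first by rewrite -mE.
  by apply/funext => A; rewrite ldirac_rem.
have [uI|Iu] := ltP Im u; last first.
  by apply: Or33; split=> //; right.
have Iu : u < Ip.
  have [b0|/Mplus_mem[x xb mE]] := eqVneq (sells X) [::].
    by rewrite Mplus_nil in mu.
  by apply: (lt_trans mu); rewrite mE; have /andP[] := sells_itv xb.
apply: Or32; rewrite Iu /= /sub_delta cpos_sells ldirac_gt0.
have uE : u = (fine u)%:E.
  rewrite fineK// fin_numE; apply/andP; split.
    by apply/eqP => h; rewrite h ltNge leNye in uI.
  by apply/eqP => h; rewrite h ltNge leey in Iu.
have /negbTE -> : fine u \notin sells X.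
  by apply/negP => /Mplus_le; rewrite -uE leNgt mu.
split=> //=; rewrite cneg_buys.
by apply/funext => A; rewrite ldirac_cons.
Qed.

End fin.

(** The potentials, the number of orders and the counts that describe the Borel structure are all of
    this additive form. *)
Definition lsum (wp wm : R -> R) (X : S) : R :=
  (\sum_(x <- sells X) wp x + \sum_(x <- buys X) wm x)%R.

Lemma lsum_lists wp wm (X : S) s b : cpos X = ldirac s -> cneg X = ldirac b ->
  lsum wp wm X = (\sum_(x <- s) wp x + \sum_(x <- b) wm x)%R.
Proof.
move=> /sells_perm ps /buys_perm pb.
by rewrite /lsum (perm_big _ ps) (perm_big _ pb).
Qed.

Lemma Sord_inj (X Y : S) : X = Y :> conf -> X = Y.
Proof.
case: X Y => X oX [Y oY] /= XY; move: oX; rewrite XY => oX.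
by rewrite (Prop_irrelevance oX oY).
Qed.

Lemma Sfin_luckock w (X : S) : Im < Ip -> Sfin Im Ip X -> Sfin Im Ip (luckock_map w X).
Proof.
move=> hI SX; case: w => u [].
  have [[x [_ _ _ h1 h2]]|[_ _ h1 h2]|[_ h]] := luckock_sell SX u hI.
  - exact: Sfin_of_lists h1 h2.
  - exact: Sfin_of_lists h1 h2.
  - by rewrite /Sfin /= h.
have [[x [_ _ _ h1 h2]]|[_ _ h1 h2]|[_ h]] := luckock_buy SX u hI.
- exact: Sfin_of_lists h2 h1.
- exact: Sfin_of_lists h2 h1.
- by rewrite /Sfin /= h.
Qed.

(* The order executed against vanishes when the opposite side is empty. *)
Definition best_sell (wp : R -> R) (X : S) : R :=
  if sells X == [::] then 0%R else wp (fine (Mplus Im Ip X)).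
Definition best_buy (wm : R -> R) (X : S) : R :=
  if buys X == [::] then 0%R else wm (fine (Mminus Im Ip X)).

Lemma lsum_sell wp wm (X : S) u : Im < Ip -> Sfin Im Ip X ->
  lsum wp wm (luckock_map (u, true) X) =
  (lsum wp wm X + if (u <= Mminus Im Ip X)%E then - best_buy wm X
                  else if (u < Ip)%E then wp (fine u) else 0)%R.
Proof.
move=> hI SX; have := luckock_sell SX u hI.
case=> [[x [xb mE ux h1 h2]]|[mu uI h1 h2]|[h1 h2]].
- rewrite (lsum_lists _ _ h1 h2) mE ux /best_buy mE /=.
  have /negbTE -> : buys X != [::] by apply: contraTneq xb => ->.
  by rewrite /lsum (perm_big _ (perm_to_rem xb)) big_cons /=; lra.
- rewrite (lsum_lists _ _ h1 h2) leNgt mu /= uI /lsum big_cons; lra.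
- have -> : luckock_map (u, true) X = X by exact: Sord_inj.
  case: h1 => [[-> b0]|[mu Iu]]; first by rewrite /best_buy b0 eqxx oppr0 addr0.
  by rewrite leNgt mu /= ltNge Iu /= addr0.
Qed.

Lemma lsum_buy wp wm (X : S) u : Im < Ip -> Sfin Im Ip X ->
  lsum wp wm (luckock_map (u, false) X) =
  (lsum wp wm X + if (Mplus Im Ip X <= u)%E then - best_sell wp X
                  else if (Im < u)%E then wm (fine u) else 0)%R.
Proof.
move=> hI SX; have := luckock_buy SX u hI.
case=> [[x [xb mE ux h1 h2]]|[mu uI h1 h2]|[h1 h2]].
- rewrite (lsum_lists _ _ h2 h1) mE ux /best_sell mE /=.
  have /negbTE -> : sells X != [::] by apply: contraTneq xb => ->.
  by rewrite /lsum (perm_big _ (perm_to_rem xb)) big_cons /=; lra.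
- rewrite (lsum_lists _ _ h2 h1) leNgt mu /= uI /lsum big_cons; lra.
- have -> : luckock_map (u, false) X = X by exact: Sord_inj.
  case: h1 => [[-> b0]|[mu Iu]]; first by rewrite /best_sell b0 eqxx oppr0 addr0.
  by rewrite leNgt mu /= ltNge Iu /= addr0.
Qed.

End states.

(** * The Borel structure of the space of finite order books *)

Lemma cvg_sum_seq {R : realType} (A : eqType) (s : seq A) (f : nat -> A -> R) (g : A -> R) :
  (forall x, x \in s -> f n x @[n --> \oo] --> g x) ->
  (\sum_(x <- s) f n x)%R @[n --> \oo] --> (\sum_(x <- s) g x)%R.
Proof.
elim: s => [|x s IH] fg.
  rewrite big_nil; under eq_fun do rewrite big_nil; exact: cvg_cst.
rewrite big_cons; under eq_fun do rewrite big_cons.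
apply: cvgD; first by apply: fg; exact: mem_head.
by apply: IH => y ys; apply: fg; rewrite inE ys orbT.
Qed.

Section state_measurability.
Context {R : realType} (Im Ip : \bar R).
Local Notation S := (Sord Im Ip).
Local Notation SF := (Sfin Im Ip).
Local Notation I := (open_itv Im Ip).

Lemma measurable_open_itv : measurable (I : set R).
Proof.
have -> : I = (EFin : R -> \bar R) @^-1` `]Im, Ip[.
  by apply/seteqP; split=> x /=; rewrite in_itv.
by rewrite -[X in measurable X]setTI; apply: EFin_measurable => //; exact: emeasurable_itv.
Qed.

Lemma bounded_continuous_measurable f : bounded_continuous_on Im Ip f -> measurable_fun I f.
Proof.
by move=> [cf _]; apply: subspace_continuous_measurable_fun => //; exact: measurable_open_itv.
Qed.

Lemma Sfin_evalE (X : SF) (f : {f | bounded_continuous_on Im Ip f}) :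
  Sfin_eval X f = (\sum_(x <- sells (val X)) sval f x, \sum_(x <- buys (val X)) sval f x)%R.
Proof.
have SX : SF (val X) by exact: set_valP.
have mf := bounded_continuous_measurable (svalP f).
rewrite /Sfin_eval (cpos_sells SX) (cneg_buys SX).
rewrite !integral_ldirac//; try exact: measurable_open_itv.
- by move=> x; exact: buys_itv.
- by move=> x; exact: sells_itv.
Qed.

Lemma measurable_Sfin' : measurable (SF : set S).
Proof. exact: measurable_Sfin. Qed.

Lemma continuous_eval (f : {f | bounded_continuous_on Im Ip f}) :
  continuous (fun X : initial_topology (@Sfin_eval R Im Ip) => Sfin_eval X f).
Proof.
move=> X.
have h1 : {for X, continuous (@Sfin_eval R Im Ip : initial_topology (@Sfin_eval R Im Ip) -> _)}.
  exact: initial_continuous.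
have h2 : (fun g : {ptws {f | bounded_continuous_on Im Ip f} -> (R * R)%type} => g f) @
    nbhs (Sfin_eval X) --> Sfin_eval X f.
  have /cvg_sup/(_ f) h : nbhs (Sfin_eval X : {ptws {f | bounded_continuous_on Im Ip f} -> (R * R)%type}) --> Sfin_eval X by exact: cvg_id.
  move=> A /= nA; apply: h.
  exact: (@initial_continuous _ _ (fun g : {ptws {f | bounded_continuous_on Im Ip f} -> (R * R)%type} => g f)).
exact: (cvg_comp _ _ h1 h2).
Qed.

(** Evaluation at [f] is continuous for the initial topology, so the superlevel sets of [g] are
    images of open sets, which are generators. *)
Lemma measurable_on_Sfin (h : R * R -> R) (f : {f | bounded_continuous_on Im Ip f}) (g : S -> R) :
  continuous h ->
  (forall X : SF, g (val X) = h (Sfin_eval X f)) -> measurable_fun SF g.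
Proof.
move=> ch gE; apply: (measurability (@RGenOInfty.G R)); first exact: RGenOInfty.measurableE.
move=> _ [_ [r ->] <-]; apply: sub_sigma_algebra.
exists [set X : SF | r < h (Sfin_eval X f)]%R.
  apply: sub_sigma_algebra => /=.
  have ch' : continuous (fun X : initial_topology (@Sfin_eval R Im Ip) => h (Sfin_eval X f)).
    by move=> X; apply: cvg_comp (@continuous_eval f X) _; exact: ch.
  have /continuousP/(_ _ (@open_gt R r)) := ch'.
  by [].
apply/seteqP; split=> [_ [X /= hX <-]|X [SX]]/=.
  by split; [exact: set_valP|rewrite in_itv/= andbT gE].
rewrite in_itv/= andbT => rg.
by exists (exist _ X (mem_set SX)) => //=; rewrite -gE.
Qed.

Lemma measurable_lsum_sells f : bounded_continuous_on Im Ip f ->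
  measurable_fun SF (lsum f (cst 0%R) : S -> R).
Proof.
move=> bf; apply: (@measurable_on_Sfin fst (exist _ f bf)); first by move=> [x y]; exact: cvg_fst.
by move=> X; rewrite Sfin_evalE /lsum /= [X in (_ + X)%R]big1// addr0.
Qed.

Lemma measurable_lsum_buys f : bounded_continuous_on Im Ip f ->
  measurable_fun SF (lsum (cst 0%R) f : S -> R).
Proof.
move=> bf; apply: (@measurable_on_Sfin snd (exist _ f bf)); first by move=> [x y]; exact: cvg_snd.
by move=> X; rewrite Sfin_evalE /lsum /= [X in (X + _)%R]big1// add0r.
Qed.

Lemma measurable_lsum f g : bounded_continuous_on Im Ip f -> bounded_continuous_on Im Ip g ->
  measurable_fun SF (lsum f g : S -> R).
Proof.
move=> bf bg.
have -> : (lsum f g : S -> R) = (lsum f (cst 0%R) \+ lsum (cst 0%R) g)%R.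
  apply/funext => X; rewrite /lsum /= [X in (_ = _ + X + _)%R]big1//.
  by rewrite [X in (_ = _ + (X + _))%R]big1// addr0 add0r.
by apply: measurable_funD; [exact: measurable_lsum_sells|exact: measurable_lsum_buys].
Qed.

(* The indicator function of the half-line below [a]. *)
Definition below (a : \bar R) (x : R) : R := ((x%:E < a)%E%:R)%R.

(** Bounded continuous functions converging pointwise to [below a]; through them the weak topology
    controls the number of orders below a threshold. *)
Definition ramp (a : R) (n : nat) (x : R) : R := (Num.min 1 (Num.max 0 (n%:R * (a - x))))%R.

Lemma bounded_continuous_ramp a n : bounded_continuous_on Im Ip (ramp a n).
Proof.
split; last first.
  exists 1%R => x _; rewrite ger0_norm /ramp ?ge_min ?lexx//.
  by rewrite le_min ler01 le_max lexx.
have c1 (c : R) : continuous (cst c : R -> R^o) by move=> x; exact: cvg_cst.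
have c2 : continuous ((fun x => n%:R * (a - x))%R : R -> R^o).
  by move=> x; apply: cvgM; [exact: cvg_cst|apply: cvgB; [exact: cvg_cst|exact: cvg_id]].
apply: continuous_subspaceT => x.
exact: (continuous_min (c1 _ x) (continuous_max (c1 _ x) (c2 x))).
Qed.

Lemma ramp_cvg a x : ramp a n x @[n --> \oo] --> below a%:E x.
Proof.
rewrite /below lte_fin; have [xa|ax] := ltP x a; last first.
  apply: cvg_near_cst; near=> n; rewrite /ramp max_l ?min_r//.
  by rewrite mulr_ge0_le0// subr_le0.
apply: cvg_near_cst.
exists (Num.bound (a - x)^-1).+1 => // n /= hn.
rewrite /ramp max_r; last by rewrite mulr_ge0// subr_ge0 ltW.
rewrite min_l// -ler_pdivrMr ?subr_gt0// mul1r.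
have := archi_boundP (ltW (_ : 0 < (a - x)^-1)%R); rewrite invr_gt0 subr_gt0 => /(_ xa).
by move=> /ltW /le_trans; apply; rewrite ler_nat; exact: ltnW.
Unshelve. all: by end_near.
Qed.

Lemma bounded_continuous_cst c : bounded_continuous_on Im Ip (cst c).
Proof.
split; first by apply: continuous_subspaceT => x; exact: cvg_cst.
by exists `|c|%R.
Qed.

Lemma lsum_cvg (f g : nat -> R -> R) (f' g' : R -> R) (X : S) :
  (forall x, f n x @[n --> \oo] --> f' x) ->
  (forall x, g n x @[n --> \oo] --> g' x) ->
  lsum (f n) (g n) X @[n --> \oo] --> lsum f' g' X.
Proof.
move=> cf cg; apply: cvgD.
  by apply: cvg_sum_seq => x _; exact: cf.
by apply: cvg_sum_seq => x _; exact: cg.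
Qed.

Lemma below_pinfty : below +oo = cst 1%R.
Proof. by apply/funext => x; rewrite /below ltry. Qed.

Lemma measurable_lsum_below (a b : R) :
  measurable_fun SF (lsum (below a%:E) (cst 0%R) : S -> R) /\
  measurable_fun SF (lsum (cst 0%R) (below b%:E) : S -> R).
Proof.
split.
  apply: (@measurable_fun_cvg _ _ _ _ (fun n => lsum (ramp a n) (cst 0%R))).
    by move=> n; apply: measurable_lsum_sells; exact: bounded_continuous_ramp.
  move=> X _; apply: (@lsum_cvg _ (fun=> cst 0%R)) => x; first exact: ramp_cvg.
  exact: cvg_cst.
apply: (@measurable_fun_cvg _ _ _ _ (fun n => lsum (cst 0%R) (ramp b n))).
  by move=> n; apply: measurable_lsum_buys; exact: bounded_continuous_ramp.
move=> X _; apply: (@lsum_cvg (fun=> cst 0%R)) => x; last exact: ramp_cvg.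
exact: cvg_cst.
Qed.

End state_measurability.

Section criterion.
Context {R : realType} (Im Ip : \bar R).
Local Notation S := (Sord Im Ip).
Local Notation SF := (Sfin Im Ip).
Local Notation I := (open_itv Im Ip).

(** One rational interval for each entry of the sorted list, hence countably many patterns [c]. The
    intervals are half-open so that membership is a condition on the numbers of entries strictly
    below thresholds. *)
Definition in_boxes (c : seq (rat * rat)) (s : seq R) : Prop :=
  size s = size c /\ forall i, (i < size c)%N ->
   (ratr (nth (0, 0) c i).1 <= nth 0 s i < ratr (nth (0, 0) c i).2)%R.

Definition box (c : seq (rat * rat) * seq (rat * rat)) : set S :=
  [set Y | [/\ SF Y, in_boxes c.1 (sells Y) & in_boxes c.2 (buys Y)]].

Lemma small_boxes (s : seq R) (n : nat) : exists c, in_boxes c s /\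
  forall i t, (i < size s)%N -> in_boxes c t ->
    (`|nth 0 t i - nth 0 s i| < 2 * n.+1%:R^-1)%R.
Proof.
have n0 : (0 < n.+1%:R^-1 :> R)%R by rewrite invr_gt0.
have ex (x : R) : exists q : rat * rat,
    (x - n.+1%:R^-1 < ratr q.1 < x)%R /\ (x < ratr q.2 < x + n.+1%:R^-1)%R.
  have [a ha] : exists q : rat, ratr q \in `]x - n.+1%:R^-1, x[%R.
    by apply: rat_in_itvoo; rewrite ltrBlDr ltrDl.
  have [b hb] : exists q : rat, ratr q \in `]x, x + n.+1%:R^-1[%R.
    by apply: rat_in_itvoo; rewrite ltrDl.
  by exists (a, b); rewrite !in_itv /= in ha hb *.
have [q hq] := choice ex.
exists (map q s); split.
  split; first by rewrite size_map.
  move=> i; rewrite size_map => si; rewrite (nth_map 0%R)//.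
  have [/andP[_ h1] /andP[h2 _]] := hq (nth 0%R s i).
  by rewrite h2 ltW.
move=> i t si [_ /(_ i)]; rewrite size_map => /(_ si); rewrite (nth_map 0%R)//.
have [/andP[h0 h1] /andP[h2 h3]] := hq (nth 0%R s i).
move: h0 h1 h2 h3; move: (nth 0%R s i) => y; move: (nth 0%R t i) => z.
move: (ratr (q y).1) (ratr (q y).2) => a b.
move: n0; move: (n.+1%:R^-1)%R => e e0 h0 h1 h2 h3 /andP[h4 h5].
rewrite ltr_norml; apply/andP; split; lra.
Qed.

Lemma open_itv_open : open (I : set R).
Proof.
have -> : I = [set x | Im < x%:E] `&` [set x | x%:E < Ip].
  by apply/seteqP; split=> x /=; [move=> /andP[]|move=> [? ?]; apply/andP].
apply: openI.
  case: Im => [r||].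
  - by under eq_set do rewrite lte_fin; exact: open_gt.
  - by rewrite (_ : mkset _ = set0) ?open0//; apply/seteqP; split.
  - by rewrite (_ : mkset _ = setT); [exact: openT|apply/seteqP; split=> // x _ /=; exact: ltNyr].
case: Ip => [r||].
- by under eq_set do rewrite lte_fin; exact: open_lt.
- by rewrite (_ : mkset _ = setT); [exact: openT|apply/seteqP; split=> // x _ /=; exact: ltry].
- by rewrite (_ : mkset _ = set0) ?open0//; apply/seteqP; split.
Qed.

Lemma sum_cvg_nth (f : R -> R) (s : seq R) (t : nat -> seq R) :
  {within I, continuous f} -> (forall x, x \in s -> I x) ->
  (forall m x, x \in t m -> I x) -> (forall m, size (t m) = size s) ->
  (forall m i, (i < size s)%N -> (`|nth 0 (t m) i - nth 0 s i| < 2 * m.+1%:R^-1)%R) ->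
  (\sum_(x <- t m) f x)%R @[m --> \oo] --> (\sum_(x <- s) f x)%R.
Proof.
move=> cf sI tI st d.
have e m : (\sum_(x <- t m) f x = \sum_(i <- iota 0 (size s)) f (nth 0 (t m) i))%R.
  by rewrite (big_nth 0%R) st /index_iota subn0.
under eq_fun do rewrite e.
have -> : (\sum_(x <- s) f x = \sum_(i <- iota 0 (size s)) f (nth 0 s i))%R.
  by rewrite (big_nth 0%R) /index_iota subn0.
apply: cvg_sum_seq => i; rewrite mem_iota add0n => /andP[_ si].
have six : I (nth 0%R s i) by apply: sI; exact: mem_nth.
have cfx : {for nth 0%R s i, continuous f}.
  have := cf; rewrite continuous_open_subspace; last exact: open_itv_open.
  by apply; exact: mem_set.
have ct : nth 0%R (t m) i @[m --> \oo] --> nth 0%R s i.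
  apply/cvgrPdist_lt => eps e0; near=> m.
  rewrite distrC; apply: lt_trans (d m i si) _.
  rewrite -ltr_pdivlMl// mulrC.
  near: m; exact: (near_infty_natSinv_lt (PosNum (divr_gt0 e0 _))).
exact: (continuous_cvg _ cfx ct).
Unshelve. all: by end_near.
Qed.

(** Otherwise every small box around [X] contains a state outside [U]. Along shrinking boxes the
    sorted entries of these states converge to those of [X], hence so do all integrals of bounded
    continuous functions, and the states converge to [X], against the openness of [U]. *)
Lemma open_box (U : set SF) (X : SF) :
  open (U : set (initial_topology (@Sfin_eval R Im Ip))) -> U X ->
  exists c, box c (val X) /\ forall Y : SF, box c (val Y) -> U Y.
Proof.
move=> oU UX; apply: contrapT => /forallNP noc.
have SX : SF (val X) by exact: set_valP.
have [c1 hc1] := choice (small_boxes (sells (val X))).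
have [c2 hc2] := choice (small_boxes (buys (val X))).
have [Y hY] : exists Y : nat -> SF, forall m, box (c1 m, c2 m) (val (Y m)) /\ ~ U (Y m).
  suff : forall m, exists Y : SF, box (c1 m, c2 m) (val Y) /\ ~ U Y.
    by move=> h; have [Y hY] := choice h; exists Y.
  move=> m; apply: contrapT => nY.
  apply: (noc (c1 m, c2 m)); split.
    by split => //=; [have [] := hc1 m|have [] := hc2 m].
  by move=> Y bY; apply: contrapT => nUY; apply: nY; exists Y.
(* Convergence in the initial topology of a product topology is convergence of each evaluation
   [f]. *)
have cvY : Y @ \oo --> (X : initial_topology (@Sfin_eval R Im Ip)).
  move=> A; rewrite nbhsE => -[B [[V oV VB] BX] BA].
  have nV : nbhs (Sfin_eval X : {ptws {f | bounded_continuous_on Im Ip f} -> (R * R)%type}) V.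
    by apply: open_nbhs_nbhs; split => //; rewrite -VB in BX.
  have : (fun m => Sfin_eval (Y m) : {ptws {f | bounded_continuous_on Im Ip f} -> (R * R)%type}) @ \oo --> Sfin_eval X.
    apply/cvg_sup => f C; rewrite nbhsE => -[D [[W oW WD] DX] DC].
    have nW : nbhs (Sfin_eval X f) W by apply: open_nbhs_nbhs; split => //; rewrite -WD in DX.
    apply: filterS DC _; rewrite -WD /=.
    suff : Sfin_eval (Y m) f @[m --> \oo] --> Sfin_eval X f by move=> /(_ W nW).
    rewrite Sfin_evalE; under eq_fun do rewrite Sfin_evalE.
    have [cf _] := svalP f.
    have SY m : SF (val (Y m)) by exact: set_valP.
    have h1 : (\sum_(x <- sells (val (Y m))) sval f x)%R @[m --> \oo] -->
        (\sum_(x <- sells (val X)) sval f x)%R.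
      apply: sum_cvg_nth => //.
      - by move=> x; exact: sells_itv.
      - by move=> m x; apply: sells_itv; exact: set_valP.
      - move=> m; have [[_ [-> _] _] _] := hY m.
        by have [[-> _] _] := hc1 m.
      - move=> m i si; have [_] := hc1 m; apply => //.
        by have [[_ ? _] _] := hY m.
    have h2 : (\sum_(x <- buys (val (Y m))) sval f x)%R @[m --> \oo] -->
        (\sum_(x <- buys (val X)) sval f x)%R.
      apply: sum_cvg_nth => //.
      - by move=> x; exact: buys_itv.
      - by move=> m x; apply: buys_itv; exact: set_valP.
      - move=> m; have [[_ _ [-> _]] _] := hY m.
        by have [[-> _] _] := hc2 m.
      - move=> m i si; have [_] := hc2 m; apply => //.
        by have [[_ _ ?] _] := hY m.
    exact: (cvg_pair h1 h2).
  move=> /(_ V nV) [k _ hk]; exists k => // m /hk /= Vm; apply: BA.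
  by rewrite -VB.
have := cvY U (open_nbhs_nbhs (conj oU UX)).
move=> [m _ /(_ m (leqnn m))] /=.
by have [] := hY m.
Qed.

End criterion.

Section criterion.
Context {R : realType} (Im Ip : \bar R).
Local Notation S := (Sord Im Ip).
Local Notation SF := (Sfin Im Ip).
Local Notation I := (open_itv Im Ip).

(** Converts a bound on one order into a bound on a count, the only functional whose measurability
    is assumed below. *)
Lemma sorted_nth_lt (s : seq R) i (b : R) : sorted <=%R s -> (i < size s)%N ->
  (nth 0 s i < b)%R = (i < count (fun x => x < b)%R s)%N.
Proof.
move=> ss si; apply/idP/idP => h; last exact: nth_count_lt.
rewrite ltnNge; apply: contraTN h => h; rewrite -leNgt.
by apply: nth_count_ge => //; rewrite si andbT.
Qed.

Lemma sum_below (s : seq R) (a : \bar R) :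
  (\sum_(x <- s) below a x)%R = (count (fun x => x%:E < a) s)%:R :> R.
Proof.
elim: s => [|x s IH]; first by rewrite big_nil.
by rewrite big_cons IH /= /below natrD.
Qed.

Lemma lsum_below_sells a (X : S) :
  lsum (below a) (cst 0%R) X = (count (fun x => x%:E < a) (sells X))%:R.
Proof. by rewrite /lsum sum_below [X in (_ + X)%R]big1 ?addr0. Qed.

Lemma lsum_below_buys a (X : S) :
  lsum (cst 0%R) (below a) X = (count (fun x => x%:E < a) (buys X))%:R.
Proof. by rewrite /lsum sum_below [X in (X + _)%R]big1 ?add0r. Qed.

Context d (T : measurableType d) (g : T -> S).
Hypothesis mgF : measurable (g @^-1` SF).
Hypothesis mg : forall a : \bar R,
  measurable_fun (g @^-1` SF) (fun w => lsum (below a) (cst 0%R) (g w)) /\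
  measurable_fun (g @^-1` SF) (fun w => lsum (cst 0%R) (below a) (g w)).

Lemma measurable_in_boxes (h : S -> seq R) c :
  (forall X, sorted <=%R (h X)) ->
  (forall a : \bar R, measurable_fun (g @^-1` SF)
    (fun w => (count (fun x => x%:E < a) (h (g w)))%:R : R)) ->
  measurable ((g @^-1` SF) `&` [set w | in_boxes c (h (g w))]).
Proof.
move=> hs mh.
pose C a w : R := (count (fun x => x%:E < a) (h (g w)))%:R.
have mC a (B : set R) : measurable B -> measurable (g @^-1` SF `&` C a @^-1` B).
  by move=> mB; exact: mh.
have -> : (g @^-1` SF) `&` [set w | in_boxes c (h (g w))] =
  (g @^-1` SF `&` C +oo @^-1` [set (size c)%:R]) `&`
  \bigcap_(i in `I_(size c))
   ((g @^-1` SF `&` C (ratr (nth (0, 0)%R c i).1)%:E @^-1` `]-oo, i%:R]) `&`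
    (g @^-1` SF `&` C (ratr (nth (0, 0)%R c i).2)%:E @^-1` `]i%:R, +oo[)).
  have eqT w : C +oo w = (size (h (g w)))%:R.
    by rewrite /C (eq_count (a2 := predT)) ?count_predT// => x; rewrite ltry.
  apply/seteqP; split=> w /=.
    move=> [gw [sc bc]]; split; first by split=> //; rewrite eqT sc.
    move=> i /= ic; have := bc i ic.
    have si : (i < size (h (g w)))%N by rewrite sc.
    rewrite leNgt !sorted_nth_lt// -leqNgt => /andP[h1 h2].
    by split; split => //=; rewrite in_itv /= ?andbT /C ?ler_nat ?ltr_nat.
  rewrite eqT => -[[gw /eqP]]; rewrite eqr_nat => /eqP sc bc; split => //; split => // i ic.
  have si : (i < size (h (g w)))%N by rewrite sc.
  have [[_ /=] ] := bc i ic; rewrite in_itv /= /C ler_nat => h1 [_ /=].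
  rewrite in_itv /= andbT ltr_nat => h2.
  by rewrite leNgt !sorted_nth_lt// -leqNgt; apply/andP; split.
apply: measurableI; first exact: mC.
apply: bigcap_measurableType => i _.
by apply: measurableI; apply: mC; exact: measurable_itv.
Qed.

Lemma measurable_box c : measurable (g @^-1` box c).
Proof.
have -> : g @^-1` box c =
   ((g @^-1` SF) `&` [set w | in_boxes c.1 (sells (g w))]) `&`
   ((g @^-1` SF) `&` [set w | in_boxes c.2 (buys (g w))]).
  by apply/seteqP; split=> w /=; [move=> []|move=> [[? ?] [? ?]]].
apply: measurableI; apply: measurable_in_boxes.
- by move=> X; exact: sells_sorted.
- move=> a; under eq_fun do rewrite -lsum_below_sells; exact: (mg a).1.
- by move=> X; exact: buys_sorted.
- move=> a; under eq_fun do rewrite -lsum_below_buys; exact: (mg a).2.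
Qed.

(** By [open_box] an open set is the union of the boxes it contains, and there are only countably
    many boxes; so measurable counts below every threshold make a map into [Sord] measurable. *)
Lemma measurable_to_Sord : measurable_fun setT g.
Proof.
apply: (measurability (@Sord_generators R Im Ip)) => //.
move=> _ [_ [B sB <-] <-]; rewrite setTI.
suff : Sfin_borel (Im := Im) (Ip := Ip) `<=` [set B : set SF | measurable (g @^-1` (val @` B))] by exact.
apply: smallest_sub.
  split.
  - by rewrite /= image_set0 preimage_set0.
  - move=> A /= mA; rewrite setTD.
    have -> : g @^-1` (val @` ~` A) = g @^-1` SF `\` g @^-1` (val @` A).
      apply/seteqP; split=> w /=.
        move=> [Y nAY Yw]; split; first by rewrite -Yw; exact: set_valP.
        by move=> [Z AZ Zw]; apply: nAY; rewrite (_ : Y = Z)//; apply: val_inj; rewrite /= Yw.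
      move=> [SFw nA]; exists (exist _ (g w) (mem_set SFw)) => //.
      by move=> Aw; apply: nA; exists (exist _ (g w) (mem_set SFw)).
    by apply: measurableD.
  - move=> A mA /=; rewrite image_bigcup preimage_bigcup.
    by apply: bigcup_measurable => i _; exact: mA.
move=> U oU /=.
have -> : g @^-1` (val @` U) = \bigcup_(c in [set c | forall Y : SF, box c (val Y) -> U Y])
    (g @^-1` box c).
  apply/seteqP; split=> w /=.
    move=> [X UX Xw]; have [c [cX cU]] := open_box oU UX.
    by exists c => //=; rewrite -Xw.
  move=> [c /= cU cw]; have SFw : SF (g w) by have [] := cw.
  by exists (exist _ (g w) (mem_set SFw)) => //; exact: cU.
rewrite bigcup_mkcond; apply: countable_bigcupT_measurable; first exact: countableP.
by move=> c; case: ifP => _ //; exact: measurable_box.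
Qed.

End criterion.

(** * Measurability of the Luckock map *)

Lemma measurable_fun_if' d d' (T : sigmaRingType d) (T' : sigmaRingType d') (D : set T)
    (f g : T -> T') (b : T -> bool) :
  measurable_fun D b -> measurable_fun D f -> measurable_fun D g ->
  measurable_fun D (fun x => if b x then f x else g x).
Proof.
move=> mb mf mg mD; move: (mD); apply: measurable_fun_if => //;
  by apply: measurable_funS (mD) _ _.
Qed.

Section measurable_luckock.
Context {R : realType} (Im Ip : \bar R).
Hypothesis hI : Im < Ip.
Local Notation S := (Sord Im Ip).
Local Notation SF := (Sfin Im Ip).
Local Notation I := (open_itv Im Ip).

(** A step changes each side by at most one order. Together with [Sfin_luckock] this identifies the
    preimage of [Sfin] under a step, on which [measurable_to_Sord] works. *)
Lemma Sfin_luckock_inv w (X : S) : SF (luckock_map w X) -> SF X.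
Proof.
have finB (m : \bar R) z : m - \d_z setT < +oo -> m < +oo.
  by rewrite diracE; case: m => //= *; exact: ltry.
have finD (m : \bar R) z : m + \d_z setT < +oo -> m < +oo.
  by rewrite diracE; case: m => //= *; exact: ltry.
rewrite /Sfin /= /luckock_conf; case: w => u [] /=; case: ifP => // _.
  by rewrite /add_delta; case: ifP => _ /= -[]; [move=> ? /finB|move=> /finD].
by rewrite /sub_delta; case: ifP => _ /= -[]; [move=> /finB|move=> ? /finD].
Qed.

Lemma measurable_lsum_below' a :
  measurable_fun SF (lsum (below a) (cst 0%R) : S -> R) /\
  measurable_fun SF (lsum (cst 0%R) (below a) : S -> R).
Proof.
have below_ninfty : below -oo = cst 0%R :> (R -> R).
  by apply/funext => x; rewrite /below ltNge leNye.
case: a => [r||]; first exact: measurable_lsum_below.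
  rewrite below_pinfty.
  by split; apply: measurable_lsum; exact: bounded_continuous_cst.
rewrite below_ninfty.
by split; apply: measurable_lsum; exact: bounded_continuous_cst.
Qed.

Lemma measurable_sells_nil : measurable_fun SF (fun X : S => sells X == [::]).
Proof.
apply: (measurable_fun_bool true).
have -> : SF `&` (fun X : S => sells X == [::]) @^-1` [set true] =
   SF `&` lsum (below +oo) (cst 0%R) @^-1` [set 0%R].
  apply/seteqP; split=> X /= [SX]; rewrite lsum_below_sells.
    by move/eqP => ->.
  rewrite (eq_count (a2 := predT)) ?count_predT => [|x]; last by rewrite ltry.
  by move=> /eqP; rewrite pnatr_eq0 size_eq0.
by apply: (measurable_lsum_below' _).1 => //; exact: measurable_Sfin.
Qed.

Lemma measurable_buys_nil : measurable_fun SF (fun X : S => buys X == [::]).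
Proof.
apply: (measurable_fun_bool true).
have -> : SF `&` (fun X : S => buys X == [::]) @^-1` [set true] =
   SF `&` lsum (cst 0%R) (below +oo) @^-1` [set 0%R].
  apply/seteqP; split=> X /= [SX]; rewrite lsum_below_buys.
    by move/eqP => ->.
  rewrite (eq_count (a2 := predT)) ?count_predT => [|x]; last by rewrite ltry.
  by move=> /eqP; rewrite pnatr_eq0 size_eq0.
by apply: (measurable_lsum_below' _).2 => //; exact: measurable_Sfin.
Qed.

(** For r above [Im], the best buy price is below r exactly if the number of buy orders below r is
    the number of all buy orders. *)
Lemma measurable_Mminus : measurable_fun SF (fun X : S => Mminus Im Ip X).
Proof.
apply: (measurability (@ErealGenInftyO.G R)); first exact: ErealGenInftyO.measurableE.
move=> _ [_ [r ->] <-].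
have [Imr|rIm] := ltP Im r%:E; last first.
  rewrite (_ : _ `&` _ = set0)//; apply/seteqP; split => // X /= [SX].
  rewrite in_itv /= ltNge => /negP; apply; apply: le_trans rIm _.
  by apply: ereal_sup_ubound; left.
have -> : SF `&` (fun X : S => Mminus Im Ip X) @^-1` `]-oo, r%:E[ =
   SF `&` (lsum (cst 0%R) (below r%:E) \- lsum (cst 0%R) (below +oo))%R @^-1` [set 0%R].
  apply/seteqP; split=> X /= [SX]; rewrite !lsum_below_buys in_itv /=;
    rewrite (eq_count (a2 := predT) (fun x => ltry x)) count_predT.
    move=> Mr; split => //; apply/eqP; rewrite subr_eq0 eqr_nat -all_count.
    by apply/allP => x xb; apply: le_lt_trans Mr; exact: Mminus_ge.
  move=> /eqP; rewrite subr_eq0 eqr_nat -all_count => /allP h; split => //.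
  have [b0|/(Mminus_mem SX)[x xb ->]] := eqVneq (buys X) [::]; last exact: h.
  by rewrite Mminus_nil.
have [m1 m2] := (measurable_lsum_below' r%:E, measurable_lsum_below' +oo).
by apply: (measurable_funB m1.2 m2.2) => //; exact: measurable_Sfin.
Qed.

Lemma measurable_Mplus : measurable_fun SF (fun X : S => Mplus Im Ip X).
Proof.
apply: (measurability (@ErealGenInftyO.G R)); first exact: ErealGenInftyO.measurableE.
move=> _ [_ [r ->] <-].
have [Imr|rIm] := ltP Ip r%:E.
  rewrite (_ : _ `&` _ = SF); first exact: measurable_Sfin.
  apply/seteqP; split => X /=; first by case.
  move=> SX; split => //; rewrite in_itv /=; apply: le_lt_trans Imr.
  by apply: ereal_inf_lbound; left.
have -> : SF `&` (fun X : S => Mplus Im Ip X) @^-1` `]-oo, r%:E[ =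
   SF `&` (lsum (below r%:E) (cst 0%R)) @^-1` `]0%R, +oo[.
  apply/seteqP; split=> X /= [SX]; rewrite lsum_below_sells !in_itv /= andbT ltr0n -has_count.
    move=> Mr; split => //.
    have [b0|/(Mplus_mem SX)[x xb xE]] := eqVneq (sells X) [::].
      by move: Mr; rewrite Mplus_nil// ltNge rIm.
    by apply/hasP; exists x => //; rewrite -xE.
  move=> /hasP[x xs xr]; split => //; apply: le_lt_trans xr; exact: Mplus_le.
by apply: (measurable_lsum_below' _).1; [exact: measurable_Sfin|exact: measurable_itv].
Qed.

Let D : set ((\bar R * bool) * S) := snd @^-1` SF.

Let mD : measurable D.
Proof. by rewrite -[D]setTI; apply: measurable_snd => //; exact: measurable_Sfin. Qed.

Let mcomp d (T : measurableType d) (f : S -> T) : measurable_fun SF f -> measurable_fun D (f \o snd).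
Proof.
move=> mf; apply: measurable_comp mf _ => //; first exact: measurable_Sfin.
  by move=> _ [x Dx <-].
exact: measurable_funTS.
Qed.

Lemma measurable_below_fine a d (T : measurableType d) (E : set T) (h : T -> \bar R) :
  measurable_fun E h -> measurable_fun E (fun x => below a (fine (h x))).
Proof.
move=> mh; rewrite /below.
have -> : (fun x => ((fine (h x))%:E < a)%E%:R : R) =
   (fun x => if ((fine (h x))%:E < a)%E then 1%R else 0%R : R) by apply/funext => x; case: ifP.
apply: measurable_fun_if' => //; apply: measurable_fun_lte => //.
apply/measurable_EFinP; exact: measurableT_comp.
Qed.

(** By [lsum_sell] and [lsum_buy], each count for the new state is an explicit expression in the
    input, the old count, the best prices and the emptiness of the two sides. *)
Lemma measurable_luckock :
  measurable_fun setT (fun p : (\bar R * bool) * S => luckock_map p.1 p.2).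
Proof.
have preE : (fun p : (\bar R * bool) * S => luckock_map p.1 p.2) @^-1` SF = D.
  apply/seteqP; split=> [[w X]|[w X]] /=; first exact: Sfin_luckock_inv.
  exact: Sfin_luckock.
have mu : measurable_fun D (fun p : (\bar R * bool) * S => p.1.1).
  by apply: measurable_funTS; exact: (measurableT_comp measurable_fst measurable_fst).
have mb : measurable_fun D (fun p : (\bar R * bool) * S => p.1.2).
  by apply: measurable_funTS; exact: (measurableT_comp measurable_snd measurable_fst).
have mMm := mcomp measurable_Mminus.
have mMp := mcomp measurable_Mplus.
have key wp wm :
    measurable_fun SF (lsum wp wm : S -> R) ->
    measurable_fun SF (best_sell (Im := Im) (Ip := Ip) wp) ->
    measurable_fun SF (best_buy (Im := Im) (Ip := Ip) wm) ->
    measurable_fun D (fun p => wp (fine p.1.1)) ->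
    measurable_fun D (fun p => wm (fine p.1.1)) ->
    measurable_fun D (fun p => lsum wp wm (luckock_map p.1 p.2)).
  move=> ml ms mbu mwp mwm.
  apply/(measurable_fun_eqP (fun p : (\bar R * bool) * S => if p.1.2 then
     (lsum wp wm p.2 + if (p.1.1 <= Mminus Im Ip p.2)%E then - best_buy wm p.2
                  else if (p.1.1 < Ip)%E then wp (fine p.1.1) else 0)%R else
     (lsum wp wm p.2 + if (Mplus Im Ip p.2 <= p.1.1)%E then - best_sell wp p.2
                  else if (Im < p.1.1)%E then wm (fine p.1.1) else 0)%R)).
    move=> [[u []] X] /set_mem /= SX; first by rewrite lsum_sell.
    by rewrite lsum_buy.
  apply: measurable_fun_if' => //.
    apply: measurable_funD; first exact: (mcomp ml).
    apply: measurable_fun_if' => //; first exact: measurable_fun_lee.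
      by apply: measurable_funN; exact: (mcomp mbu).
    by apply: measurable_fun_if' => //; exact: measurable_fun_lte.
  apply: measurable_funD; first exact: (mcomp ml).
  apply: measurable_fun_if' => //; first exact: measurable_fun_lee.
    by apply: measurable_funN; exact: (mcomp ms).
  by apply: measurable_fun_if' => //; exact: measurable_fun_lte.
apply: measurable_to_Sord; rewrite preE // => a; split; apply: key => //.
- exact: (measurable_lsum_below' a).1.
- apply: measurable_fun_if' => //; first exact: measurable_sells_nil.
  exact: measurable_below_fine measurable_Mplus.
- apply: measurable_fun_if' => //; exact: measurable_buys_nil.
- exact: measurable_below_fine.
- exact: (measurable_lsum_below' a).2.
- apply: measurable_fun_if' => //; exact: measurable_sells_nil.
- apply: measurable_fun_if' => //; first exact: measurable_buys_nil.
  exact: measurable_below_fine measurable_Mminus.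
- exact: measurable_below_fine.
Qed.

Lemma Sord0P (X : S) : SF X -> X = Sord0 Im Ip <-> sells X = [::] /\ buys X = [::].
Proof.
move=> SX; split.
  move=> ->; split; apply/eqP; rewrite -size_eq0 -leqn0.
    by have := @sells_perm _ _ _ (Sord0 Im Ip) [::] erefl => /perm_size ->.
  by have := @buys_perm _ _ _ (Sord0 Im Ip) [::] erefl => /perm_size ->.
move=> [s0 b0]; apply: Sord_inj; case: X SX s0 b0 => -[p n] o SX s0 b0 /=.
have /= := cpos_sells SX; have /= := cneg_buys SX.
by rewrite s0 b0 => -> ->.
Qed.

Lemma Sfin0 : SF (Sord0 Im Ip).
Proof. by split => /=; exact: ltry. Qed.

Lemma measurable_Sord0 : measurable [set Sord0 Im Ip].
Proof.
have -> : [set Sord0 Im Ip] =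
   (SF `&` (fun X : S => sells X == [::]) @^-1` [set true]) `&`
   (SF `&` (fun X : S => buys X == [::]) @^-1` [set true]).
  apply/seteqP; split=> X /=.
    move=> ->; have /Sord0P[+ _] := Sfin0 => /(_ erefl)[-> ->].
    by split; split => //; exact: Sfin0.
  by move=> [[SX /eqP s0] [_ /eqP b0]]; apply/Sord0P.
apply: measurableI; first by apply: measurable_sells_nil => //; exact: measurable_Sfin.
by apply: measurable_buys_nil => //; exact: measurable_Sfin.
Qed.

End measurable_luckock.

(** * The mean return time as a series of survival probabilities *)

Section process.
Context {R : realType} (Im Ip : \bar R).
Hypothesis hI : Im < Ip.
Local Notation S := (Sord Im Ip).
Local Notation SF := (Sfin Im Ip).
Local Notation E := (\bar R * bool)%type.

Definition luckock_step (p : E * S) : S := luckock_map p.1 p.2.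

Lemma measurable_luckock_step : measurable_fun setT luckock_step.
Proof. exact: measurable_luckock. Qed.

Context (mu : {measure set E -> \bar R}) (m : probability E R).
Hypothesis mE : forall A, measurable A -> m A = normalized mu A.

Section inputs.
Context d (T : measurableType d) (P : probability T R).
Variables (W : nat -> {RV P >-> E}).
Hypothesis hW : iid_inputs mu W.

Lemma process_chain (X0 : T -> S) k : process W X0 k = chain luckock_step W X0 k.
Proof. by apply/funext => w; elim: k => //= k ->. Qed.

Lemma inputs_law k A : measurable A -> P (W k @^-1` A) = m A.
Proof. by move=> mA; have [h _] := hW; rewrite mE// -(h k). Qed.

Lemma inputs_indep (F : {fset nat}) (A : nat -> set E) : (forall k, measurable (A k)) ->
  P (cylinder W F A) = \prod_(k <- F) P (W k @^-1` A k).
Proof. by move=> mA; have [_] := hW; exact. Qed.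

Lemma cst_indep dZ (Z : measurableType dZ) (z : Z) (F : {fset nat}) (A : nat -> set E)
    (B : set Z) : (forall k, measurable (A k)) -> measurable B ->
  P ((cst z : T -> Z) @^-1` B `&` cylinder W F A) = P ((cst z : T -> Z) @^-1` B) * P (cylinder W F A).
Proof.
move=> mA mB; rewrite preimage_cst; case: ifP => _.
  by rewrite setTI probability_setT mul1e.
by rewrite set0I measure0 mul0e.
Qed.

Local Notation hits0 := [set Sord0 Im Ip].

(** The return time is the number of k >= 0 at which no return has yet occurred, also when it is
    infinite. *)
Lemma return_time_sum w : return_time Im Ip W w =
  \sum_(0 <= k <oo) (\1_(no_hit luckock_step hits0 W (cst (Sord0 Im Ip)) k) w)%:E.
Proof.
pose X := process W (fun=> Sord0 Im Ip).
have nhE k : no_hit luckock_step hits0 W (cst (Sord0 Im Ip)) k =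
   [set w | forall j, (j < k)%N -> X j.+1 w <> Sord0 Im Ip].
  apply/seteqP; split => v /= h j jk; have := h j jk; rewrite /X process_chain//.
under eq_eseriesr => k _ do rewrite nhE.
have [[j hj]|nohit] := pselect (exists j, X j.+1 w = Sord0 Im Ip); last first.
  have -> : return_time Im Ip W w = +oo.
    rewrite /return_time (_ : [set _ | _ in _] = set0) ?ereal_inf0//.
    apply/seteqP; split => // y [[|k] [/= k0 hk] _]//.
    by apply: nohit; exists k.
  apply/esym/eqyP => A A0.
  apply: (@le_trans _ _ (\sum_(0 <= k < (Num.bound A).+1) (1%:E : \bar R))).
    rewrite sumEFin lee_fin sumr_const_nat subn0.
    have := archi_boundP (ltW A0) => /ltW /le_trans; apply.
    by rewrite ler_nat.
  apply: (@le_trans _ _ (\sum_(0 <= k < (Num.bound A).+1)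
     (\1_[set w | forall j, (j < k)%N -> X j.+1 w <> Sord0 Im Ip] w)%:E)).
    apply: lee_sum => k _; rewrite lee_fin indicE mem_set// => j _ hj.
    by apply: nohit; exists j.
  by apply: nneseries_lim_ge => k _; rewrite lee_fin.
have [j0 hj0 jmin] : exists2 j0, X j0.+1 w = Sord0 Im Ip &
    forall j, (j < j0)%N -> X j.+1 w <> Sord0 Im Ip.
  pose p k := `[< X k.+1 w = Sord0 Im Ip >].
  have ep : exists k, p k by exists j; apply/asboolP.
  exists (ex_minn ep); case: ex_minnP => k /asboolP pk mink//.
  by move=> i ik /asboolP pi; have := mink _ pi; rewrite leqNgt ik.
have indE k : (\1_[set w | forall j, (j < k)%N -> X j.+1 w <> Sord0 Im Ip] w : R) =
    ((k <= j0)%N)%:R.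
  rewrite indicE; congr (nat_of_bool _)%:R; apply/idP/idP.
    by move=> /set_mem /= h; rewrite leqNgt; apply/negP => /h.
  move=> kj; apply/mem_set => /= i ik; apply: jmin; exact: leq_trans ik kj.
transitivity (j0.+1%:R%:E : \bar R).
  apply/eqP; rewrite eq_le; apply/andP; split.
    by apply: ereal_inf_lbound; exists j0.+1.
  apply: le_ereal_inf_tmp => _ [[|k] [/= k0 hk] <-]//; rewrite lee_fin ler_nat ltnS.
  by rewrite leqNgt; apply/negP => /jmin.
apply/esym/cvg_lim => //; apply: cvg_near_cst.
exists j0.+1 => // n /= jn.
rewrite (big_cat_nat (n := j0.+1))//= (eq_big_nat _ _ (F2 := fun=> 1%:E)); last first.
  by move=> k /andP[_ kj]; rewrite indE -ltnS kj.
rewrite sumEFin sumr_const_nat subn0 [X in _ + X]big_nat_cond [X in _ + X]big1 ?adde0//.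
by move=> k /andP[/andP[jk _] _]; rewrite indE leqNgt jk.
Qed.

Lemma integral_return_time : \int[P]_w return_time Im Ip W w =
  \sum_(0 <= k <oo) survival m luckock_step hits0 k (Sord0 Im Ip).
Proof.
have mnh k := @measurable_no_hit _ _ _ _ _ _ measurable_luckock_step _ (@measurable_Sord0 R Im Ip)
  _ _ P W (cst (Sord0 Im Ip)) (measurable_cst _) k.
under eq_integral do rewrite return_time_sum.
rewrite integral_nneseries//; last first.
  by move=> k; apply/measurable_EFinP; exact: measurable_indic.
apply: eq_eseriesr => k _.
transitivity (P (no_hit luckock_step hits0 W (cst (Sord0 Im Ip)) k)).
  by rewrite integral_indic// setIT.
rewrite (@probability_no_hit _ _ _ _ _ m _ measurable_luckock_step _ (@measurable_Sord0 R Im Ip)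
  _ _ P W (cst (Sord0 Im Ip)) (measurable_cst _) inputs_law inputs_indep)//.
  rewrite (eq_integral (cst (survival m luckock_step hits0 k (Sord0 Im Ip))))//.
  by rewrite integral_cst//= probability_setT mule1.
exact: cst_indep.
Qed.

End inputs.
End process.

(** * First-order differential calculus along the clock lp - lm *)

Section ereal_continuity.
Context {R : realType} (Im Ip : \bar R).
Local Notation Ibar := (closed_itv Im Ip).

Lemma closed_itvP x : Ibar x <-> (Im <= x <= Ip).
Proof. by rewrite /closed_itv /= in_itv. Qed.

(** The extended line is metrised by [contract]; this form also serves at infinite endpoints. *)
Lemma ereal_within_cvg (F : \bar R -> R) s eps : {within Ibar, continuous F} ->
  Ibar s -> (0 < eps)%R -> exists2 delta : R, (0 < delta)%R &
  forall y, Ibar y -> (`|contract s - contract y| < delta)%R -> (`|F s - F y| < eps)%R.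
Proof.
move=> /subspace_continuousP/(_ s) cF Is e0.
have /cvgrPdist_lt/(_ eps e0) := cF Is.
rewrite near_withinE => /nbhs_ballP[delta /= d0 hd].
by exists delta => // y Iy yd; apply: hd.
Qed.

Lemma ereal_IVT (F : \bar R -> R) t : Im <= Ip -> {within Ibar, continuous F} ->
  (F Im <= t <= F Ip)%R -> exists2 z, Ibar z & F z = t.
Proof.
move=> hI cF /andP[h1 h2].
pose h r := F (expand r).
have cI : (contract Im <= contract Ip)%R by rewrite le_contract.
have c1 x : (contract Im <= x <= contract Ip)%R -> (`|x| <= 1)%R.
  move=> /andP[l1 l2]; have := contract_le1 Im; have := contract_le1 Ip.
  rewrite !ler_norml => /andP[_ l3] /andP[l4 _].
  by rewrite (le_trans l4)// (le_trans l2).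
have Ie x : (contract Im <= x <= contract Ip)%R -> Ibar (expand x).
  move=> xI; have x1 := c1 _ xI; apply/closed_itvP.
  by rewrite le_expandRL// le_expandLR.
have ch : {within `[contract Im, contract Ip], continuous h}.
  apply/subspace_continuousP => x; rewrite /= in_itv /= => xI.
  apply/cvgrPdist_lt => eps e0.
  have [delta d0 hd] := ereal_within_cvg cF (Ie _ xI) e0.
  rewrite near_withinE; apply/nbhs_ballP; exists delta => //= y.
  rewrite /ball /= => xy; rewrite in_itv /= => yI.
  apply: hd; first exact: Ie.
  by rewrite !expandK// inE; exact: c1.
have [] := @IVT _ h _ _ t cI ch; last first.
  by move=> c; rewrite in_itv /= => cc <-; exists (expand c) => //; exact: Ie.
rewrite /h !contractK; apply/andP; split.
  by rewrite ge_min h1.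
by rewrite le_max h2 orbT.
Qed.

End ereal_continuity.

Section calculus.
Context {R : realType} (Im Ip : \bar R) (lm lp : \bar R -> R).
Hypothesis hI : Im <= Ip.
Local Notation Ibar := (closed_itv Im Ip).
Hypothesis lm_cont : {within Ibar, continuous lm}.
Hypothesis lp_cont : {within Ibar, continuous lp}.
Hypothesis lm_noninc : forall x y, Ibar x -> Ibar y -> x <= y -> (lm y <= lm x)%R.
Hypothesis lp_nondec : forall x y, Ibar x -> Ibar y -> x <= y -> (lp x <= lp y)%R.
Hypothesis lm_ge0 : forall x, Ibar x -> (0 <= lm x)%R.
Hypothesis lp_ge0 : forall x, Ibar x -> (0 <= lp x)%R.

Let Lam x : R := (lp x - lm x)%R.

(* [dform F a b] reads [dF = a dlp + b dlm], with a remainder that is quadratic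
   in the increment of the common clock [lp - lm]. *)
Definition dform (F a b : \bar R -> R) : Prop := exists2 C : R,
  forall x, Ibar x -> [/\ `|F x| <= C, `|a x| <= C & `|b x| <= C]%R &
  forall x y, Ibar x -> Ibar y -> x <= y ->
    (`|F y - F x - a x * (lp y - lp x) - b x * (lm y - lm x)| <= C * (Lam y - Lam x) ^+ 2)%R.

Lemma Im_Ibar : Ibar Im. Proof. by apply/closed_itvP; rewrite lexx. Qed.
Lemma Ip_Ibar : Ibar Ip. Proof. by apply/closed_itvP; rewrite lexx andbT. Qed.

(** Cut the path from [Im] to [x] into n pieces with equal clock increments w/n. The quadratic
    remainders add up to n C (w/n)^2, which tends to 0. *)
Lemma dform_const F : dform F (cst 0%R) (cst 0%R) ->
  forall x, Ibar x -> F x = F Im.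
Proof.
move=> [C bC hC].
have {}hC x y : Ibar x -> Ibar y -> x <= y -> (`|F y - F x| <= C * (Lam y - Lam x) ^+ 2)%R.
  by move=> Ix Iy xy; have := hC _ _ Ix Iy xy; rewrite !mul0r !subr0.
have C0 : (0 <= C)%R by have [+ _ _] := bC _ Im_Ibar; apply: le_trans.
have Lmono x y : Ibar x -> Ibar y -> x <= y -> (Lam x <= Lam y)%R.
  by move=> Ix Iy xy; rewrite /Lam lerB// ?lp_nondec// lm_noninc.
(* The cutting points below are found by their clock values only and need not come in increasing
   order, so the estimate is needed for unordered pairs. *)
have hC' x y : Ibar x -> Ibar y -> (`|F y - F x| <= C * (Lam y - Lam x) ^+ 2)%R.
  move=> Ix Iy; have [xy|yx] := leP x y; first exact: hC.
  by rewrite distrC -sqrrN opprB; apply: hC => //; exact: ltW.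
move=> x Ix; apply/eqP; rewrite -subr_eq0 -normr_le0.
have /closed_itvP/andP[Imx xIp] := Ix.
pose w := (Lam x - Lam Im)%R.
have w0 : (0 <= w)%R by rewrite subr_ge0; exact: Lmono Im_Ibar Ix Imx.
have cL : {within Ibar, continuous Lam}.
  move: lp_cont lm_cont => /subspace_continuousP cp /subspace_continuousP cm.
  by apply/subspace_continuousP => z Iz; apply: cvgB; [exact: cp|exact: cm].
have bound n : (`|F x - F Im| <= C * w ^+ 2 / n.+1%:R)%R.
  have n0 : (0 < n.+1%:R :> R)%R by [].
  (* Intermediate value theorem for the clock; beyond the last index the point is a dummy. *)
  have ex (i : nat) : exists z, Ibar z /\ ((i <= n.+1)%N -> Lam z = Lam Im + w * i%:R / n.+1%:R)%R.
    have [iN|] := leqP i n.+1; last by exists Im; split => //; exact: Im_Ibar.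
    pose q := (w * i%:R / n.+1%:R)%R.
    suff /(ereal_IVT hI cL)[z Iz zE] : (Lam Im <= Lam Im + q <= Lam Ip)%R by exists z.
    have l1 : (0 <= q)%R by rewrite /q divr_ge0 ?mulr_ge0.
    have l2 : (q <= w)%R by rewrite /q ler_pdivrMr// ler_wpM2l// ler_nat.
    have l3 := Lmono _ _ Ix Ip_Ibar xIp.
    rewrite lerDl l1 /= -lerBrDl; apply: (le_trans l2).
    by rewrite /w lerB.
  have [z hz] := choice ex.
  have step i : (i < n.+1)%N -> (`|F (z i.+1) - F (z i)| <= C * (w / n.+1%:R) ^+ 2)%R.
    move=> iN; have [Ii Ei] := hz i; have [Ii1 Ei1] := hz i.+1.
    have := hC' _ _ Ii Ii1; rewrite Ei1// Ei; last exact: ltnW.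
    suff -> : (Lam Im + w * i.+1%:R / n.+1%:R - (Lam Im + w * i%:R / n.+1%:R) = w / n.+1%:R)%R by [].
    rewrite -[in LHS]natr1; field; by rewrite gt_eqF.
  have tel i : (i <= n.+1)%N -> (`|F (z i) - F (z 0%N)| <= i%:R * (C * (w / n.+1%:R) ^+ 2))%R.
    elim: i => [|i IH] iN; first by rewrite subrr normr0 mul0r.
    have := IH (ltnW iN); have := step i iN.
    have := ler_normD (F (z i.+1) - F (z i))%R (F (z i) - F (z 0%N))%R.
    rewrite addrA subrK => h1' h2' h3'; rewrite -[i.+1%:R]natr1 mulrDl mul1r; apply: (le_trans h1'); rewrite addrC lerD//.
  (* The first and last cutting points only share their clock values with [Im] and [x]; the
     quadratic estimate then forces equal values of [F]. *)
  have z0 : F (z 0%N) = F Im.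
    have [I0 E0] := hz 0%N; apply/eqP; rewrite -subr_eq0 -normr_le0.
    have := hC' _ _ Im_Ibar I0; rewrite E0// mulr0 mul0r addr0 subrr expr0n mulr0.
    by [].
  have zn : F (z n.+1) = F x.
    have [I0 E0] := hz n.+1; apply/eqP; rewrite -subr_eq0 -normr_le0.
    have := hC' _ _ Ix I0; rewrite E0// mulfK ?gt_eqF// /w [(_ + (_ - _))%R]addrC subrK subrr.
    by rewrite expr0n mulr0.
  have := tel n.+1 (leqnn _); rewrite z0 zn => /le_trans; apply.
  rewrite le_eqVlt; apply/orP; left; apply/eqP; field; by rewrite gt_eqF.
apply/ler_addgt0Pr => eps e0; rewrite add0r.
apply: le_trans (bound (Num.bound (C * w ^+ 2 / eps))) _.
rewrite ler_pdivrMr// [leRHS]mulrC -ler_pdivrMr//.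
have := archi_boundP (divr_ge0 (mulr_ge0 C0 (sqr_ge0 w)) (ltW e0)).
by move=> /ltW/le_trans; apply; rewrite ler_nat.
Qed.

Let W : R := (Lam Ip - Lam Im)%R.

Lemma incr_bounds x y : Ibar x -> Ibar y -> x <= y ->
  [/\ 0 <= lp y - lp x, lp y - lp x <= Lam y - Lam x, lm y - lm x <= 0,
      - (Lam y - Lam x) <= lm y - lm x & Lam y - Lam x <= W]%R.
Proof.
move=> Ix Iy xy; have h1 := lp_nondec Ix Iy xy; have h2 := lm_noninc Ix Iy xy.
have /closed_itvP/andP[Imx _] := Ix; have /closed_itvP/andP[_ yIp] := Iy.
have h3 := lp_nondec Im_Ibar Ix Imx; have h4 := lm_noninc Im_Ibar Ix Imx.
have h5 := lp_nondec Iy Ip_Ibar yIp; have h6 := lm_noninc Iy Ip_Ibar yIp.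
by rewrite /W /Lam; split; lra.
Qed.

Lemma lm_bounds x : Ibar x -> (lm Ip <= lm x <= lm Im)%R.
Proof.
move=> Ix; have /closed_itvP/andP[Imx xIp] := Ix.
by rewrite (lm_noninc Ix Ip_Ibar xIp) (lm_noninc Im_Ibar Ix Imx).
Qed.

Lemma lp_bounds x : Ibar x -> (lp Im <= lp x <= lp Ip)%R.
Proof.
move=> Ix; have /closed_itvP/andP[Imx xIp] := Ix.
by rewrite (lp_nondec Ix Ip_Ibar xIp) (lp_nondec Im_Ibar Ix Imx).
Qed.

Definition clock_lipschitz (F : \bar R -> R) : Prop := exists2 L : R,
  (0 <= L)%R & (forall x, Ibar x -> (`|F x| <= L)%R) /\
  forall x y, Ibar x -> Ibar y -> x <= y -> (`|F y - F x| <= L * (Lam y - Lam x))%R.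

Lemma dform_lipschitz F a b : dform F a b -> clock_lipschitz F.
Proof.
move=> [C bC hC].
have C0 : (0 <= C)%R by have [+ _ _] := bC _ Im_Ibar; apply: le_trans.
have [_ _ _ _ W0] := incr_bounds Im_Ibar Ip_Ibar hI.
have {}W0 : (0 <= W)%R.
  by have [l1 l2 _ _ _] := incr_bounds Im_Ibar Ip_Ibar hI; exact: le_trans l2.
exists (3 * C + C * W)%R; first by rewrite addr_ge0 ?mulr_ge0.
split=> [x Ix|x y Ix Iy xy].
  have [l _ _] := bC x Ix; apply: le_trans l _.
  have : (0 <= C * W)%R by rewrite mulr_ge0. lra.
have := hC _ _ Ix Iy xy; have [_ ba bb] := bC x Ix.
have [] := incr_bounds Ix Iy xy.
set p := (lp y - lp x)%R; set q := (lm y - lm x)%R; set D := (Lam y - Lam x)%R.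
set f := (F y - F x)%R => p0 pD q0 qD DW h.
have h1 : (`|a x * p| <= C * D)%R by rewrite normrM ler_pM// ger0_norm.
have h2 : (`|b x * q| <= C * D)%R by rewrite normrM ler_pM// ler0_norm// lerNl.
have h3 : (C * D ^+ 2 <= C * W * D)%R.
  by rewrite expr2 mulrA -[leRHS]mulrA [(W * _)%R]mulrC mulrA ler_wpM2l// mulr_ge0// (le_trans p0).
have -> : f = (f - a x * p - b x * q + (a x * p) + (b x * q))%R by ring.
apply: le_trans (ler_normD _ _) _; apply: le_trans (lerD (ler_normD _ _) (lexx _)) _.
rewrite mulrDl; have : (0 <= C * D)%R by rewrite mulr_ge0// (le_trans p0).
have -> : (3 * C * D = 3 * (C * D))%R by ring.
lra.
Qed.

Lemma dform_eq F a b F' a' b' : dform F a b ->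
  (forall x, Ibar x -> F x = F' x) -> (forall x, Ibar x -> a x = a' x) ->
  (forall x, Ibar x -> b x = b' x) -> dform F' a' b'.
Proof.
move=> [C bC hC] eF ea eb; exists C => [x Ix|x y Ix Iy xy].
  by have := bC x Ix; rewrite eF// ea// eb.
by have := hC x y Ix Iy xy; rewrite !eF// ea// eb.
Qed.

Let sqr0 x y : (0 <= (Lam y - Lam x) ^+ 2)%R := sqr_ge0 _.

Lemma dform_cst c : dform (cst c) (cst 0%R) (cst 0%R).
Proof.
exists `|c|%R => [x Ix|x y _ _ _] /=; first by rewrite normr0 lexx normr_ge0.
by rewrite subrr !mul0r !subr0 normr0 mulr_ge0.
Qed.

Lemma dform_lp : dform lp (cst 1%R) (cst 0%R).
Proof.
have h := lp_ge0 Ip_Ibar.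
exists (lp Ip + 1)%R => [x Ix|x y Ix Iy xy] /=.
  have /andP[l1 l2] := lp_bounds Ix; rewrite normr0 normr1 ger0_norm ?lp_ge0//.
  by split; lra.
by rewrite mul1r subrr mul0r subr0 normr0 mulr_ge0//; lra.
Qed.

Lemma dform_lm : dform lm (cst 0%R) (cst 1%R).
Proof.
have h := lm_ge0 Im_Ibar.
exists (lm Im + 1)%R => [x Ix|x y Ix Iy xy] /=.
  have /andP[l1 l2] := lm_bounds Ix; rewrite normr0 normr1 ger0_norm ?lm_ge0//.
  by split; lra.
by rewrite mul0r mul1r subr0 subrr normr0 mulr_ge0//; lra.
Qed.

Lemma dformD F a b G a' b' : dform F a b -> dform G a' b' ->
  dform (F \+ G)%R (a \+ a')%R (b \+ b')%R.
Proof.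
move=> [C bC hC] [C' bC' hC']; exists (C + C')%R => [x Ix|x y Ix Iy xy] /=.
  have [l1 l2 l3] := bC x Ix; have [l1' l2' l3'] := bC' x Ix.
  by split; apply: le_trans (ler_normD _ _) _; exact: lerD.
rewrite [leRHS]mulrDl; apply: (le_trans _ (lerD (hC _ _ Ix Iy xy) (hC' _ _ Ix Iy xy))).
apply: (le_trans _ (ler_normD _ _)); rewrite le_eqVlt; apply/orP; left; apply/eqP.
congr (`|_|)%R; ring.
Qed.

(** The product rule; the extra term, a product of two increments, is quadratic in the clock by
    [dform_lipschitz]. *)
Lemma dformM F a b G a' b' : dform F a b -> dform G a' b' ->
  dform (F \* G)%R (fun x => a x * G x + F x * a' x)%R (fun x => b x * G x + F x * b' x)%R.
Proof.
move=> dF dG; have [L L0 [_ hL]] := dform_lipschitz dF.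
have [L' L0' [_ hL']] := dform_lipschitz dG.
case: dF => [C bC hC]; case: dG => [C' bC' hC'].
have C0 : (0 <= C)%R by have [+ _ _] := bC _ Im_Ibar; apply: le_trans.
have C0' : (0 <= C')%R by have [+ _ _] := bC' _ Im_Ibar; apply: le_trans.
have CC : (0 <= C * C')%R by rewrite mulr_ge0.
have LL : (0 <= L * L')%R by rewrite mulr_ge0.
exists (2 * (C * C') + L * L')%R => [x Ix|x y Ix Iy xy] /=.
  have [l1 l2 l3] := bC x Ix; have [l1' l2' l3'] := bC' x Ix.
  have p (u v : R) : (`|u| <= C -> `|v| <= C' -> `|u * v| <= C * C')%R.
    by move=> ? ?; rewrite normrM ler_pM.
  split.
  - by apply: le_trans (p _ _ l1 l1') _; lra.
  - apply: le_trans (ler_normD _ _) _.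
    by have := p _ _ l2 l1'; have := p _ _ l1 l2'; lra.
  - apply: le_trans (ler_normD _ _) _.
    by have := p _ _ l3 l1'; have := p _ _ l1 l3'; lra.
have := hC _ _ Ix Iy xy; have := hC' _ _ Ix Iy xy.
have := hL _ _ Ix Iy xy; have := hL' _ _ Ix Iy xy.
have [bF _ _] := bC x Ix; have [bG _ _] := bC' x Ix.
set p := (lp y - lp x)%R; set q := (lm y - lm x)%R; set D := (Lam y - Lam x)%R.
have D0 : (0 <= D)%R by have [l1 l2 _ _ _] := incr_bounds Ix Iy xy; exact: le_trans l2.
move=> h1 h2 h3 h4.
have -> : (F y * G y - F x * G x - (a x * G x + F x * a' x) * p - (b x * G x + F x * b' x) * q =
  (F y - F x - a x * p - b x * q) * G x + F x * (G y - G x - a' x * p - b' x * q) +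
  (F y - F x) * (G y - G x))%R by ring.
apply: le_trans (ler_normD _ _) _; apply: le_trans (lerD (ler_normD _ _) (lexx _)) _.
have k1 : (`|(F y - F x - a x * p - b x * q) * G x| <= C * D ^+ 2 * C')%R.
  by rewrite normrM ler_pM.
have k2 : (`|F x * (G y - G x - a' x * p - b' x * q)| <= C * (C' * D ^+ 2))%R.
  by rewrite normrM ler_pM.
have k3 : (`|(F y - F x) * (G y - G x)| <= L * D * (L' * D))%R.
  by rewrite normrM ler_pM.
have -> : ((2 * (C * C') + L * L') * D ^+ 2 =
  C * D ^+ 2 * C' + C * (C' * D ^+ 2) + L * D * (L' * D))%R by ring.
lra.
Qed.

Lemma dformV F a b c : dform F a b -> (0 < c)%R -> (forall x, Ibar x -> c <= F x)%R ->
  dform (fun x => (F x)^-1)%R (fun x => - (a x / (F x) ^+ 2))%R (fun x => - (b x / (F x) ^+ 2))%R.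
Proof.
move=> dF c0 cF; have [L L0 [_ hL]] := dform_lipschitz dF.
case: dF => [C bC hC].
have C0 : (0 <= C)%R by have [+ _ _] := bC _ Im_Ibar; apply: le_trans.
have F0 x : Ibar x -> (0 < F x)%R by move=> /cF; exact: lt_le_trans.
have iF x : Ibar x -> (0 <= (F x)^-1 <= c^-1)%R.
  move=> Ix; rewrite invr_ge0 ltW ?F0//= lef_pV2 ?posrE ?F0//; exact: cF.
have iF2 x : Ibar x -> (0 <= (F x ^+ 2)^-1 <= (c ^+ 2)^-1)%R.
  move=> Ix; have /andP[i0 i1] := iF x Ix; rewrite -!exprVn exprn_ge0//=.
  by rewrite ler_pXn2r// nnegrE// invr_ge0 ltW.
have k1 : (0 <= C / c ^+ 2)%R by rewrite divr_ge0// exprn_ge0// ltW.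
have k2 : (0 <= L ^+ 2 / c ^+ 3)%R by rewrite divr_ge0// exprn_ge0// ltW.
have k3 : (0 <= c^-1)%R by rewrite invr_ge0 ltW.
exists (c^-1 + C / c ^+ 2 + L ^+ 2 / c ^+ 3)%R => [x Ix|x y Ix Iy xy].
  have /andP[i0 i1] := iF x Ix; have /andP[j0 j1] := iF2 x Ix.
  have [_ ba bb] := bC x Ix; rewrite !normrN ger0_norm//.
  have p (u : R) : (`|u| <= C -> `|u / F x ^+ 2| <= C / c ^+ 2)%R.
    by move=> ?; rewrite normrM ler_pM// ger0_norm.
  by split; [|have := p _ ba|have := p _ bb]; lra.
have := hC _ _ Ix Iy xy; have := hL _ _ Ix Iy xy.
set p := (lp y - lp x)%R; set q := (lm y - lm x)%R; set D := (Lam y - Lam x)%R.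
move=> h1 h2.
have /andP[i0 i1] := iF y Iy; have /andP[j0 j1] := iF2 x Ix.
have -> : ((F y)^-1 - (F x)^-1 - - (a x / F x ^+ 2) * p - - (b x / F x ^+ 2) * q =
  - ((F y - F x - a x * p - b x * q) / F x ^+ 2) + (F y - F x) ^+ 2 * ((F x ^+ 2)^-1 * (F y)^-1))%R.
  by field; rewrite !gt_eqF ?F0.
apply: le_trans (ler_normD _ _) _; rewrite normrN.
have e1 : (`|(F y - F x - a x * p - b x * q) / F x ^+ 2| <= C * D ^+ 2 / c ^+ 2)%R.
  by rewrite normrM ler_pM// ger0_norm.
have e2 : (`|(F y - F x) ^+ 2 * ((F x ^+ 2)^-1 * (F y)^-1)| <= (L * D) ^+ 2 * ((c ^+ 2)^-1 * c^-1))%R.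
  rewrite normrM ler_pM//.
    by rewrite normrX ler_pXn2r// nnegrE// (le_trans _ h1).
  by rewrite ger0_norm ?mulr_ge0// ler_pM.
have -> : ((c^-1 + C / c ^+ 2 + L ^+ 2 / c ^+ 3) * D ^+ 2 = c^-1 * D ^+ 2 +
   (C * D ^+ 2 / c ^+ 2 + (L * D) ^+ 2 * ((c ^+ 2)^-1 * c^-1)))%R.
  by field; rewrite gt_eqF.
have : (0 <= c^-1 * D ^+ 2)%R by rewrite mulr_ge0// sqr_ge0.
lra.
Qed.

End calculus.

(** * Indefinite integrals against the measures of incoming orders *)

Lemma integrable_bounded d (T : measurableType d) (R : realType)
    (m : {finite_measure set T -> \bar R}) (D : set T) (g : T -> R) (M : R) :
  measurable D -> measurable_fun D g -> (forall u, D u -> `|g u| <= M)%R ->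
  m.-integrable D (EFin \o g).
Proof.
move=> mD mg gM; apply: measurable_bounded_integrable => //.
  by rewrite ltey_eq fin_num_measure.
exists M; split; first exact: num_real.
by move=> x Mx u Du; apply: le_trans (gM u Du) _; exact: ltW.
Qed.

Lemma Rintegral_near_cst d (T : measurableType d) (R : realType)
    (m : {finite_measure set T -> \bar R}) (D : set T) (g : T -> R) (c e : R) :
  measurable D -> measurable_fun D g -> (forall u, D u -> `|g u - c| <= e)%R ->
  (`|(\int[m]_(u in D) g u)%R - c * fine (m D)| <= e * fine (m D))%R.
Proof.
move=> mD mg ge.
have ic (c' : R) : m.-integrable D (EFin \o cst c').
  by apply: (@integrable_bounded _ _ _ _ _ _ `|c'|%R) => // u _; exact: lexx.
have ig : m.-integrable D (EFin \o g).
  apply: (@integrable_bounded _ _ _ _ _ _ (e + `|c|)%R) => // u Du.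
  have := ge u Du; have := ler_normD (g u - c)%R c; rewrite subrK; lra.
have mgc : measurable_fun D (fun u => (g u - c)%R) by apply: measurable_funB.
have igc : m.-integrable D (EFin \o (fun u => g u - c)%R).
  by apply: (@integrable_bounded _ _ _ _ _ _ e).
rewrite -Rintegral_cst// -RintegralB//; last exact: ic.
apply: le_trans (le_normr_Rintegral mD igc) _.
rewrite -Rintegral_cst//; apply: le_Rintegral => //; last exact: ic.
apply: (@integrable_bounded _ _ _ _ _ _ e) => //.
  by apply: measurableT_comp.

by move=> u Du /=; rewrite normr_id; exact: ge.
Qed.

Section ereal_monotone.
Context {R : realType} (Im Ip : \bar R).
Local Notation Ibar := (closed_itv Im Ip).

Lemma measurable_Ibar : measurable (Ibar : set (\bar R)).
Proof. exact: emeasurable_itv. Qed.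

Lemma measurable_initial (A : set (\bar R)) : A `<=` Ibar ->
  (forall x y, A x -> Ibar y -> y <= x -> A y) -> measurable A.
Proof.
move=> AI Ad; pose s := ereal_sup A.
have up x : A x -> x <= s by move=> Ax; exact: ereal_sup_ubound.
have dn x : Ibar x -> x < s -> A x.
  by move=> Ix /ereal_sup_gt[y Ay xy]; apply: Ad Ay Ix _; exact: ltW.
have [As|nAs] := pselect (A s).
  have -> : A = Ibar `&` `]-oo, s]%classic.
    apply/seteqP; split=> x; first by move=> Ax; split; [exact: AI|rewrite /= in_itv /= up].
    by move=> [Ix] /=; rewrite in_itv /=; exact: Ad.
  by apply: measurableI; [exact: measurable_Ibar|exact: emeasurable_itv].
have -> : A = Ibar `&` `]-oo, s[%classic.
  apply/seteqP; split=> x.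
    move=> Ax; split; first exact: AI.
    rewrite /= in_itv /= lt_neqAle up// andbT; apply/eqP => xs.
    by rewrite xs in Ax.
  by move=> [Ix] /=; rewrite in_itv /=; exact: dn.
by apply: measurableI; [exact: measurable_Ibar|exact: emeasurable_itv].
Qed.

Lemma measurable_nonincr (g : \bar R -> R) :
  (forall x y, Ibar x -> Ibar y -> x <= y -> (g y <= g x)%R) -> measurable_fun Ibar g.
Proof.
move=> gm; apply: (measurability (@RGenOInfty.G R)); first exact: RGenOInfty.measurableE.
move=> _ [_ [r ->] <-]; apply: measurable_initial; first by move=> x [].
move=> x y [Ix]; rewrite /= !in_itv /= !andbT => rx Iy yx; split => //=.
by rewrite (lt_le_trans rx)// gm.
Qed.

Lemma measurable_nondecr (g : \bar R -> R) :
  (forall x y, Ibar x -> Ibar y -> x <= y -> (g x <= g y)%R) -> measurable_fun Ibar g.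
Proof.
move=> gm; have -> : g = (\- (\- g))%R by apply/funext => x /=; rewrite opprK.
by apply: measurable_funN; apply: measurable_nonincr => x y Ix Iy xy; rewrite lerN2 gm.
Qed.

End ereal_monotone.

Section integrals.
Context {R : realType} (Im Ip : \bar R) (lm lp : \bar R -> R).
Hypothesis hI : Im <= Ip.
Local Notation Ibar := (closed_itv Im Ip).
Hypothesis lm_noninc : forall x y, Ibar x -> Ibar y -> x <= y -> (lm y <= lm x)%R.
Hypothesis lp_nondec : forall x y, Ibar x -> Ibar y -> x <= y -> (lp x <= lp y)%R.
Variables mum mup : {finite_measure set \bar R -> \bar R}.
Hypothesis mumE : forall x, Ibar x -> mum `[x, Ip]%classic = (lm x)%:E.
Hypothesis mupE : forall x, Ibar x -> mup `[Im, x]%classic = (lp x)%:E.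

Local Notation dform := (dform Im Ip lm lp).
Local Notation clock_lipschitz := (clock_lipschitz Im Ip lm lp).


Lemma mum_co x y : Ibar x -> Ibar y -> x <= y -> mum `[x, y[%classic = (lm x - lm y)%:E.
Proof.
move=> Ix Iy xy; have /closed_itvP/andP[_ yIp] := Iy.
have : mum `[x, Ip]%classic = mum `[x, y[%classic + mum `[y, Ip]%classic.
  rewrite -measureU//; try exact: emeasurable_itv.
    by rewrite -itv_bndbnd_setU ?bnd_simp.
  apply/seteqP; split=> z // []; rewrite /= !in_itv /= => /andP[_ h1] /andP[h2 _].
  by have := lt_le_trans h1 h2; rewrite ltxx.
rewrite !mumE//; case: (mum `[x, y[%classic) => //= r [->].
by rewrite addrK.
Qed.

Lemma mup_oc x y : Ibar x -> Ibar y -> x <= y -> mup `]x, y]%classic = (lp y - lp x)%:E.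
Proof.
move=> Ix Iy xy; have /closed_itvP/andP[Imx _] := Ix.
have : mup `[Im, y]%classic = mup `[Im, x]%classic + mup `]x, y]%classic.
  rewrite -measureU//; try exact: emeasurable_itv.
    by rewrite -itv_bndbnd_setU ?bnd_simp.
  apply/seteqP; split=> z // []; rewrite /= !in_itv /= => /andP[_ h1] /andP[h2 _].
  by have := le_lt_trans h1 h2; rewrite ltxx.
rewrite !mupE//; case: (mup `]x, y]%classic) => //= r [->].
by rewrite addrAC subrr add0r.
Qed.

Let sub_co x y : Ibar x -> Ibar y -> `[x, y[ `<=` Ibar.
Proof.
move=> /closed_itvP/andP[l1 l2] /closed_itvP/andP[l3 l4] z; rewrite /= in_itv /= => /andP[l5 l6].
by apply/closed_itvP; rewrite (le_trans l1)//= (le_trans (ltW l6)).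
Qed.

Let sub_oc x y : Ibar x -> Ibar y -> `]x, y] `<=` Ibar.
Proof.
move=> /closed_itvP/andP[l1 l2] /closed_itvP/andP[l3 l4] z; rewrite /= in_itv /= => /andP[l5 l6].
by apply/closed_itvP; rewrite (le_trans l1 (ltW l5))//= (le_trans l6).
Qed.

Let bound (m : {finite_measure set \bar R -> \bar R}) (D : set (\bar R)) (g : \bar R -> R) (L : R) :
  measurable D -> D `<=` Ibar -> measurable_fun Ibar g -> (0 <= L)%R ->
  (forall x, Ibar x -> `|g x| <= L)%R ->
  (`|\int[m]_(u in D) g u| <= L * fine (m Ibar))%R.
Proof.
move=> mD DI mg L0 gL.
have := @Rintegral_near_cst _ _ _ m D g 0%R L mD.
rewrite mul0r subr0 => /(_ _ _)/le_trans; apply.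
- by apply: measurable_funS mg => //; exact: measurable_Ibar.
- by move=> u /DI /gL; rewrite subr0.
rewrite ler_wpM2l// fine_le ?fin_num_measure//; try exact: measurable_Ibar.
by apply: le_measure => //; rewrite in_setE//; exact: measurable_Ibar.
Qed.

(** [mum] of [[x, y[] is lm x - lm y, so [mum] acts as - dlm; the remainder comes from freezing [g]
    at the left endpoint. *)
Lemma dform_integral_m g : clock_lipschitz g -> measurable_fun Ibar g ->
  dform (fun x => \int[mum]_(u in `[Im, x[) g u)%R (cst 0%R) (\- g)%R.
Proof.
move=> [L L0 [gL hL]] mg.
have M0 : (0 <= fine (mum Ibar))%R by exact: fine_ge0.
have LM : (0 <= L * fine (mum Ibar))%R by rewrite mulr_ge0.
exists (L + L * fine (mum Ibar))%R => [x Ix|x y Ix Iy xy] /=.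
  rewrite normr0 normrN; split; [|by lra|by have := gL x Ix; lra].
  have : (`|\int[mum]_(u in `[Im, x[) g u| <= L * fine (mum Ibar))%R.
    by apply: bound => //; [exact: emeasurable_itv|apply: sub_co => //; exact: Im_Ibar].
  lra.
have Im0 := @Im_Ibar _ _ _ hI.
have mD : measurable `[x, y[%classic by exact: emeasurable_itv.
have mgD : measurable_fun `[x, y[%classic g.
  by apply: measurable_funS mg; [exact: measurable_Ibar|exact: sub_co].
have [p0 pD q0 qD _] := incr_bounds hI lm_noninc lp_nondec Ix Iy xy.
have near u : `[x, y[%classic u -> (`|g u - g x| <= L * ((lp y - lm y) - (lp x - lm x)))%R.
  move=> uxy; have Iu := sub_co Ix Iy uxy.
  move: uxy; rewrite /= in_itv /= => /andP[xu uy].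
  apply: le_trans (hL _ _ Ix Iu xu) _; apply: ler_wpM2l => //; rewrite lerD2r.
  by apply: lerB; [apply: lp_nondec|apply: lm_noninc] => //; exact: ltW.
have -> : (\int[mum]_(u in `[Im, y[) g u - \int[mum]_(u in `[Im, x[) g u =
    \int[mum]_(u in `[x, y[) g u)%R.
  have /closed_itvP/andP[Imx _] := Ix.
  have -> : `[Im, y[%classic = `[Im, x[%classic `|` `[x, y[%classic.
    by rewrite -itv_bndbnd_setU ?bnd_simp.
  rewrite Rintegral_setU//; try exact: emeasurable_itv.
  - by rewrite addrAC subrr add0r.
  - rewrite -itv_bndbnd_setU ?bnd_simp//.
    apply: (@integrable_bounded _ _ _ _ _ _ L); first exact: emeasurable_itv.
      by apply: measurable_funS mg; [exact: measurable_Ibar|exact: sub_co].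
    by move=> u /(sub_co Im0 Iy)/gL.
  - apply/disj_setPS => z [] /=; rewrite !in_itv /= => /andP[_ h1] /andP[h2 _].
    by have := lt_le_trans h1 h2; rewrite ltxx.
have := @Rintegral_near_cst _ _ _ mum _ g (g x) _ mD mgD near.
rewrite mum_co//= mul0r subr0 => h.
have -> : (- g x * (lm y - lm x) = g x * (lm x - lm y))%R by ring.
apply: le_trans h _.
move: p0 pD q0 qD; set D := ((lp y - lm y) - (lp x - lm x))%R => p0 pD q0 qD.
have D0 : (0 <= D)%R by exact: le_trans pD.
rewrite expr2 mulrA -mulrA; apply: (@le_trans _ _ (L * (D * D))%R).
  by apply: ler_wpM2l => //; apply: ler_wpM2l => //; lra.
by rewrite -mulrA ler_wpM2r ?mulr_ge0//; lra.
Qed.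

Lemma dform_integral_p g : clock_lipschitz g -> measurable_fun Ibar g ->
  dform (fun x => \int[mup]_(u in `]Im, x]) g u)%R g (cst 0%R).
Proof.
move=> [L L0 [gL hL]] mg.
have M0 : (0 <= fine (mup Ibar))%R by exact: fine_ge0.
have LM : (0 <= L * fine (mup Ibar))%R by rewrite mulr_ge0.
have Im0 := @Im_Ibar _ _ _ hI.
exists (L + L * fine (mup Ibar))%R => [x Ix|x y Ix Iy xy] /=.
  rewrite normr0; split; [|by have := gL x Ix; lra|by lra].
  have : (`|\int[mup]_(u in `]Im, x]) g u| <= L * fine (mup Ibar))%R.
    by apply: bound => //; [exact: emeasurable_itv|apply: sub_oc => //; exact: Im_Ibar].
  lra.
have mD : measurable `]x, y]%classic by exact: emeasurable_itv.
have mgD : measurable_fun `]x, y]%classic g.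
  by apply: measurable_funS mg; [exact: measurable_Ibar|exact: sub_oc].
have [p0 pD q0 qD _] := incr_bounds hI lm_noninc lp_nondec Ix Iy xy.
have near u : `]x, y]%classic u -> (`|g u - g x| <= L * ((lp y - lm y) - (lp x - lm x)))%R.
  move=> uxy; have Iu := sub_oc Ix Iy uxy.
  move: uxy; rewrite /= in_itv /= => /andP[xu uy].
  apply: le_trans (hL _ _ Ix Iu (ltW xu)) _; apply: ler_wpM2l => //; rewrite lerD2r.
  by apply: lerB; [apply: lp_nondec|apply: lm_noninc].
have -> : (\int[mup]_(u in `]Im, y]) g u - \int[mup]_(u in `]Im, x]) g u =
    \int[mup]_(u in `]x, y]) g u)%R.
  have /closed_itvP/andP[Imx _] := Ix.
  have -> : `]Im, y]%classic = `]Im, x]%classic `|` `]x, y]%classic.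
    by rewrite -itv_bndbnd_setU ?bnd_simp.
  rewrite Rintegral_setU//; try exact: emeasurable_itv.
  - by rewrite addrAC subrr add0r.
  - rewrite -itv_bndbnd_setU ?bnd_simp//.
    apply: (@integrable_bounded _ _ _ _ _ _ L); first exact: emeasurable_itv.
      by apply: measurable_funS mg; [exact: measurable_Ibar|exact: sub_oc].
    by move=> u /(sub_oc Im0 Iy)/gL.
  - apply/disj_setPS => z [] /=; rewrite !in_itv /= => /andP[_ h1] /andP[h2 _].
    by have := le_lt_trans h1 h2; rewrite ltxx.
have := @Rintegral_near_cst _ _ _ mup _ g (g x) _ mD mgD near.
rewrite mup_oc//= mul0r subr0 => h.
apply: le_trans h _.
move: p0 pD q0 qD; set D := ((lp y - lm y) - (lp x - lm x))%R => p0 pD q0 qD.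
have D0 : (0 <= D)%R by exact: le_trans pD.
rewrite expr2 mulrA -mulrA; apply: (@le_trans _ _ (L * (D * D))%R).
  by apply: ler_wpM2l => //; apply: ler_wpM2l.
by rewrite -mulrA ler_wpM2r ?mulr_ge0//; lra.
Qed.

End integrals.

(** * Order weights whose drift does not depend on the best prices *)

Section weights.
Context {R : realType} (Im Ip : \bar R) (lm lp : \bar R -> R).
Hypothesis hI : Im <= Ip.
Local Notation Ibar := (closed_itv Im Ip).
Hypothesis lm_cont : {within Ibar, continuous lm}.
Hypothesis lp_cont : {within Ibar, continuous lp}.
Hypothesis lm_noninc : forall x y, Ibar x -> Ibar y -> x <= y -> (lm y <= lm x)%R.
Hypothesis lp_nondec : forall x y, Ibar x -> Ibar y -> x <= y -> (lp x <= lp y)%R.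
Hypothesis lp_gt0 : (0 < lp Im)%R.
Hypothesis lm_gt0 : (0 < lm Ip)%R.
Variables mum mup : {finite_measure set \bar R -> \bar R}.
Hypothesis mumE : forall x, Ibar x -> mum `[x, Ip]%classic = (lm x)%:E.
Hypothesis mupE : forall x, Ibar x -> mup `[Im, x]%classic = (lp x)%:E.

Local Notation dform := (dform Im Ip lm lp).
Local Notation clock_lipschitz := (clock_lipschitz Im Ip lm lp).

Let Im0 : Ibar Im := Im_Ibar hI.
Let Ip0 : Ibar Ip := Ip_Ibar hI.

Let lmp x : Ibar x -> (0 < lm x)%R.
Proof. by move=> Ix; have /andP[h _] := lm_bounds hI lm_noninc Ix; exact: lt_le_trans h. Qed.

Let lpp x : Ibar x -> (0 < lp x)%R.
Proof. by move=> Ix; have /andP[h _] := lp_bounds hI lp_nondec Ix; exact: lt_le_trans h. Qed.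

Let lm_ge0 x : Ibar x -> (0 <= lm x)%R. Proof. by move=> /lmp/ltW. Qed.
Let lp_ge0 x : Ibar x -> (0 <= lp x)%R. Proof. by move=> /lpp/ltW. Qed.

Let dlm : dform lm (cst 0%R) (cst 1%R). Proof. exact: dform_lm. Qed.
Let dlp : dform lp (cst 1%R) (cst 0%R). Proof. exact: dform_lp. Qed.

(** With [gp], the coefficients of the differential d(1/(lp lm)) = - gm dlm - gp dlp. *)
Definition gm (x : \bar R) : R := ((lp x)^-1 * ((lm x)^-1 * (lm x)^-1))%R.
Definition gp (x : \bar R) : R := ((lm x)^-1 * ((lp x)^-1 * (lp x)^-1))%R.

Let dilm : dform (fun x => (lm x)^-1)%R (fun x => - (cst 0 x / lm x ^+ 2))%R
  (fun x => - (cst 1 x / lm x ^+ 2))%R.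
Proof.
apply: (dformV hI lm_noninc lp_nondec dlm lm_gt0) => x Ix.
by have /andP[] := lm_bounds hI lm_noninc Ix.
Qed.

Let dilp : dform (fun x => (lp x)^-1)%R (fun x => - (cst 1 x / lp x ^+ 2))%R
  (fun x => - (cst 0 x / lp x ^+ 2))%R.
Proof.
apply: (dformV hI lm_noninc lp_nondec dlp lp_gt0) => x Ix.
by have /andP[] := lp_bounds hI lp_nondec Ix.
Qed.

Let dM F a b G a' b' : dform F a b -> dform G a' b' ->
  dform (F \* G)%R (fun x => a x * G x + F x * a' x)%R (fun x => b x * G x + F x * b' x)%R.
Proof. exact: dformM. Qed.

Lemma gm_lipschitz : clock_lipschitz gm.
Proof. exact: (dform_lipschitz hI lm_noninc lp_nondec (dM dilp (dM dilm dilm))). Qed.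

Lemma gp_lipschitz : clock_lipschitz gp.
Proof. exact: (dform_lipschitz hI lm_noninc lp_nondec (dM dilm (dM dilp dilp))). Qed.

Let milm : measurable_fun Ibar (fun x => (lm x)^-1 : R)%R.
Proof.
apply: measurable_nondecr => x y Ix Iy xy.
by rewrite lef_pV2 ?posrE ?lmp// lm_noninc.
Qed.

Let milp : measurable_fun Ibar (fun x => (lp x)^-1 : R)%R.
Proof.
apply: measurable_nonincr => x y Ix Iy xy.
by rewrite lef_pV2 ?posrE ?lpp// lp_nondec.
Qed.

Lemma measurable_gm : measurable_fun Ibar gm.
Proof. by apply: measurable_funM => //; exact: measurable_funM. Qed.

Lemma measurable_gp : measurable_fun Ibar gp.
Proof. by apply: measurable_funM => //; exact: measurable_funM. Qed.

Lemma gm_ge0 x : Ibar x -> (0 <= gm x)%R.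
Proof. by move=> Ix; rewrite /gm !mulr_ge0// invr_ge0 ?lm_ge0 ?lp_ge0. Qed.

Lemma gp_ge0 x : Ibar x -> (0 <= gp x)%R.
Proof. by move=> Ix; rewrite /gp !mulr_ge0// invr_ge0 ?lm_ge0 ?lp_ge0. Qed.

Definition Gm (x : \bar R) : R := (\int[mum]_(u in `[Im, x[) gm u)%R.
(** The integral of [gp] over []x, Ip]], written as a difference so that [dform_integral_p] gives
    its differential. *)
Definition Gp (x : \bar R) : R :=
  (\int[mup]_(u in `]Im, Ip]) gp u - \int[mup]_(u in `]Im, x]) gp u)%R.

Lemma dGm : dform Gm (cst 0%R) (\- gm)%R.
Proof. exact: (dform_integral_m hI lm_noninc lp_nondec mumE gm_lipschitz measurable_gm). Qed.

Lemma dGp : dform Gp (\- gp)%R (cst 0%R).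
Proof.
have d0 := dform_integral_p hI lm_noninc lp_nondec mupE gp_lipschitz measurable_gp.
have d1 := dM (dform_cst Im Ip lm lp (-1)%R) d0.
have := dformD (dform_cst Im Ip lm lp (\int[mup]_(u in `]Im, Ip]) gp u)%R) d1.
move/dform_eq; apply => x Ix /=; rewrite /Gp; ring.
Qed.

Lemma Gm_Im : Gm Im = 0%R.
Proof. by rewrite /Gm set_itvxx Rintegral_set0. Qed.

Lemma Gp_Ip : Gp Ip = 0%R.
Proof. by rewrite /Gp subrr. Qed.

Lemma Gm_ge0 x : Ibar x -> (0 <= Gm x)%R.
Proof.
move=> /closed_itvP/andP[l1 l2]; apply: Rintegral_ge0 => u; rewrite /= in_itv /= => /andP[h1 h2].
by apply: gm_ge0; apply/closed_itvP; rewrite h1 (le_trans (ltW h2)).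
Qed.

Lemma Gm_nondec x y : Ibar x -> Ibar y -> x <= y -> (Gm x <= Gm y)%R.
Proof.
move=> Ix Iy xy; have [L L0 [gL _]] := gm_lipschitz.
have sub z : Ibar z -> `[Im, z[ `<=` Ibar.
  move=> /closed_itvP/andP[l1 l2] u; rewrite /= in_itv /= => /andP[h1 h2].
  by apply/closed_itvP; rewrite h1 (le_trans (ltW h2)).
have int z : Ibar z -> mum.-integrable `[Im, z[ (EFin \o gm).
  move=> Iz; apply: (@integrable_bounded _ _ _ _ _ _ L); first exact: emeasurable_itv.
    apply: measurable_funS measurable_gm; [exact: measurable_Ibar|exact: sub].
  by move=> u /(sub _ Iz); exact: gL.
rewrite /Gm /Rintegral; apply: fine_le.
- by apply: integrable_fin_num (int _ Ix); exact: emeasurable_itv.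
- by apply: integrable_fin_num (int _ Iy); exact: emeasurable_itv.
apply: ge0_subset_integral; try exact: emeasurable_itv.
- by have /integrableP[] := int _ Iy.
- by move=> u /(sub _ Iy) /gm_ge0; rewrite lee_fin.
- by apply: subset_itvl; rewrite bnd_simp.
Qed.

Lemma Gp_noninc x y : Ibar x -> Ibar y -> x <= y -> (Gp y <= Gp x)%R.
Proof.
move=> Ix Iy xy; have [L L0 [gL _]] := gp_lipschitz.
have sub z : Ibar z -> `]Im, z] `<=` Ibar.
  move=> /closed_itvP/andP[l1 l2] u; rewrite /= in_itv /= => /andP[h1 h2].
  by apply/closed_itvP; rewrite ltW// (le_trans h2).
have int z : Ibar z -> mup.-integrable `]Im, z] (EFin \o gp).
  move=> Iz; apply: (@integrable_bounded _ _ _ _ _ _ L); first exact: emeasurable_itv.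
    apply: measurable_funS measurable_gp; [exact: measurable_Ibar|exact: sub].
  by move=> u /(sub _ Iz); exact: gL.
rewrite /Gp lerD2l lerN2 /Rintegral; apply: fine_le.
- by apply: integrable_fin_num (int _ Ix); exact: emeasurable_itv.
- by apply: integrable_fin_num (int _ Iy); exact: emeasurable_itv.
apply: ge0_subset_integral; try exact: emeasurable_itv.
- by have /integrableP[] := int _ Iy.
- by move=> u /(sub _ Iy) /gp_ge0; rewrite lee_fin.
- by apply: subset_itvl; rewrite bnd_simp.
Qed.

Lemma Gp_ge0 x : Ibar x -> (0 <= Gp x)%R.
Proof.
move=> Ix; have /closed_itvP/andP[_ xIp] := Ix.
by have := Gp_noninc Ix Ip0 xIp; rewrite Gp_Ip.
Qed.

Definition slack : R := ((lp Im)^-1 * (lm Im)^-1 - Gp Im)%R.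

(** [Gm] + [Gp] and 1/(lp lm) have the same differential, and [slack] is their difference at
    [Im]. *)
Lemma GmGp x : Ibar x -> (Gm x + Gp x + slack = (lp x)^-1 * (lm x)^-1)%R.
Proof.
move=> Ix.
have d1 := dM (dform_cst Im Ip lm lp (-1)%R) (dformD dGm dGp).
have d2 := dformD (dM dilp dilm) d1.
have d3 : dform (fun x => (lp x)^-1 * (lm x)^-1 - Gm x - Gp x)%R (cst 0%R) (cst 0%R).
  apply: dform_eq d2 _ _ _ => y Iy /=; rewrite ?/gm ?/gp; try ring;
    by field; rewrite ?gt_eqF ?lmp ?lpp.
have := dform_const hI lm_cont lp_cont lm_noninc lp_nondec d3 Ix.
rewrite Gm_Im /slack; lra.
Qed.

Section shifted.
Variables al be : R.
Hypothesis al_be : (al + be = slack)%R.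

(** The weights of a resting sell order and, in [wminus], of a resting buy order. The constraint on
    al + be leaves one free parameter. *)
Definition wplus (x : \bar R) : R := (al + Gm x)%R.
Definition wminus (x : \bar R) : R := (be + Gp x)%R.

Lemma wsum x : Ibar x -> (wplus x + wminus x = (lp x)^-1 * (lm x)^-1)%R.
Proof. by move=> Ix; rewrite -GmGp// -al_be /wplus /wminus; ring. Qed.

Lemma dwplus : dform wplus (cst 0%R) (\- gm)%R.
Proof.
have := dformD (dform_cst Im Ip lm lp al) dGm.
by move/dform_eq; apply => x Ix //=; rewrite add0r.
Qed.

Lemma dwminus : dform wminus (\- gp)%R (cst 0%R).
Proof.
have := dformD (dform_cst Im Ip lm lp be) dGp.
by move/dform_eq; apply => x Ix //=; rewrite add0r.
Qed.

Lemma measurable_wplus : measurable_fun Ibar wplus.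
Proof.
by apply: measurable_nondecr => x y Ix Iy xy; rewrite lerD2l Gm_nondec.
Qed.

Lemma measurable_wminus : measurable_fun Ibar wminus.
Proof.
by apply: measurable_nonincr => x y Ix Iy xy; rewrite lerD2l Gp_noninc.
Qed.

Lemma wplus_lipschitz : clock_lipschitz wplus.
Proof. exact: (dform_lipschitz hI lm_noninc lp_nondec dwplus). Qed.

Lemma wminus_lipschitz : clock_lipschitz wminus.
Proof. exact: (dform_lipschitz hI lm_noninc lp_nondec dwminus). Qed.

(** Since lm gm = 1/(lp lm) = wplus + wminus, the product rule gives d(lm wplus) = (wplus - 1/(lp
    lm)) dlm = - wminus dlm, and [mum] acts as - dlm. *)
Lemma integral_wminus x : Ibar x ->
  (\int[mum]_(u in `[Im, x[) wminus u = lm x * wplus x - lm Im * al)%R.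
Proof.
move=> Ix.
have d0 := dform_integral_m hI lm_noninc lp_nondec mumE wminus_lipschitz measurable_wminus.
have d1 := dM (dform_cst Im Ip lm lp (-1)%R) (dM dlm dwplus).
have d2 := dformD d0 d1.
have d3 : dform (fun x => \int[mum]_(u in `[Im, x[) wminus u - lm x * wplus x)%R (cst 0%R) (cst 0%R).
  apply: dform_eq d2 _ _ _ => y Iy /=; try ring.
  have -> : (wminus y = (lp y)^-1 * (lm y)^-1 - wplus y)%R by rewrite -wsum//; ring.
  rewrite /gm; move: (wplus y) => w.
  by field; rewrite ?gt_eqF ?lmp ?lpp.
have := dform_const hI lm_cont lp_cont lm_noninc lp_nondec d3 Ix.
by rewrite set_itvxx Rintegral_set0 /wplus Gm_Im; lra.
Qed.

Lemma integral_wplus x : Ibar x ->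
  (\int[mup]_(u in `]Im, Ip]) wplus u - \int[mup]_(u in `]Im, x]) wplus u =
   lp x * wminus x - lp Ip * be)%R.
Proof.
move=> Ix.
have d0 := dform_integral_p hI lm_noninc lp_nondec mupE wplus_lipschitz measurable_wplus.
have d2 := dformD d0 (dM dlp dwminus).
have d3 : dform (fun x => \int[mup]_(u in `]Im, x]) wplus u + lp x * wminus x)%R (cst 0%R) (cst 0%R).
  apply: dform_eq d2 _ _ _ => y Iy /=; try ring.
  have -> : (wplus y = (lp y)^-1 * (lm y)^-1 - wminus y)%R by rewrite -wsum//; ring.
  rewrite /gp; move: (wminus y) => w.
  by field; rewrite ?gt_eqF ?lmp ?lpp.
have h1 := dform_const hI lm_cont lp_cont lm_noninc lp_nondec d3 Ix.
have h2 := dform_const hI lm_cont lp_cont lm_noninc lp_nondec d3 Ip0.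
move: h1 h2; rewrite /wminus Gp_Ip addr0; lra.
Qed.

End shifted.

(** An atom at [Im] would be a jump of [lm] there. Buy orders at the price [Im] never enter the
    book, so their mass would spoil the drift formula. *)
Lemma mum_Im : Im < Ip -> mum [set Im] = 0.
Proof.
move=> ltI; apply/eqP; rewrite eq_le measure_ge0 andbT; apply/lee_addgt0Pr => e e0.
rewrite add0e.
have [delta d0 hd] := ereal_within_cvg lm_cont Im0 e0.
have [y [Iy Imy ly]] : exists y, [/\ Ibar y, Im < y & (`|contract Im - contract y| < delta)%R].
  have cI : (contract Im < contract Ip)%R by rewrite lt_contract.
  (* A point slightly to the right of [Im], chosen in contracted coordinates because [Im] may be
     infinite. *)
  pose c := Num.min (contract Ip) (contract Im + delta / 2)%R.
  have c1 : (contract Im < c)%R by rewrite lt_min cI ltrDl divr_gt0.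
  have c2 : (c <= contract Ip)%R by rewrite ge_min lexx.
  have c3 : (`|c| <= 1)%R.
    have := contract_le1 Im; have := contract_le1 Ip; rewrite !ler_norml.
    move=> /andP[_ h1] /andP[h2 _]; apply/andP; split; first by apply: le_trans h2 (ltW c1).
    exact: le_trans c2 h1.
  exists (expand c); split.
  - by apply/closed_itvP; rewrite le_expandRL// ltW//= le_expandLR.
  - by rewrite lt_expandRL.
  - rewrite expandK// ltr0_norm ?subr_lt0// opprB.
    have : (c <= contract Im + delta / 2)%R by rewrite ge_min lexx orbT.
    lra.
apply: (@le_trans _ _ (mum `[Im, y[%classic)).
  apply: le_measure; rewrite ?in_setE//; first exact: emeasurable_itv.
  by move=> _ ->; rewrite /= in_itv /= lexx.
rewrite (mum_co mumE)//; last exact: ltW.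
rewrite lee_fin; have := hd y Iy ly; rewrite ltr_norml => /andP[_ h]; exact: ltW.
Qed.

Lemma mup_Ip : Im < Ip -> mup [set Ip] = 0.
Proof.
move=> ltI; apply/eqP; rewrite eq_le measure_ge0 andbT; apply/lee_addgt0Pr => e e0.
rewrite add0e.
have [delta d0 hd] := ereal_within_cvg lp_cont Ip0 e0.
have [y [Iy yIp ly]] : exists y, [/\ Ibar y, y < Ip & (`|contract Ip - contract y| < delta)%R].
  have cI : (contract Im < contract Ip)%R by rewrite lt_contract.
  pose c := Num.max (contract Im) (contract Ip - delta / 2)%R.
  have c1 : (c < contract Ip)%R by rewrite gt_max cI gtrBl divr_gt0.
  have c2 : (contract Im <= c)%R by rewrite le_max lexx.
  have c3 : (`|c| <= 1)%R.
    have := contract_le1 Im; have := contract_le1 Ip; rewrite !ler_norml.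
    move=> /andP[_ h1] /andP[h2 _]; apply/andP; split; first by apply: le_trans h2 c2.
    exact: le_trans (ltW c1) h1.
  exists (expand c); split.
  - by apply/closed_itvP; rewrite le_expandRL// c2 le_expandLR// ltW.
  - by rewrite lt_expandLR.
  - rewrite expandK// gtr0_norm ?subr_gt0//.
    have : (contract Ip - delta / 2 <= c)%R by rewrite le_max lexx orbT.
    lra.
apply: (@le_trans _ _ (mup `]y, Ip]%classic)).
  apply: le_measure; rewrite ?in_setE//; first exact: emeasurable_itv.
  by move=> _ ->; rewrite /= in_itv /= lexx yIp.
rewrite (mup_oc mupE)//; last exact: ltW.
rewrite lee_fin; have := hd y Iy ly; rewrite ltr_norml => /andP[_ h]; exact: ltW.
Qed.

End weights.

Lemma Rintegral_negligible d (T : measurableType d) (R : realType)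
    (m : {finite_measure set T -> \bar R}) (D N : set T) (f : T -> R) :
  measurable D -> measurable N -> m.-integrable D (EFin \o f) -> m N = 0 ->
  (\int[m]_(x in D) f x = \int[m]_(x in D `\` N) f x)%R.
Proof.
by move=> mD mN fi N0; rewrite /Rintegral (@negligible_integral _ _ _ m D N).
Qed.

(** * The drift of the potentials *)

Section signed_input.
Context {R : realType} (Im Ip : \bar R) (lm lp : \bar R -> R).
Local Notation E := (\bar R * bool)%type.
Variables mum mup : {finite_measure set \bar R -> \bar R}.
Variables (mu : {measure set E -> \bar R}) (m : probability E R).
Hypothesis muE : forall A, measurable A ->
  mu (A `*` [set false]) = mum A /\ mu (A `*` [set true]) = mup A.
Hypothesis mE : forall A, measurable A -> m A = normalized mu A.

Let pairb (b : bool) (u : \bar R) : E := (u, b).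

Let mpair b : measurable_fun setT (pairb b).
Proof. exact: measurable_fun_pair. Qed.

Let pb b : {mfun \bar R >-> E} := mfun_Sub (mem_set (mpair b)).

Lemma mu_split A : measurable A ->
  mu A = mum (pairb false @^-1` A) + mup (pairb true @^-1` A).
Proof.
move=> mA; have mp b : measurable (pairb b @^-1` A).
  by rewrite -[X in measurable X]setTI; exact: mpair.
have [h1 _] := muE (mp false); have [_ h2] := muE (mp true).
rewrite -h1 -h2 -measureU; [| by apply: measurableX | by apply: measurableX | ].
  congr (mu _); apply/seteqP; split=> [[u []] Au|[u b] [[/= Au ->]//|[/= Au ->]//]].
    by right.
  by left.
by apply/seteqP; split=> // -[u b] [[_ /= ->] [_ /=]].
Qed.

Lemma integral_input (h : E -> \bar R) : measurable_fun setT h -> (forall w, 0 <= h w) ->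
  \int[m]_w h w = (fine (mu setT))^-1%:E *
    (\int[mum]_u h (u, false) + \int[mup]_u h (u, true)).
Proof.
move=> mh h0.
have c0 : (0 <= (fine (mu setT))^-1)%R by rewrite invr_ge0 fine_ge0.
pose k : {nonneg R} := NngNum c0.
have ex (n : {finite_measure set \bar R -> \bar R}) b :
    exists Q : {measure set E -> \bar R}, forall A, Q A = pushforward n (pb b) A.
  by exists (measure_function_pushforward__canonical__measure_function_Measure n (mpair b)).
have [P0 P0E] := ex mum false; have [P1 P1E] := ex mup true.
transitivity (\int[mscale k (measure_add P0 P1)]_w h w).
  apply: eq_measure_integral => A mA _.
  transitivity (normalized mu A); first exact: mE.
  transitivity ((fine (mu setT))^-1%:E * measure_add P0 P1 A); last by [].
  by rewrite /normalized; congr (_ * _); rewrite mu_split// measure_addE P0E P1E.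
rewrite ge0_integral_mscale//; congr (_ * _).
rewrite ge0_integral_measure_add//.
have -> : \int[P0]_w h w = \int[pushforward mum (pb false)]_w h w.
  by apply: eq_measure_integral => A _ _; rewrite P0E.
have -> : \int[P1]_w h w = \int[pushforward mup (pb true)]_w h w.
  by apply: eq_measure_integral => A _ _; rewrite P1E.
by rewrite !ge0_integral_pushforward.
Qed.

(** Adding the bound [M] makes the integrand nonnegative and reduces the claim to [integral_input];
    the added constants cancel because [m] has mass 1. *)
Lemma Rintegral_input (h : E -> R) (M : R) : measurable_fun setT h ->
  (forall w, `|h w| <= M)%R ->
  (\int[m]_w h w = (fine (mu setT))^-1 *
    (\int[mum]_u h (u, false) + \int[mup]_u h (u, true)))%R.
Proof.
move=> mh hM.
have M0 : (0 <= M)%R by apply: le_trans (hM point).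
have mhb b : measurable_fun setT (fun u => h (u, b)).
  exact: (measurable_fun_pair1 b mh).
have c0 : fine (mu setT) != 0%R \/ fine (mu setT) = 0%R.
  by case: eqVneq => e; [right|left].
have hp w : 0 <= (h w + M)%:E by rewrite lee_fin; have := hM w; rewrite ler_norml; lra.
have mhM : measurable_fun setT (fun w => (h w + M)%:E).
  by apply/measurable_EFinP; exact: measurable_funD.
have := integral_input mhM hp.
have e d (T : measurableType d) (n : {finite_measure set T -> \bar R}) (g : T -> R) :
    measurable_fun setT g -> (forall w, `|g w| <= M)%R ->
    \int[n]_w (g w + M)%:E = ((\int[n]_w g w)%R + M * fine (n setT))%:E.
  move=> mg gM.
  have ig : n.-integrable setT (EFin \o g) by apply: (@integrable_bounded _ _ _ _ _ _ M).
  have iM : n.-integrable setT (EFin \o cst M).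
    by apply: (@integrable_bounded _ _ _ _ _ _ `|M|%R) => // u _; exact: lexx.
  rewrite -Rintegral_cst// -RintegralD// /Rintegral fineK//.
  apply: integrable_fin_num => //.
  exact: (integrableD _ ig iM).
have em : \int[m]_w (h w + M)%:E = ((\int[m]_w h w)%R + M)%:E.
  transitivity (((\int[m]_w h w)%R + M * fine (m setT))%:E); first exact: e.
  by rewrite probability_setT mulr1.
rewrite em (e _ _ mum _ (mhb false) (fun u => hM _))
  (e _ _ mup _ (mhb true) (fun u => hM _)).
have muT : mu setT = mum setT + mup setT by rewrite mu_split// !preimage_setT.
have m1 : m setT = 1 by rewrite probability_setT.
rewrite -EFinD -EFinM => -[].
have := m1; rewrite mE// /normalized muT fineD ?fin_num_measure//.
rewrite -(fineK (fin_num_measure mum _ measurableT)) -(fineK (fin_num_measure mup _ measurableT)).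
rewrite -EFinD -EFinM => -[].
set x := fine (mum setT); set y := fine (mup setT); set c := ((x + y)^-1)%R => cE.
set A := (\int[m]_w h w)%R; set B := (\int[mum]_w h (w, false))%R.
set C := (\int[mup]_w h (w, true))%R => h1.
have -> : (c * (B + C) = c * (B + M * x + (C + M * y)) - M * (c * (x + y)))%R by ring.
by rewrite -h1 cE mulr1 addrK.
Qed.

End signed_input.

Section drift.
Context {R : realType} (Im Ip : \bar R) (lm lp : \bar R -> R).
Hypothesis ltI : Im < Ip.
Let hI : Im <= Ip := ltW ltI.
Local Notation Ibar := (closed_itv Im Ip).
Hypothesis lm_cont : {within Ibar, continuous lm}.
Hypothesis lp_cont : {within Ibar, continuous lp}.
Hypothesis lm_noninc : forall x y, Ibar x -> Ibar y -> x <= y -> (lm y <= lm x)%R.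
Hypothesis lp_nondec : forall x y, Ibar x -> Ibar y -> x <= y -> (lp x <= lp y)%R.
Hypothesis lp_gt0 : (0 < lp Im)%R.
Hypothesis lm_gt0 : (0 < lm Ip)%R.
Variables mum mup : {finite_measure set \bar R -> \bar R}.
Hypothesis mumE : forall x, Ibar x -> mum `[x, Ip]%classic = (lm x)%:E.
Hypothesis mupE : forall x, Ibar x -> mup `[Im, x]%classic = (lp x)%:E.
Hypothesis mumC : mum (~` Ibar) = 0.
Hypothesis mupC : mup (~` Ibar) = 0.

Variables al be : R.
Hypothesis al_be : (al + be)%R = slack Im Ip lm lp mup.
Local Notation wplus := (wplus Im lm lp mum al).
Local Notation wminus := (wminus Im Ip lm lp mup be).

Let Im0 : Ibar Im := Im_Ibar hI.
Let Ip0 : Ibar Ip := Ip_Ibar hI.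
Let mI : measurable Ibar := measurable_Ibar Im Ip.

Let measure0U (n : {finite_measure set \bar R -> \bar R}) (A B : set (\bar R)) :
  measurable A -> measurable B -> n A = 0 -> n B = 0 -> n (A `|` B) = 0.
Proof.
move=> mA mB nA nB; apply/eqP; rewrite eq_le measure_ge0 andbT.
apply: le_trans (measureU2 n mA mB) _; change (n A + n B <= 0); by rewrite nA nB adde0.
Qed.

(** Used with [M] the best sell price and [v] the weight of the order sitting there, in which case
    the two terms containing [M] cancel; for an empty sell side [M] is [Ip] and [v] is 0. *)
Lemma drift_minus (M : \bar R) (v : R) (h : \bar R -> R) : Im < M -> M <= Ip ->
  (forall u, h u = if (M <= u)%E then - v else if (Im < u)%E then wminus (fine u)%:E else 0)%R ->
  measurable_fun setT h -> (exists B, forall u, `|h u| <= B)%R ->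
  (\int[mum]_u h u = lm M * wplus M - lm Im * al - v * lm M)%R.
Proof.
move=> ImM MIp hE mh [B hB].
have IM : Ibar M by apply/closed_itvP; rewrite ltW.
have ih D : measurable D -> mum.-integrable D (EFin \o h).
  move=> mD; apply: (@integrable_bounded _ _ _ _ _ _ B) => //.
  by apply: measurable_funTS.
(* Neither the complement of [Ibar] nor the point [Im] carries mass; the rest splits at [M] into
   orders that rest and orders that trade. *)
rewrite (@Rintegral_negligible _ _ _ _ _ (~` Ibar `|` [set Im]))//; last 3 first.
- by apply: measurableU => //; exact: measurableC.
- exact: ih.
- apply: measure0U => //; first exact: measurableC.
  exact: (mum_Im hI lm_cont mumE ltI).
have -> : setT `\` (~` Ibar `|` [set Im]) = `]Im, M[ `|` `[M, Ip].
  apply/seteqP; split=> u /=; rewrite !in_itv /=.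
    move=> [_ /not_orP[/contrapT h0 /eqP h3]].
    have /closed_itvP/andP[h1 h2] : Ibar u := h0.
    have lu : Im < u by rewrite lt_neqAle eq_sym h3.
    by have [?|?] := ltP u M; [left; rewrite lu|right; rewrite h2].
  move=> [/andP[h1 h2]|/andP[h1 h2]]; split => //; apply/not_orP; split.
  - by apply; apply/closed_itvP; rewrite ltW//= (le_trans (ltW h2)).
  - by move=> e; rewrite e ltxx in h1.
  - by apply; apply/closed_itvP; rewrite h2 (le_trans (ltW ImM)).
  - by move=> e; rewrite e leNgt ImM in h1.
rewrite Rintegral_setU; try exact: emeasurable_itv; last 2 first.
- by apply: ih; apply: measurableU; exact: emeasurable_itv.
- apply/disj_setPS => u []; rewrite /= !in_itv /= => /andP[_ h1] /andP[h2 _].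
  by have := lt_le_trans h1 h2; rewrite ltxx.
have -> : (\int[mum]_(u in `[M, Ip]) h u = - v * lm M)%R.
  transitivity (\int[mum]_(u in `[M, Ip]) (- v))%R.
    by apply: eq_Rintegral => u; rewrite in_setE /= in_itv /= => /andP[Mu _]; rewrite hE Mu.
  transitivity (- v * fine (mum `[M, Ip]%classic))%R; last by rewrite mumE.
  by apply: Rintegral_cst; exact: emeasurable_itv.
have -> : (\int[mum]_(u in `]Im, M[) h u = \int[mum]_(u in `]Im, M[) wminus u)%R.
  apply: eq_Rintegral => u; rewrite in_setE /= in_itv /= => /andP[h1 h2].
  rewrite hE leNgt h2 /= h1 fineK// fin_numE; apply/andP; split.
    by apply/eqP => e; rewrite e ltNge leNye in h1.
  by apply/eqP => e; rewrite e ltNge leey in h2.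
have -> : `]Im, M[%classic = `[Im, M[ `\` [set Im].
  apply/seteqP; split=> u /=; rewrite !in_itv /=.
    by move=> /andP[h1 ->]; rewrite ltW//; split => // e; rewrite e ltxx in h1.
  by move=> [/andP[h1 ->] /eqP h2]; rewrite lt_neqAle eq_sym h2 h1.
rewrite -Rintegral_negligible; first last.
- exact: (mum_Im hI lm_cont mumE ltI).
- have [L L0 [wL _]] := wminus_lipschitz hI lm_noninc lp_nondec lp_gt0 lm_gt0 mupE be.
  have sub : `[Im, M[ `<=` Ibar.
    move=> u; rewrite /= in_itv /= => /andP[h1 h2]; apply/closed_itvP.
    by rewrite h1 (le_trans (ltW h2)).
  apply: (@integrable_bounded _ _ _ _ _ _ L); first exact: emeasurable_itv.
    apply: measurable_funS (measurable_wminus hI lm_noninc lp_nondec lp_gt0 lm_gt0 mup be) => //.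
  by move=> u /sub; exact: wL.
- by [].
- exact: emeasurable_itv.
by rewrite (integral_wminus hI lm_cont lp_cont lm_noninc lp_nondec lp_gt0 lm_gt0 mumE mupE al_be IM) mulNr.
Qed.

Lemma drift_plus (M : \bar R) (v : R) (h : \bar R -> R) : Im <= M -> M < Ip ->
  (forall u, h u = if (u <= M)%E then - v else if (u < Ip)%E then wplus (fine u)%:E else 0)%R ->
  measurable_fun setT h -> (exists B, forall u, `|h u| <= B)%R ->
  (\int[mup]_u h u = lp M * wminus M - lp Ip * be - v * lp M)%R.
Proof.
move=> ImM MIp hE mh [B hB].
have IM : Ibar M by apply/closed_itvP; rewrite ImM ltW.
have ih D : measurable D -> mup.-integrable D (EFin \o h).
  move=> mD; apply: (@integrable_bounded _ _ _ _ _ _ B) => //.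
  by apply: measurable_funTS.
rewrite (@Rintegral_negligible _ _ _ _ _ (~` Ibar `|` [set Ip]))//; last 3 first.
- by apply: measurableU => //; exact: measurableC.
- exact: ih.
- apply: measure0U => //; first exact: measurableC.
  exact: (mup_Ip hI lp_cont mupE ltI).
have -> : setT `\` (~` Ibar `|` [set Ip]) = `[Im, M] `|` `]M, Ip[.
  apply/seteqP; split=> u /=; rewrite !in_itv /=.
    move=> [_ /not_orP[/contrapT h0 /eqP h3]].
    have /closed_itvP/andP[h1 h2] : Ibar u := h0.
    have lu : u < Ip by rewrite lt_neqAle h3.
    by have [?|?] := leP u M; [left; rewrite h1|right; rewrite lu].
  move=> [/andP[h1 h2]|/andP[h1 h2]]; split => //; apply/not_orP; split.
  - by apply; apply/closed_itvP; rewrite h1 (le_trans h2 (ltW MIp)).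
  - by move=> e; rewrite e leNgt MIp in h2.
  - by apply; apply/closed_itvP; rewrite (le_trans ImM (ltW h1)) ltW.
  - by move=> e; rewrite e ltxx in h2.
rewrite Rintegral_setU; try exact: emeasurable_itv; last 2 first.
- by apply: ih; apply: measurableU; exact: emeasurable_itv.
- apply/disj_setPS => u []; rewrite /= !in_itv /= => /andP[_ h1] /andP[h2 _].
  by have := le_lt_trans h1 h2; rewrite ltxx.
have -> : (\int[mup]_(u in `[Im, M]) h u = - v * lp M)%R.
  transitivity (\int[mup]_(u in `[Im, M]) (- v))%R.
    by apply: eq_Rintegral => u; rewrite in_setE /= in_itv /= => /andP[_ Mu]; rewrite hE Mu.
  transitivity (- v * fine (mup `[Im, M]%classic))%R; last by rewrite mupE.
  by apply: Rintegral_cst; exact: emeasurable_itv.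
have -> : (\int[mup]_(u in `]M, Ip[) h u = \int[mup]_(u in `]M, Ip[) wplus u)%R.
  apply: eq_Rintegral => u; rewrite in_setE /= in_itv /= => /andP[h1 h2].
  rewrite hE leNgt h1 /= h2 fineK// fin_numE; apply/andP; split.
    by apply/eqP => e; rewrite e ltNge leNye in h1.
  by apply/eqP => e; rewrite e ltNge leey in h2.
have -> : `]M, Ip[%classic = `]M, Ip] `\` [set Ip].
  apply/seteqP; split=> u /=; rewrite !in_itv /=.
    by move=> /andP[-> h1]; rewrite ltW//; split => // e; rewrite e ltxx in h1.
  by move=> [/andP[-> h1] /eqP h2]; rewrite lt_neqAle h2 h1.
have [L L0 [wL _]] := wplus_lipschitz hI lm_noninc lp_nondec lp_gt0 lm_gt0 mumE al.
have iw D : measurable D -> D `<=` Ibar -> mup.-integrable D (EFin \o wplus).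
  move=> mD sub; apply: (@integrable_bounded _ _ _ _ _ _ L) => //.
    exact: measurable_funS (measurable_wplus hI lm_noninc lp_nondec lp_gt0 lm_gt0 mum al).
  by move=> u /sub; exact: wL.
have sub x : Ibar x -> `]x, Ip] `<=` Ibar.
  move=> /closed_itvP/andP[h0 _] u; rewrite /= in_itv /= => /andP[h1 h2]; apply/closed_itvP.
  by rewrite (le_trans h0 (ltW h1)).
rewrite -Rintegral_negligible; first last.
- exact: (mup_Ip hI lp_cont mupE ltI).
- by apply: iw; [exact: emeasurable_itv|exact: sub].
- by [].
- exact: emeasurable_itv.
have := integral_wplus hI lm_cont lp_cont lm_noninc lp_nondec lp_gt0 lm_gt0 mumE mupE al_be IM.
have -> : `]Im, Ip]%classic = `]Im, M] `|` `]M, Ip].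
  by rewrite -itv_bndbnd_setU ?bnd_simp// ltW.
rewrite Rintegral_setU; try exact: emeasurable_itv; last 2 first.
- apply: iw; first by apply: measurableU; exact: emeasurable_itv.
  rewrite -itv_bndbnd_setU ?bnd_simp//; last exact: ltW.
  exact: sub.
- apply/disj_setPS => u []; rewrite /= !in_itv /= => /andP[_ h1] /andP[h2 _].
  by have := le_lt_trans h1 h2; rewrite ltxx.
lra.
Qed.

End drift.

Section state_drift.
Context {R : realType} (Im Ip : \bar R) (lm lp : \bar R -> R).
Hypothesis ltI : Im < Ip.
Let hI : Im <= Ip := ltW ltI.
Local Notation Ibar := (closed_itv Im Ip).
Hypothesis lm_cont : {within Ibar, continuous lm}.
Hypothesis lp_cont : {within Ibar, continuous lp}.
Hypothesis lm_noninc : forall x y, Ibar x -> Ibar y -> x <= y -> (lm y <= lm x)%R.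
Hypothesis lp_nondec : forall x y, Ibar x -> Ibar y -> x <= y -> (lp x <= lp y)%R.
Hypothesis lp_gt0 : (0 < lp Im)%R.
Hypothesis lm_gt0 : (0 < lm Ip)%R.
Variables mum mup : {finite_measure set \bar R -> \bar R}.
Hypothesis mumE : forall x, Ibar x -> mum `[x, Ip]%classic = (lm x)%:E.
Hypothesis mupE : forall x, Ibar x -> mup `[Im, x]%classic = (lp x)%:E.
Hypothesis mumC : mum (~` Ibar) = 0.
Hypothesis mupC : mup (~` Ibar) = 0.
Local Notation E := (\bar R * bool)%type.
Variables (mu : {measure set E -> \bar R}) (m : probability E R).
Hypothesis muE : forall A, measurable A ->
  mu (A `*` [set false]) = mum A /\ mu (A `*` [set true]) = mup A.
Hypothesis mE : forall A, measurable A -> m A = normalized mu A.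
Local Notation S := (Sord Im Ip).
Local Notation SF := (Sfin Im Ip).

Let Im0 : Ibar Im := Im_Ibar hI.
Let Ip0 : Ibar Ip := Ip_Ibar hI.

(** The clock is continuous, so the weights are admissible test functions for weak convergence; this
    is what makes the potentials Borel. *)
Lemma clock_lipschitz_bounded_continuous F : clock_lipschitz Im Ip lm lp F ->
  bounded_continuous_on Im Ip (fun x : R => F x%:E).
Proof.
move=> [L L0 [bF lF]].
have IE x : open_itv Im Ip x -> Ibar x%:E.
  by move=> /andP[h1 h2]; apply/closed_itvP; rewrite !ltW.
split; last by exists L => x /IE; exact: bF.
apply/subspace_continuousP => x Ix.
apply/cvgrPdist_lt => e e0.
(* [L + 1] replaces [L], which may vanish. *)
have e'0 : (0 < e / (2 * (L + 1)))%R by rewrite divr_gt0// mulr_gt0//; lra.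
have L1 : (0 < 2 * (L + 1))%R by lra.
have [d1 d10 h1] := ereal_within_cvg lm_cont (IE _ Ix) e'0.
have [d2 d20 h2] := ereal_within_cvg lp_cont (IE _ Ix) e'0.
have near : \forall y \near (x%:E : \bar R), (`|contract x%:E - contract y| < Num.min d1 d2)%R.
  have d0 : (0 < Num.min d1 d2)%R by rewrite lt_min d10.
  by apply/nbhs_ballP; exists (Num.min d1 d2).
rewrite near_withinE.
have nearR : \forall y \near x, (`|contract x%:E - contract y%:E| < Num.min d1 d2)%R.
  exact: near.
apply: filterS nearR => y; rewrite lt_min => /andP[l1 l2] Iy.
have {}h1 := h1 _ (IE _ Iy) l1; have {}h2 := h2 _ (IE _ Iy) l2.
have key a b : (a <= b)%R -> open_itv Im Ip a -> open_itv Im Ip b ->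
    (`|lm a%:E - lm b%:E| < e / (2 * (L + 1)))%R -> (`|lp a%:E - lp b%:E| < e / (2 * (L + 1)))%R ->
    (`|F b%:E - F a%:E| < e)%R.
  move=> ab Ia Ib k1 k2; apply: le_lt_trans (lF _ _ (IE _ Ia) (IE _ Ib) _) _; first by rewrite lee_fin.
  have : (lp b%:E - lm b%:E - (lp a%:E - lm a%:E) <= 2 * (e / (2 * (L + 1))))%R.
    by move: k1 k2; rewrite !ltr_norml; lra.
  move=> /(ler_wpM2l L0)/le_lt_trans; apply.
  have -> : (L * (2 * (e / (2 * (L + 1)))) = e * (L / (L + 1)))%R by field; lra.
  by rewrite -[ltRHS]mulr1 ltr_pM2l// ltr_pdivrMr ?mul1r; lra.
have [xy|/ltW yx] := leP x y.
  by rewrite distrC; apply: key.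
by apply: key => //; rewrite distrC.
Qed.

Variables al be : R.
Hypothesis al_be : (al + be)%R = slack Im Ip lm lp mup.
Local Notation wplus := (wplus Im lm lp mum al).
Local Notation wminus := (wminus Im Ip lm lp mup be).

Definition wp (x : R) : R := wplus x%:E.
Definition wm (x : R) : R := wminus x%:E.
Definition potential (X : S) : R := lsum wp wm X.

Lemma wp_bounded_continuous : bounded_continuous_on Im Ip wp.
Proof.
apply: (@clock_lipschitz_bounded_continuous wplus).
exact: (wplus_lipschitz hI lm_noninc lp_nondec lp_gt0 lm_gt0 mumE).
Qed.

Lemma wm_bounded_continuous : bounded_continuous_on Im Ip wm.
Proof.
apply: (@clock_lipschitz_bounded_continuous wminus).
exact: (wminus_lipschitz hI lm_noninc lp_nondec lp_gt0 lm_gt0 mupE).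
Qed.

Lemma measurable_potential : measurable_fun SF potential.
Proof. exact: (measurable_lsum wp_bounded_continuous wm_bounded_continuous). Qed.

Lemma measurable_luckock_input (X : S) : measurable_fun setT (fun w : E => luckock_map w X).
Proof. exact: (measurable_fun_pair1 X (measurable_luckock ltI)). Qed.

Lemma measurable_potential_step (X : S) : SF X ->
  measurable_fun setT (fun w : E => potential (luckock_map w X)).
Proof.
move=> SX; apply: measurable_comp measurable_potential (measurable_luckock_input X).
- exact: measurable_Sfin.
- by move=> _ [w _ <-]; exact: Sfin_luckock.
Qed.

(** A step adds or removes at most one order, and the weights are bounded on the open interval. *)
Lemma potential_lip : exists2 B : R, (0 <= B)%R & forall X w, SF X ->
  (`|potential (luckock_map w X) - potential X| <= B)%R.
Proof.
have [_ [B1 hB1]] := wp_bounded_continuous.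
have [_ [B2 hB2]] := wm_bounded_continuous.
exists (`|B1| + `|B2|)%R; first by rewrite addr_ge0.
have {}hB1 x : open_itv Im Ip x -> (`|wp x| <= `|B1| + `|B2|)%R.
  by move=> /hB1; have := ler_norm B1; have := normr_ge0 B2; lra.
have {}hB2 x : open_itv Im Ip x -> (`|wm x| <= `|B1| + `|B2|)%R.
  by move=> /hB2; have := ler_norm B2; have := normr_ge0 B1; lra.
have B0 : (0 <= `|B1| + `|B2|)%R by rewrite addr_ge0.
have Ifine u : Im < u -> u < Ip -> open_itv Im Ip (fine u).
  move=> h1 h2; rewrite /open_itv /= fineK ?h1 ?h2// fin_numE; apply/andP; split.
    by apply/eqP => e; rewrite e ltNge leNye in h1.
  by apply/eqP => e; rewrite e ltNge leey in h2.
move=> X [u b] SX; rewrite /potential; case: b.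
  rewrite lsum_sell// addrAC subrr add0r; case: ifPn => [um|].
    rewrite normrN /best_buy; case: ifPn => [|b0]; first by rewrite normr0.
    by have [x xb ->] := Mminus_mem SX b0; apply: hB2; exact: buys_itv xb.
  rewrite -ltNge => mu'; case: ifPn => [uI|]; last by rewrite normr0.
  apply: hB1; apply: Ifine => //; apply: le_lt_trans mu'.
  by apply: ereal_sup_ubound; left.
rewrite lsum_buy// addrAC subrr add0r; case: ifPn => [um|].
  rewrite normrN /best_sell; case: ifPn => [|b0]; first by rewrite normr0.
  by have [x xb ->] := Mplus_mem SX b0; apply: hB1; exact: sells_itv xb.
rewrite -ltNge => mu'; case: ifPn => [uI|]; last by rewrite normr0.
apply: hB2; apply: Ifine => //; apply: lt_le_trans mu' _.
by apply: ereal_inf_lbound; left.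
Qed.

Definition drift_rate (X : S) : R :=
  (- lm Im * al - lp Ip * be + (if sells X == [::] then lm Ip * wplus Ip else 0) +
   (if buys X == [::] then lp Im * wminus Im else 0))%R.

(** On a nonempty side, the executed order has exactly the weight that cancels the boundary term of
    [integral_wminus] or [integral_wplus], so the best prices drop out. On an empty side nothing is
    executed, and the boundary term at [Ip] or [Im] survives. *)
Lemma state_drift (X : S) : SF X ->
  (\int[m]_w (potential (luckock_map w X) - potential X) =
   (fine (mu setT))^-1 * drift_rate X)%R.
Proof.
move=> SX; have [B B0 hB] := potential_lip.
have mh : measurable_fun setT (fun w : E => potential (luckock_map w X) - potential X)%R.
  by apply: measurable_funB => //; exact: measurable_potential_step.
rewrite (Rintegral_input muE mE mh (fun w => hB X w SX)); congr (_ * _)%R.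
have hb (b : bool) : measurable_fun setT (fun u => potential (luckock_map (u, b) X) - potential X)%R.
  exact: (measurable_fun_pair1 b mh).
have MpIm := Mplus_gtIm SX ltI.
have MpIp : Mplus Im Ip X <= Ip by apply: ereal_inf_lbound; left.
have MmIp := Mminus_ltIp SX ltI.
have MmIm : Im <= Mminus Im Ip X by apply: ereal_sup_ubound; left.
rewrite (@drift_minus _ _ _ _ _ ltI lm_cont lp_cont lm_noninc lp_nondec lp_gt0 lm_gt0 mum mup
  mumE mupE mumC al be al_be (Mplus Im Ip X) (best_sell wp X)) //; first last.
- by exists B => u; exact: hB.
- by move=> u; rewrite /potential lsum_buy// addrAC subrr add0r.
rewrite (@drift_plus _ _ _ _ _ ltI lm_cont lp_cont lm_noninc lp_nondec lp_gt0 lm_gt0 mum mup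
  mumE mupE mupC al be al_be (Mminus Im Ip X) (best_buy wm X)) //; first last.
- by exists B => u; exact: hB.
- by move=> u; rewrite /potential lsum_sell// addrAC subrr add0r.
rewrite /drift_rate /best_sell /best_buy /wp /wm.
have [s0|s0] := eqVneq (sells X) [::].
  rewrite (Mplus_nil SX s0); have [b0|b0] := eqVneq (buys X) [::].
    rewrite (Mminus_nil SX b0); ring.
  have [x xb ->] := Mminus_mem SX b0; rewrite /=; ring.
have [y ys ->] := Mplus_mem SX s0; have [b0|b0] := eqVneq (buys X) [::].
  rewrite (Mminus_nil SX b0) /=; ring.
have [x xb ->] := Mminus_mem SX b0; rewrite /=; ring.
Qed.

End state_drift.

(** * The two extremal potentials and the Lyapunov function *)

Section lyapunov.
Context {R : realType} (Im Ip : \bar R) (lm lp : \bar R -> R).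
Hypothesis ltI : Im < Ip.
Let hI : Im <= Ip := ltW ltI.
Local Notation Ibar := (closed_itv Im Ip).
Hypothesis lm_cont : {within Ibar, continuous lm}.
Hypothesis lp_cont : {within Ibar, continuous lp}.
Hypothesis lm_noninc : forall x y, Ibar x -> Ibar y -> x <= y -> (lm y <= lm x)%R.
Hypothesis lp_nondec : forall x y, Ibar x -> Ibar y -> x <= y -> (lp x <= lp y)%R.
Hypothesis lp_gt0 : (0 < lp Im)%R.
Hypothesis lm_gt0 : (0 < lm Ip)%R.
Variables mum mup : {finite_measure set \bar R -> \bar R}.
Hypothesis mumE : forall x, Ibar x -> mum `[x, Ip]%classic = (lm x)%:E.
Hypothesis mupE : forall x, Ibar x -> mup `[Im, x]%classic = (lp x)%:E.
Hypothesis mumC : mum (~` Ibar) = 0.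
Hypothesis mupC : mup (~` Ibar) = 0.
Local Notation E := (\bar R * bool)%type.
Variables (mu : {measure set E -> \bar R}) (m : probability E R).
Hypothesis muE : forall A, measurable A ->
  mu (A `*` [set false]) = mum A /\ mu (A `*` [set true]) = mup A.
Hypothesis mE : forall A, measurable A -> m A = normalized mu A.
Local Notation S := (Sord Im Ip).
Local Notation SF := (Sfin Im Ip).

Let Im0 : Ibar Im := Im_Ibar hI.
Let Ip0 : Ibar Ip := Ip_Ibar hI.
Let mSF : measurable (SF : set S) := @measurable_Sfin R Im Ip.

Let Gam_m := Gm Im lm lp mum Ip.
Let Gam_p := Gp Im Ip lm lp mup Im.
Let s := slack Im Ip lm lp mup.
Let c := fine (mu setT).

(* [buy_margin > 0] is equivalent to [fm Im > 0], and [sell_margin > 0] to [fp Ip > 0]. *)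
Definition buy_margin : R := ((lm Ip)^-1 - lm Im * Gam_m)%R.
Definition sell_margin : R := ((lp Im)^-1 - lp Ip * Gam_p)%R.

Let lmIm : (0 < lm Im)%R.
Proof. by apply: lt_le_trans lm_gt0 _; apply: lm_noninc. Qed.

Let lpIp : (0 < lp Ip)%R.
Proof. by apply: lt_le_trans lp_gt0 _; apply: lp_nondec. Qed.

Let Gam_m0 : (0 <= Gam_m)%R.
Proof. exact: (Gm_ge0 hI lm_noninc lp_nondec lp_gt0 lm_gt0 _ Ip0). Qed.

Let Gam_p0 : (0 <= Gam_p)%R.
Proof. exact: (Gp_ge0 hI lm_noninc lp_nondec lp_gt0 lm_gt0 _ Im0). Qed.

Lemma slack_Ip : (Gam_m + s = (lp Ip)^-1 * (lm Ip)^-1)%R.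
Proof.
have := GmGp hI lm_cont lp_cont lm_noninc lp_nondec lp_gt0 lm_gt0 mumE mupE Ip0.
by rewrite Gp_Ip addr0.
Qed.

Lemma slack_Im : (Gam_p + s = (lp Im)^-1 * (lm Im)^-1)%R.
Proof. by rewrite /s /slack -/Gam_p; ring. Qed.

(** The margins bound Gam_m by 1/(lm Im lm Ip) and Gam_p by 1/(lp Ip lp Im). Comparing with
    [slack_Ip] if lm Im >= lp Ip, and with [slack_Im] otherwise, gives a positive slack. *)
Lemma slack_gt0 : (0 < buy_margin)%R -> (0 < sell_margin)%R -> (0 < s)%R.
Proof.
rewrite /buy_margin /sell_margin => hA hB; have h1 := slack_Ip; have h2 := slack_Im.
have i1 : (0 < (lm Im)^-1)%R by rewrite invr_gt0.
have i2 : (0 < (lp Ip)^-1)%R by rewrite invr_gt0.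
have i3 : (0 < (lm Ip)^-1)%R by rewrite invr_gt0.
have i4 : (0 < (lp Im)^-1)%R by rewrite invr_gt0.
have k1 : (Gam_m < (lm Im)^-1 * (lm Ip)^-1)%R.
  by rewrite -(ltr_pM2l lmIm) mulrA mulfV ?gt_eqF// mul1r; lra.
have k2 : (Gam_p < (lp Ip)^-1 * (lp Im)^-1)%R.
  by rewrite -(ltr_pM2l lpIp) mulrA mulfV ?gt_eqF// mul1r; lra.
have [le|/ltW le] := leP (lm Im)^-1%R (lp Ip)^-1%R.
  have : ((lm Im)^-1 * (lm Ip)^-1 <= (lp Ip)^-1 * (lm Ip)^-1)%R by rewrite ler_pM2r.
  lra.
have : ((lp Ip)^-1 * (lp Im)^-1 <= (lp Im)^-1 * (lm Im)^-1)%R.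
  by rewrite [leRHS]mulrC ler_pM2r.
lra.
Qed.

Lemma mu_gt0 : (0 < c)%R.
Proof.
rewrite /c (mu_split muE)// !preimage_setT fineD ?fin_num_measure//.
apply: ltr_pwDl; last exact: fine_ge0.
have : 0 < mum setT.
  apply: (@lt_le_trans _ _ (mum `[Im, Ip]%classic)).
    by rewrite mumE// lte_fin.
  by apply: le_measure; rewrite ?in_setE//; exact: emeasurable_itv.
by move=> h; rewrite fine_gt0// h ltey_eq fin_num_measure.
Qed.

Let alb_a : (- Gam_m + (s + Gam_m) = slack Im Ip lm lp mup)%R.
Proof. by rewrite /s; lra. Qed.

Let alb_b : ((s + Gam_p) + - Gam_p = slack Im Ip lm lp mup)%R.
Proof. by rewrite /s; lra. Qed.

Local Notation pot := (potential lm lp mum mup).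
(** The constant [- Gam_m] makes [wplus] vanish at [Ip], so that an empty sell side does not show in
    the drift. In [pot_sell] it is [wminus] that vanishes, at [Im]. *)
Definition pot_buy (X : S) : R := pot (- Gam_m)%R (s + Gam_m)%R X.
Definition pot_sell (X : S) : R := pot (s + Gam_p)%R (- Gam_p)%R X.

Lemma measurable_pot_buy : measurable_fun SF pot_buy.
Proof.
exact: (measurable_potential ltI lm_cont lp_cont lm_noninc lp_nondec lp_gt0 lm_gt0 mumE mupE).
Qed.

Lemma measurable_pot_sell : measurable_fun SF pot_sell.
Proof.
exact: (measurable_potential ltI lm_cont lp_cont lm_noninc lp_nondec lp_gt0 lm_gt0 mumE mupE).
Qed.

Lemma pot_buy_drift X : SF X ->
  (\int[m]_w (pot_buy (luckock_map w X) - pot_buy X) =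
   c^-1 * (- buy_margin + (if buys X == [::] then lp Im * (s + Gam_m + Gam_p) else 0)))%R.
Proof.
move=> SX.
have := state_drift ltI lm_cont lp_cont lm_noninc lp_nondec lp_gt0 lm_gt0 mumE mupE mumC mupC
  muE mE alb_a SX.
rewrite /pot_buy => ->; congr (_ * _)%R.
rewrite /drift_rate /wplus /wminus -/Gam_m -/Gam_p addNr mulr0 if_same addr0.
congr (_ + _)%R; rewrite /buy_margin [(s + _)%R]addrC slack_Ip.
by field; rewrite !gt_eqF.
Qed.

Lemma pot_sell_drift X : SF X ->
  (\int[m]_w (pot_sell (luckock_map w X) - pot_sell X) =
   c^-1 * (- sell_margin + (if sells X == [::] then lm Ip * (s + Gam_p + Gam_m) else 0)))%R.
Proof.
move=> SX.
have := state_drift ltI lm_cont lp_cont lm_noninc lp_nondec lp_gt0 lm_gt0 mumE mupE mumC mupC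
  muE mE alb_b SX.
rewrite /pot_sell => ->; congr (_ * _)%R.
rewrite /drift_rate /wplus /wminus -/Gam_m -/Gam_p addNr mulr0 if_same addr0.
congr (_ + _)%R; rewrite /sell_margin [(s + _)%R]addrC slack_Im.
by field; rewrite !gt_eqF.
Qed.

Let bIbar (x : R) : open_itv Im Ip x -> Ibar x%:E.
Proof. by move=> /andP[h1 h2]; apply/closed_itvP; rewrite !ltW. Qed.

(** [Gm] is largest at [Ip], so sell orders have nonpositive weight here and only buy orders can
    make the potential positive. *)
Lemma pot_buy_buys X : SF X -> (0 < pot_buy X)%R -> buys X != [::].
Proof.
move=> SX; apply: contraTneq => b0; rewrite -leNgt /pot_buy /potential /lsum b0 big_nil addr0.
rewrite big_seq; apply: sumr_le0 => x xs; rewrite /wp /wplus addrC subr_le0.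
have Ix := bIbar (sells_itv SX xs).
apply: (Gm_nondec hI lm_noninc lp_nondec lp_gt0 lm_gt0) => //.
by have /closed_itvP/andP[] := Ix.
Qed.

Lemma pot_sell_sells X : SF X -> (0 < pot_sell X)%R -> sells X != [::].
Proof.
move=> SX; apply: contraTneq => b0; rewrite -leNgt /pot_sell /potential /lsum b0 big_nil add0r.
rewrite big_seq; apply: sumr_le0 => x xs; rewrite /wm /wminus addrC subr_le0.
have Ix := bIbar (buys_itv SX xs).
apply: (Gp_noninc hI lm_noninc lp_nondec lp_gt0 lm_gt0) => //.
by have /closed_itvP/andP[] := Ix.
Qed.

Definition norders (X : S) : R := lsum (cst 1%R) (cst 1%R) X.

Lemma nordersE X : norders X = (size (sells X) + size (buys X))%:R.
Proof.
rewrite /norders /lsum !big_const_seq !count_predT !iter_addr_0 natrD.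
by [].
Qed.

Lemma norders_ge0 X : (0 <= norders X)%R. Proof. by rewrite nordersE. Qed.

(** A convex combination of the two potentials gives every order a weight of at least [s / 2], and
    such a combination is at most the sum of the positive parts. *)
Lemma pot_norders X : (0 < s)%R -> SF X ->
  (s / 2 * norders X <= Num.max 0 (pot_buy X) + Num.max 0 (pot_sell X))%R.
Proof.
have gm0 := Gam_m0; have gp0 := Gam_p0.
(* This [t] turns the combined weights into [s / 2 + Gm] for sell orders and [s / 2 + Gp] for buy
   orders. *)
move=> s0 SX; pose t := ((s / 2 + Gam_p) / (s + Gam_p + Gam_m))%R.
have d0 : (0 < s + Gam_p + Gam_m)%R by lra.
have t0 : (0 <= t)%R by rewrite divr_ge0//; lra.
have t1 : (t <= 1)%R by rewrite ler_pdivrMr// mul1r; lra.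
have tE : (t * (s + Gam_p + Gam_m) = s / 2 + Gam_p)%R by rewrite /t divfK// gt_eqF.
have key : (s / 2 * norders X <= t * pot_buy X + (1 - t) * pot_sell X)%R.
  rewrite /norders /pot_buy /pot_sell /potential /lsum !mulrDr addrACA.
  apply: lerD.
    rewrite 3!mulr_sumr -big_split /= big_seq [leRHS]big_seq.
    apply: ler_sum => x xs; rewrite /wp /wplus mulr1.
    have g0 : (0 <= Gm Im lm lp mum x%:E)%R.
      by apply: (Gm_ge0 hI lm_noninc lp_nondec lp_gt0 lm_gt0); apply: bIbar; exact: sells_itv xs.
    move: tE g0; move: (Gm _ _ _ _ _) => g tE g0.
    have -> : (t * (- Gam_m + g) + (1 - t) * (s + Gam_p + g) =
       s + Gam_p - t * (s + Gam_p + Gam_m) + g)%R by ring.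
    rewrite tE; lra.
  rewrite 3!mulr_sumr -big_split /= big_seq [leRHS]big_seq.
  apply: ler_sum => x xs; rewrite /wm /wminus mulr1.
  have g0 : (0 <= Gp Im Ip lm lp mup x%:E)%R.
    by apply: (Gp_ge0 hI lm_noninc lp_nondec lp_gt0 lm_gt0); apply: bIbar; exact: buys_itv xs.
  move: tE g0; move: (Gp _ _ _ _ _ _) => g tE g0.
  have -> : (t * (s + Gam_m + g) + (1 - t) * (- Gam_p + g) =
     - Gam_p + t * (s + Gam_p + Gam_m) + g)%R by ring.
  rewrite tE; lra.
apply: le_trans key _; apply: lerD.
  have [h|h] := leP 0%R (pot_buy X).
    by rewrite ler_piMl.
  by rewrite mulr_ge0_le0// ltW.
have [h|h] := leP 0%R (pot_sell X).
  by rewrite ler_piMl//; lra.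
by rewrite mulr_ge0_le0//; [lra|exact: ltW].
Qed.

End lyapunov.

Section lyapunov.
Context {R : realType} (Im Ip : \bar R) (lm lp : \bar R -> R).
Hypothesis ltI : Im < Ip.
Let hI : Im <= Ip := ltW ltI.
Local Notation Ibar := (closed_itv Im Ip).
Hypothesis lm_cont : {within Ibar, continuous lm}.
Hypothesis lp_cont : {within Ibar, continuous lp}.
Hypothesis lm_noninc : forall x y, Ibar x -> Ibar y -> x <= y -> (lm y <= lm x)%R.
Hypothesis lp_nondec : forall x y, Ibar x -> Ibar y -> x <= y -> (lp x <= lp y)%R.
Hypothesis lp_gt0 : (0 < lp Im)%R.
Hypothesis lm_gt0 : (0 < lm Ip)%R.
Variables mum mup : {finite_measure set \bar R -> \bar R}.
Hypothesis mumE : forall x, Ibar x -> mum `[x, Ip]%classic = (lm x)%:E.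
Hypothesis mupE : forall x, Ibar x -> mup `[Im, x]%classic = (lp x)%:E.
Hypothesis mumC : mum (~` Ibar) = 0.
Hypothesis mupC : mup (~` Ibar) = 0.
Local Notation E := (\bar R * bool)%type.
Variables (mu : {measure set E -> \bar R}) (m : probability E R).
Hypothesis muE : forall A, measurable A ->
  mu (A `*` [set false]) = mum A /\ mu (A `*` [set true]) = mup A.
Hypothesis mE : forall A, measurable A -> m A = normalized mu A.
Local Notation S := (Sord Im Ip).
Local Notation SF := (Sfin Im Ip).

Let Im0 : Ibar Im := Im_Ibar hI.
Let Ip0 : Ibar Ip := Ip_Ibar hI.
Let mSF : measurable (SF : set S) := @measurable_Sfin R Im Ip.

Local Notation buy_margin := (buy_margin Im Ip lm lp mum).
Local Notation sell_margin := (sell_margin Im Ip lm lp mup).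
Local Notation pot_buy := (@pot_buy R Im Ip lm lp mum mup).
Local Notation pot_sell := (@pot_sell R Im Ip lm lp mum mup).

(** With the value [+oo] off [Sfin], the drift inequality is trivial there and no such state has
    finite rank in [foster]. *)
Definition ext_pinfty (F : S -> R) (X : S) : \bar R := if X \in SF then (F X)%:E else +oo.

Lemma ext_pinftyE F X : SF X -> ext_pinfty F X = (F X)%:E.
Proof. by move=> SX; rewrite /ext_pinfty mem_set. Qed.

Lemma nnmfun_ext_pinfty (F : S -> R) : measurable_fun SF F -> (forall X, 0 <= F X)%R ->
  measurable_fun setT (ext_pinfty F) /\ forall X, 0 <= ext_pinfty F X.
Proof.
move=> mF F0; split; last by move=> X; rewrite /ext_pinfty; case: ifP; rewrite ?lee_fin// leey.
apply: measurable_fun_if => //.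
- apply: (measurable_fun_bool true); rewrite setTI.
  have -> : (fun X : S => X \in SF) @^-1` [set true] = SF; last by [].
  by apply/seteqP; split=> X /=; [move/set_mem|move/mem_set].
- rewrite setTI; have -> : (fun X : S => X \in SF) @^-1` [set true] = SF.
    by apply/seteqP; split=> X /=; [move/set_mem|move/mem_set].
  exact/measurable_EFinP.
Qed.

(** The square of the positive part has the 2-Lipschitz derivative 2 max(0, v), so its increment
    from v to h is at most 2 max(0, v) (h - v) + (h - v)^2. *)
Lemma square_drift d (T : measurableType d) (n : probability T R) (h : T -> R) (v B : R) :
  measurable_fun setT h -> (forall w, `|h w - v| <= B)%R ->
  \int[n]_w (Num.max 0 (h w) ^+ 2)%:E <=
  (Num.max 0 v ^+ 2 + 2 * Num.max 0 v * (\int[n]_w (h w - v))%R + B ^+ 2)%:E.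
Proof.
move=> mh hB.
have md : measurable_fun setT (fun w => h w - v)%R by exact: measurable_funB.
have id : n.-integrable setT (EFin \o (fun w => h w - v)%R).
  by apply: (@integrable_bounded _ _ _ _ _ _ B).
pose a := (2 * Num.max 0 v)%R; pose b := (Num.max 0 v ^+ 2 + B ^+ 2)%R.
have ia : n.-integrable setT (EFin \o (fun w => a * (h w - v))%R).
  have M0 : (0 <= Num.max 0 v)%R by rewrite le_max lexx.
  apply: (@integrable_bounded _ _ _ _ _ _ (a * B)%R) => //; first exact: measurable_funM.
  by move=> u _; rewrite normrM ger0_norm /a ?mulr_ge0// ler_wpM2l// mulr_ge0.
have ib : n.-integrable setT (EFin \o cst b).
  by apply: (@integrable_bounded _ _ _ _ _ _ `|b|%R) => // u _; exact: lexx.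
have -> : (Num.max 0 v ^+ 2 + 2 * Num.max 0 v * (\int[n]_w (h w - v))%R + B ^+ 2)%:E =
  \int[n]_w (b + a * (h w - v))%:E.
  transitivity ((\int[n]_w (b + a * (h w - v)))%R%:E); last first.
    rewrite /Rintegral fineK//; apply: integrable_fin_num => //.
    exact: (integrableD _ ib ia).
  congr EFin; transitivity (b + a * (\int[n]_w (h w - v)))%R; first by rewrite /b /a; ring.
  rewrite -RintegralZl//; transitivity ((\int[n]_w cst b w) + (\int[n]_w (a * (h w - v))))%R.
    congr (_ + _)%R; rewrite Rintegral_cst//; rewrite -[LHS]mulr1; congr (b * _)%R.
    by rewrite -[LHS]/(fine 1); exact: (congr1 fine (esym (probability_setT n))).
  by rewrite -RintegralD.
apply: ge0_le_integral => //.
- by move=> w _; rewrite lee_fin sqr_ge0.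
- apply/measurable_EFinP; apply: measurable_funX.
  by apply: measurable_maxr.
- by apply/measurable_EFinP; apply: measurable_funD => //; exact: measurable_funM.
move=> w _; rewrite lee_fin /a /b; have := hB w; rewrite ler_norml => /andP[h1 h2].
have dB : ((h w - v) ^+ 2 <= B ^+ 2)%R.
  have B0 : (0 <= B)%R := le_trans (normr_ge0 _) (hB w).
  by rewrite -[leLHS]real_normK ?num_real// ler_sqr ?nnegrE//; exact: hB.
case: (leP 0%R v) => v0; case: (leP 0%R (h w)) => h0; nra.
Qed.

Hypothesis buy_gt0 : (0 < buy_margin)%R.
Hypothesis sell_gt0 : (0 < sell_margin)%R.

Definition lyapunov : S -> R :=
  fun X => (Num.max 0 (pot_buy X) ^+ 2 + Num.max 0 (pot_sell X) ^+ 2)%R.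

Lemma measurable_lyapunov : measurable_fun SF lyapunov.
Proof.
have mb := measurable_pot_buy ltI lm_cont lp_cont lm_noninc lp_nondec lp_gt0 lm_gt0 mumE mupE.
have ms := measurable_pot_sell ltI lm_cont lp_cont lm_noninc lp_nondec lp_gt0 lm_gt0 mumE mupE.
by apply: measurable_funD; apply: measurable_funX; exact: measurable_maxr.
Qed.

Lemma lyapunov_ge0 X : (0 <= lyapunov X)%R.
Proof. by rewrite addr_ge0 ?sqr_ge0. Qed.

Lemma measurable_norders : measurable_fun SF (@norders R Im Ip).
Proof. by apply: measurable_lsum; exact: bounded_continuous_cst. Qed.

Let c_gt0 : (0 < fine (mu setT))%R.
Proof. exact: (mu_gt0 ltI lm_noninc lm_gt0 mumE muE). Qed.

(** In [square_drift] the linear term is present only where the potential is positive. There the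
    corresponding side is nonempty, so the mean increment is exactly minus the normalised margin;
    [pot_norders] converts the resulting decrease into a multiple of the number of orders. *)
Lemma lyapunov_drift : exists C delta : R, [/\ (0 <= C)%R, (0 < delta)%R &
  forall X, step_op m (@luckock_step R Im Ip) (ext_pinfty lyapunov) X +
    delta%:E * ext_pinfty (@norders R Im Ip) X <= ext_pinfty lyapunov X + C%:E].
Proof.
have s0 := slack_gt0 ltI lm_cont lp_cont lm_noninc lp_nondec lp_gt0 lm_gt0 mumE mupE buy_gt0 sell_gt0.
set s := slack _ _ _ _ _ in s0.
have lip := potential_lip ltI lm_cont lp_cont lm_noninc lp_nondec lp_gt0 lm_gt0 mumE mupE.
have [B1 B10 lip1] := lip (- Gm Im lm lp mum Ip)%R (s + Gm Im lm lp mum Ip)%R.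
have [B2 B20 lip2] := lip (s + Gp Im Ip lm lp mup Im)%R (- Gp Im Ip lm lp mup Im)%R.
pose k := Num.min buy_margin sell_margin.
have k0 : (0 < k)%R by rewrite lt_min buy_gt0.
have kb : (k <= buy_margin)%R by rewrite ge_min lexx.
have ks : (k <= sell_margin)%R by rewrite ge_min lexx orbT.
pose c := (fine (mu setT))^-1%R; have c0 : (0 < c)%R by rewrite invr_gt0.
(* [C] collects the squared step bounds; [k] is the smaller margin, [c] normalises the input measure
   and [s / 2] is the constant of [pot_norders]. *)
exists (B1 ^+ 2 + B2 ^+ 2)%R, (2 * c * k * (s / 2))%R; split.
- by rewrite addr_ge0 ?sqr_ge0.
- by rewrite !mulr_gt0.
move=> X; have [SX|nX] := pselect (SF X); last first.
  by rewrite [X in _ <= X + _]/ext_pinfty memNset// addye// leey.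
rewrite !ext_pinftyE// -EFinM -EFinD.
have SL w : SF (luckock_map w X) by exact: Sfin_luckock.
have mst := measurable_potential_step ltI lm_cont lp_cont lm_noninc lp_nondec lp_gt0 lm_gt0 mumE mupE.
have -> : step_op m (@luckock_step R Im Ip) (ext_pinfty lyapunov) X =
    \int[m]_w (Num.max 0 (pot_buy (luckock_map w X)) ^+ 2)%:E +
    \int[m]_w (Num.max 0 (pot_sell (luckock_map w X)) ^+ 2)%:E.
  rewrite -ge0_integralD//; last 4 first.
  - by move=> w _; rewrite lee_fin sqr_ge0.
  - apply/measurable_EFinP; apply: measurable_funX; apply: measurable_maxr => //.
    exact: mst.
  - by move=> w _; rewrite lee_fin sqr_ge0.
  - apply/measurable_EFinP; apply: measurable_funX; apply: measurable_maxr => //.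
    exact: mst.
  by apply: eq_integral => w _; rewrite /luckock_step/= ext_pinftyE.
have h1 := @square_drift _ _ m (fun w => pot_buy (luckock_map w X)) (pot_buy X) B1
  (mst _ _ _ SX) (fun w => lip1 X w SX).
have h2 := @square_drift _ _ m (fun w => pot_sell (luckock_map w X)) (pot_sell X) B2
  (mst _ _ _ SX) (fun w => lip2 X w SX).
apply: (@le_trans _ _ (((Num.max 0 (pot_buy X) ^+ 2 + 2 * Num.max 0 (pot_buy X) *
    (\int[m]_w (pot_buy (luckock_map w X) - pot_buy X))%R + B1 ^+ 2) +
   (Num.max 0 (pot_sell X) ^+ 2 + 2 * Num.max 0 (pot_sell X) *
    (\int[m]_w (pot_sell (luckock_map w X) - pot_sell X))%R + B2 ^+ 2) +
   (2 * c * k * (s / 2) * norders X))%:E)).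
  by rewrite EFinD [X in _ <= X + _]EFinD leeD2r// leeD.
rewrite lee_fin /lyapunov.
have hN := pot_norders ltI lm_noninc lp_nondec lp_gt0 lm_gt0 mum s0 SX.
have eb : (2 * Num.max 0 (pot_buy X) * (\int[m]_w (pot_buy (luckock_map w X) - pot_buy X))%R <=
    - (2 * c * k * Num.max 0 (pot_buy X)))%R.
  rewrite (pot_buy_drift ltI lm_cont lp_cont lm_noninc lp_nondec lp_gt0 lm_gt0 mumE mupE mumC mupC muE mE SX).
  have [h|h] := leP (pot_buy X) 0%R; first by rewrite !(mulr0, mul0r) oppr0.
  have /negbTE -> := pot_buy_buys ltI lm_noninc lp_nondec lp_gt0 lm_gt0 SX h.
  rewrite addr0 -/c; move: (pot_buy X) h => p p0.
  rewrite -subr_ge0.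
  have -> : (- (2 * c * k * p) - 2 * p * (c * - buy_margin) = 2 * (c * p * (buy_margin - k)))%R by ring.
  by rewrite !mulr_ge0 ?subr_ge0// ltW.
have es : (2 * Num.max 0 (pot_sell X) * (\int[m]_w (pot_sell (luckock_map w X) - pot_sell X))%R <=
    - (2 * c * k * Num.max 0 (pot_sell X)))%R.
  rewrite (pot_sell_drift ltI lm_cont lp_cont lm_noninc lp_nondec lp_gt0 lm_gt0 mumE mupE mumC mupC muE mE SX).
  have [h|h] := leP (pot_sell X) 0%R; first by rewrite !(mulr0, mul0r) oppr0.
  have /negbTE -> := pot_sell_sells ltI lm_noninc lp_nondec lp_gt0 lm_gt0 SX h.
  rewrite addr0 -/c; move: (pot_sell X) h => p p0.
  rewrite -subr_ge0.
  have -> : (- (2 * c * k * p) - 2 * p * (c * - sell_margin) = 2 * (c * p * (sell_margin - k)))%R by ring.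
  by rewrite !mulr_ge0 ?subr_ge0// ltW.
have hN' : (2 * c * k * (s / 2) * norders X <=
  2 * c * k * Num.max 0 (pot_buy X) + 2 * c * k * Num.max 0 (pot_sell X))%R.
  rewrite -mulrDr -[leLHS]mulrA ler_wpM2l//.
  by rewrite !mulr_ge0// ltW.
lra.
Qed.

End lyapunov.

(** * Two books fed with the same orders *)

Section coupling.
Context {R : realType} (Im Ip : \bar R) (lm lp : \bar R -> R).
Hypothesis ltI : Im < Ip.
Let hI : Im <= Ip := ltW ltI.
Local Notation Ibar := (closed_itv Im Ip).
Hypothesis lm_cont : {within Ibar, continuous lm}.
Hypothesis lp_cont : {within Ibar, continuous lp}.
Hypothesis lm_noninc : forall x y, Ibar x -> Ibar y -> x <= y -> (lm y <= lm x)%R.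
Hypothesis lp_nondec : forall x y, Ibar x -> Ibar y -> x <= y -> (lp x <= lp y)%R.
Hypothesis lp_gt0 : (0 < lp Im)%R.
Hypothesis lm_gt0 : (0 < lm Ip)%R.
Variables mum mup : {finite_measure set \bar R -> \bar R}.
Hypothesis mumE : forall x, Ibar x -> mum `[x, Ip]%classic = (lm x)%:E.
Hypothesis mupE : forall x, Ibar x -> mup `[Im, x]%classic = (lp x)%:E.
Hypothesis mumC : mum (~` Ibar) = 0.
Hypothesis mupC : mup (~` Ibar) = 0.
Local Notation E := (\bar R * bool)%type.
Variables (mu : {measure set E -> \bar R}) (m : probability E R).
Hypothesis muE : forall A, measurable A ->
  mu (A `*` [set false]) = mum A /\ mu (A `*` [set true]) = mup A.
Hypothesis mE : forall A, measurable A -> m A = normalized mu A.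
Local Notation S := (Sord Im Ip).
Local Notation SF := (Sfin Im Ip).

Let Im0 : Ibar Im := Im_Ibar hI.
Local Notation buy_margin := (buy_margin Im Ip lm lp mum).
Local Notation sell_margin := (sell_margin Im Ip lm lp mup).
Local Notation step := (@luckock_step R Im Ip).
Local Notation emp := (Sord0 Im Ip).

Definition coupled_step (p : E * (S * S)) : S * S :=
  (luckock_map p.1 p.2.1, luckock_map p.1 p.2.2).

Lemma measurable_coupled_step : measurable_fun setT coupled_step.
Proof.
have mL := measurable_luckock_step ltI.
apply: measurable_fun_pair.
  apply: (measurableT_comp mL (_ : measurable_fun setT (fun p : E * (S * S) => (p.1, p.2.1)))).
  by apply: measurable_fun_pair => //; apply: measurableT_comp.
apply: (measurableT_comp mL (_ : measurable_fun setT (fun p : E * (S * S) => (p.1, p.2.2)))).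
by apply: measurable_fun_pair => //; apply: measurableT_comp.
Qed.

Local Notation D2 := [set (emp, emp)].

Lemma measurable_coupled_empty : measurable (D2 : set (S * S)).
Proof.
have -> : D2 = [set emp] `*` [set emp] :> set (S * S).
  by apply/seteqP; split=> [_ ->|[x y] [/= -> ->]].
by apply: measurableX; exact: (@measurable_Sord0 R Im Ip).
Qed.

(** Equal books stay equal under common inputs, so on the diagonal the pair behaves like a single
    book. *)
Lemma taboo_diag (F : S * S -> \bar R) x :
  taboo_op m coupled_step D2 F (x, x) = taboo_op m step [set emp] (fun x => F (x, x)) x.
Proof.
rewrite /taboo_op /step_op; apply: eq_integral => w _; rewrite /coupled_step /luckock_step /=.
rewrite !patchE; case: (pselect (luckock_map w x = emp)) => [->|h].
  by rewrite !memNset//=; apply.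
by rewrite !mem_set // => e; apply: h; exact: (congr1 fst e).
Qed.

Lemma survival_diag n x :
  survival m coupled_step D2 n (x, x) = survival m step [set emp] n x.
Proof.
rewrite /survival; elim: n x => // n IH x; rewrite !iterS taboo_diag.
by apply: (congr1 (fun F => taboo_op m step [set emp] F x)); apply/funext => z; exact: IH.
Qed.

Lemma norders_eq0 X : SF X -> norders X = 0%R -> X = emp.
Proof.
move=> SX /eqP; rewrite nordersE pnatr_eq0 addn_eq0 !size_eq0 => /andP[/eqP s0 /eqP b0].
by apply/(Sord0P SX).
Qed.

Lemma norders_emp : norders emp = 0%R.
Proof. by have [/(_ erefl)[h1 h2] _] := Sord0P (Sfin0 Im Ip); rewrite nordersE h1 h2. Qed.

(** A buy order at [Ip] is a market order: it takes the best sell order if there is one and never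
    rests in the book. *)
Lemma norders_market_buy X : SF X ->
  norders (luckock_map (Ip, false) X) = (norders X - (sells X != [::])%:R)%R.
Proof.
move=> SX; rewrite /norders lsum_buy// ifT; last by apply: ereal_inf_lbound; left.
by rewrite /best_sell; case: ifP => //= _; rewrite ?oppr0 ?subr0.
Qed.

Lemma norders_market_sell X : SF X ->
  norders (luckock_map (Im, true) X) = (norders X - (buys X != [::])%:R)%R.
Proof.
move=> SX; rewrite /norders lsum_sell// ifT; last by apply: ereal_sup_ubound; left.
by rewrite /best_buy; case: ifP => //= _; rewrite ?oppr0 ?subr0.
Qed.

Let Ip0 : Ibar Ip := Ip_Ibar hI.

Let c_gt0 : (0 < fine (mu setT))%R.
Proof. exact: (mu_gt0 ltI lm_noninc lm_gt0 mumE muE). Qed.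

Let minput (w : E) : measurable [set w].
Proof.
have -> : [set w] = [set w.1] `*` [set w.2] :> set E.
  by case: w => u b; apply/seteqP; split=> [_ ->|[v b'] [/= -> ->]].
by apply: measurableX => //; exact: emeasurable_set1.
Qed.

(** [mum] has an atom at [Ip] of mass [lm Ip]; its positivity is what allows the book to be
    emptied. *)
Let market_buy_mass : m [set (Ip, false)] = ((fine (mu setT))^-1 * lm Ip)%:E.
Proof.
have e : [set (Ip, false)] = [set Ip] `*` [set false] :> set E.
  by apply/seteqP; split=> [_ ->|[u b] [/= -> ->]].
have -> : m [set (Ip, false)] = normalized mu ([set Ip] `*` [set false]).
  by rewrite e mE//; apply: measurableX.
have [h _] := muE (emeasurable_set1 Ip).
rewrite /normalized h EFinM; congr (_ * _).
by rewrite -mumE// set_itv1.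
Qed.

Let market_sell_mass : m [set (Im, true)] = ((fine (mu setT))^-1 * lp Im)%:E.
Proof.
have e : [set (Im, true)] = [set Im] `*` [set true] :> set E.
  by apply/seteqP; split=> [_ ->|[u b] [/= -> ->]].
have -> : m [set (Im, true)] = normalized mu ([set Im] `*` [set true]).
  by rewrite e mE//; apply: measurableX.
have [_ h] := muE (emeasurable_set1 Im).
rewrite /normalized h EFinM; congr (_ * _).
by rewrite -mupE// set_itv1.
Qed.

(** The booleans tell which of the two books loses an order; the number of orders in both then drops
    by at least one. *)
Let dec (j : nat) (i k : R) (a b : bool) : (i <= j%:R)%R -> a || b ->
  (k = i - (a%:R + b%:R))%R -> (0 <= k)%R -> (0 < j)%N /\ (k%:E <= j.-1%:R%:E).
Proof.
move=> ij ab kE k0; have h : (1 <= a%:R + b%:R :> R)%R.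
  by move: ab; case: (a); case: (b) => //= _; rewrite ?addr0 ?add0r// lerDl.
case: j ij => [|j] ij; first by exfalso; move: ij; rewrite /=; lra.
by split=> //=; rewrite lee_fin; move: ij; rewrite -natr1; lra.
Qed.

Hypothesis buy_gt0 : (0 < buy_margin)%R.
Hypothesis sell_gt0 : (0 < sell_margin)%R.

(** Foster's criterion for the pair: the drift inequalities of the two books add up, and the rank is
    the total number of orders in both. *)
Lemma summable_coupling x y : SF x -> SF y ->
  \sum_(0 <= n <oo) survival m coupled_step D2 n (x, y) < +oo.
Proof.
move=> Sx Sy.
have [C [delta [C0 d0 drift]]] := lyapunov_drift ltI lm_cont lp_cont lm_noninc lp_nondec lp_gt0
  lm_gt0 mumE mupE mumC mupC muE mE buy_gt0 sell_gt0.
have [mV V0] := nnmfun_ext_pinfty (measurable_lyapunov ltI lm_cont lp_cont lm_noninc lp_nondec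
  lp_gt0 lm_gt0 mumE mupE) (lyapunov_ge0 lm lp mum mup).
have [mN N0] := nnmfun_ext_pinfty (@measurable_norders R Im Ip) (@norders_ge0 R Im Ip).
set V := ext_pinfty _ in mV V0 drift.
set N := ext_pinfty _ in mN N0 drift.
have mpr (F : S -> \bar R) : measurable_fun setT F ->
    measurable_fun setT (fun z : S * S => F z.1 + F z.2).
  by move=> mF; apply: emeasurable_funD; apply: measurableT_comp.
pose c := (fine (mu setT))^-1%R; have c0 : (0 < c)%R by rewrite invr_gt0.
(* The smaller of the probabilities of a market buy order and of a market sell order. *)
pose p := Num.min (c * lm Ip)%R (c * lp Im)%R.
have p0 : (0 < p)%R by rewrite lt_min !mulr_gt0.
have p1 : (p <= 1)%R.
  rewrite -lee_fin; apply: (@le_trans _ _ (m [set (Ip, false)])); last exact: (probability_le1 _ (minput _)).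
  by rewrite market_buy_mass lee_fin ge_min lexx.
have mL := measurable_luckock_step ltI.
apply: (@foster _ _ _ _ _ m coupled_step measurable_coupled_step D2 measurable_coupled_empty
  (fun z => V z.1 + V z.2) (fun z => N z.1 + N z.2) (C + C)%R delta p).
- by split; [exact: mpr|move=> z; rewrite adde_ge0].
- by split; [exact: mpr|move=> z; rewrite adde_ge0].
- exact: addr_ge0.
- by [].
- by rewrite p0.
- move=> [x' y'] /=.
  have -> : step_op m coupled_step (fun z => V z.1 + V z.2) (x', y') =
      step_op m step V x' + step_op m step V y'.
    rewrite /step_op -ge0_integralD//.
      by apply: measurableT_comp => //; exact: (measurable_step mL).
    by apply: measurableT_comp => //; exact: (measurable_step mL).
  rewrite EFinD ge0_muleDr// addeACA [leRHS]addeACA.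
  by rewrite leeD.
- move=> j [x' y'] /=; have [Sx'|nx] := pselect (SF x'); last first.
    have -> : N x' = +oo by rewrite /N /ext_pinfty memNset.
    rewrite addye ?leye_eq//; apply: contraTneq (N0 y') => ->.
    by rewrite leeNy_eq.
  have [Sy'|ny] := pselect (SF y'); last first.
    have -> : N y' = +oo by rewrite /N /ext_pinfty memNset.
    rewrite addey ?leye_eq//; apply: contraTneq (N0 x') => ->.
    by rewrite leeNy_eq.
  rewrite /N !ext_pinftyE// -EFinD lee_fin => Nj.
  (* While either book contains a sell order, market buy orders lower the rank; after that, market
     sell orders do. *)
  have [s0|s0] := boolP ((sells x' == [::]) && (sells y' == [::])); last first.
    exists [set (Ip, false)]; split; first exact: minput.
      by rewrite market_buy_mass lee_fin ge_min lexx.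
    move=> _ ->; right; rewrite !ext_pinftyE; try exact: Sfin_luckock.
    rewrite -EFinD /= !norders_market_buy//.
    apply: (@dec j (norders x' + norders y')%R _ (sells x' != [::]) (sells y' != [::])) => //.
    - by move: s0; rewrite negb_and.
    - by rewrite addrACA -opprD.
    - by rewrite -!norders_market_buy// addr_ge0 ?norders_ge0.
  exists [set (Im, true)]; split; first exact: minput.
    by rewrite market_sell_mass lee_fin ge_min lexx orbT.
  have [b0|b0] := boolP ((buys x' == [::]) && (buys y' == [::])); last first.
    move=> _ ->; right; rewrite !ext_pinftyE; try exact: Sfin_luckock.
    rewrite -EFinD /= !norders_market_sell//.
    apply: (@dec j (norders x' + norders y')%R _ (buys x' != [::]) (buys y' != [::])) => //.
    - by move: b0; rewrite negb_and.
    - by rewrite addrACA -opprD.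
    - by rewrite -!norders_market_sell// addr_ge0 ?norders_ge0.
  (* Both books are empty already; a market sell order changes neither, so the target is hit. *)
  move=> _ ->; left; rewrite /coupled_step /=.
  have [/andP[/eqP sx /eqP sy] /andP[/eqP bx /eqP by_]] := (s0, b0).
  by congr pair; apply: norders_eq0; try exact: Sfin_luckock; rewrite norders_market_sell//
    nordersE ?sx ?sy ?bx ?by_ /= addn0 subr0.
- by rewrite /V !ext_pinftyE// -EFinD ltry.
Qed.

End coupling.

(** * An infinite mean return time when a margin is not positive *)

Lemma cvg_series_nneseries (R : realType) (u : nat -> R) : (forall n, 0 <= u n)%R ->
  \sum_(0 <= n <oo) (u n)%:E < +oo -> cvgn (series u).
Proof.
move=> u0 soo; apply: nondecreasing_is_cvgn.
  by apply/nondecreasing_seqP => n; rewrite /series /= big_nat_recr//= lerDl.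
have s0 : 0 <= \sum_(0 <= n <oo) (u n)%:E by apply: nneseries_ge0 => n _ _; rewrite lee_fin.
exists (fine (\sum_(0 <= n <oo) (u n)%:E)) => _ [n _ <-].
rewrite -lee_fin fineK ?ge0_fin_numE// /series/= -sumEFin.
by apply: nneseries_lim_ge => k _ _; rewrite lee_fin.
Qed.

Section null_recurrence.
Context (R : realType) dE (E : measurableType dE) dZ (Z : measurableType dZ).
Variables (m : probability E R) (f : E * Z -> Z).
Hypothesis mf : measurable_fun [set: E * Z] f.
Variable D : set Z.
Hypothesis mD : measurable D.
Variables (G : Z -> R) (z0 : Z) (B beta : R).
Hypothesis mG : measurable_fun setT G.
Hypothesis G0 : forall z, (0 <= G z)%R.
Hypothesis GD : forall z, D z -> G z = 0%R.
Hypothesis Gz0 : G z0 = 0%R.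
Hypothesis G_step : forall w z, (G (f (w, z)) <= G z + B)%R.
Hypothesis G_sub : forall z, (G z)%:E <= step_op m f (EFin \o G) z.
Hypothesis beta_gt0 : (0 < beta)%R.
Hypothesis G_beta : beta%:E <= step_op m f (EFin \o G) z0.

Let nG : measurable_fun setT (EFin \o G) /\ forall z, 0 <= (EFin \o G) z.
Proof. by split; [exact/measurable_EFinP|move=> z; rewrite lee_fin]. Qed.

(** Since [G] vanishes on [D], killing the chain there loses nothing, and the submartingale property
    passes to the taboo operator. *)
Let taboo_G : taboo_op m f D (EFin \o G) = step_op m f (EFin \o G).
Proof.
rewrite /taboo_op; congr step_op; apply/funext => z; rewrite patchE.
case: ifP => // /negbT; rewrite notin_setE => /contrapT zD.
by rewrite /= GD.
Qed.

Let iter_ge n z : (G z)%:E <= iter n (taboo_op m f D) (EFin \o G) z.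
Proof.
elim: n z => // n IH z; rewrite iterS; apply: le_trans (G_sub z) _.
rewrite -taboo_G; apply: le_taboo => //; exact: nnmfun_iter_taboo.
Qed.

Let B_ge0 : (0 <= B)%R.
Proof. by have := G_step point z0; rewrite Gz0 add0r; exact: le_trans. Qed.

Let nn_surv n : measurable_fun setT (survival m f D n) /\ forall z, 0 <= survival m f D n z.
Proof. exact: nnmfun_survival. Qed.

(** Along a surviving path [G] grows by at most [B] per step. *)
Let iter_le n z : iter n (taboo_op m f D) (EFin \o G) z <= (G z + n%:R * B)%:E * survival m f D n z.
Proof.
elim: n z => [|n IH] z; first by rewrite /survival /= mul0r addr0 mule1.
rewrite iterS [survival _ _ _ n.+1]/survival iterS -/(survival m f D n).
have c0 : (0 <= G z + n.+1%:R * B)%R by rewrite addr_ge0// mulr_ge0.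
have <- : taboo_op m f D (fun x => (G z + n.+1%:R * B)%:E * survival m f D n x) z =
    (G z + n.+1%:R * B)%:E * taboo_op m f D (survival m f D n) z.
  by rewrite tabooZ.
have [mI I0] := nnmfun_restrict (measurableC mD) (nnmfun_iter_taboo m mf mD n nG).
have nS := nnmfunZ c0 (nn_surv n).
have [mS S0] := nnmfun_restrict (measurableC mD) nS.
apply: le_step_op => // w; rewrite !patchE; case: ifP => // _.
apply: le_trans (IH _) _; apply: lee_wpmul2r; first by case: (nn_surv n).
by rewrite lee_fin -natr1; have := G_step w z; lra.
Qed.

(** The surviving paths carry [G]-mass at least [beta] at every positive time n, while [G] is at
    most n B on them. So survival to time n has probability at least of order 1/n, and the harmonic
    series diverges. *)
Lemma survival_not_summable : ~ \sum_(0 <= n <oo) survival m f D n z0 < +oo.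
Proof.
move=> soo.
(* [B + 1] is positive even if [B] vanishes. *)
have B1 : (0 < B + 1)%R by rewrite ltr_wpDl.
have fS n : (fine (survival m f D n z0))%:E = survival m f D n z0.
  by rewrite fineK// survival_fin_num.
have s0 n : (0 <= fine (survival m f D n z0))%R by rewrite fine_ge0//; case: (nn_surv n).
have k0 : (0 < (B + 1) / beta)%R by rewrite divr_gt0.
apply: (@dvg_harmonic R).
apply: (@series_le_cvg _ _ (fun n => (B + 1) / beta * fine (survival m f D n z0))%R).
- by move=> n; rewrite /harmonic invr_ge0.
- by move=> n; rewrite mulr_ge0// ltW.
- move=> n; rewrite -lee_fin EFinM fS.
  apply: le_trans (lee_wpmul2l _ (survival_nonincr m mf mD n z0)); last by rewrite lee_fin ltW.
  have key : beta%:E <= (n.+1%:R * (B + 1))%:E * survival m f D n.+1 z0.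
    apply: (@le_trans _ _ ((G z0 + n.+1%:R * B)%:E * survival m f D n.+1 z0)).
      apply: le_trans (iter_le n.+1 z0).
      rewrite iterS; apply: (le_trans G_beta); rewrite -taboo_G.
      by apply: le_taboo (iter_ge n) => //; exact: nnmfun_iter_taboo.
    apply: lee_wpmul2r; first by case: (nn_surv n.+1).
    by rewrite lee_fin Gz0 add0r ler_wpM2l// lerDl.
  move: key; rewrite -fS -!EFinM !lee_fin; move: (fine _) => t key.
  change (n.+1%:R^-1 <= (B + 1) / beta * t)%R.
  rewrite -[leLHS]mul1r ler_pdivrMr// -(ler_pM2l beta_gt0) mulr1; apply: le_trans key _.
  by rewrite le_eqVlt; apply/orP; left; apply/eqP; field; rewrite gt_eqF.
- apply: cvg_series_nneseries => [n|]; first by rewrite mulr_ge0// ltW.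
  under eq_eseriesr do rewrite EFinM fS.
  rewrite nneseriesZl//; last by move=> n _; case: (nn_surv n).
  by rewrite lte_mul_pinfty// lee_fin ltW.
Qed.

End null_recurrence.

Section null_model.
Context {R : realType} (Im Ip : \bar R) (lm lp : \bar R -> R).
Hypothesis ltI : Im < Ip.
Let hI : Im <= Ip := ltW ltI.
Local Notation Ibar := (closed_itv Im Ip).
Hypothesis lm_cont : {within Ibar, continuous lm}.
Hypothesis lp_cont : {within Ibar, continuous lp}.
Hypothesis lm_noninc : forall x y, Ibar x -> Ibar y -> x <= y -> (lm y <= lm x)%R.
Hypothesis lp_nondec : forall x y, Ibar x -> Ibar y -> x <= y -> (lp x <= lp y)%R.
Hypothesis lp_gt0 : (0 < lp Im)%R.
Hypothesis lm_gt0 : (0 < lm Ip)%R.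
Variables mum mup : {finite_measure set \bar R -> \bar R}.
Hypothesis mumE : forall x, Ibar x -> mum `[x, Ip]%classic = (lm x)%:E.
Hypothesis mupE : forall x, Ibar x -> mup `[Im, x]%classic = (lp x)%:E.
Hypothesis mumC : mum (~` Ibar) = 0.
Hypothesis mupC : mup (~` Ibar) = 0.
Local Notation E := (\bar R * bool)%type.
Variables (mu : {measure set E -> \bar R}) (m : probability E R).
Hypothesis muE : forall A, measurable A ->
  mu (A `*` [set false]) = mum A /\ mu (A `*` [set true]) = mup A.
Hypothesis mE : forall A, measurable A -> m A = normalized mu A.
Local Notation S := (Sord Im Ip).
Local Notation SF := (Sfin Im Ip).

Let Im0 : Ibar Im := Im_Ibar hI.
Local Notation buy_margin := (buy_margin Im Ip lm lp mum).
Local Notation sell_margin := (sell_margin Im Ip lm lp mup).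
Local Notation pot_buy := (@pot_buy R Im Ip lm lp mum mup).
Local Notation pot_sell := (@pot_sell R Im Ip lm lp mum mup).
Local Notation step := (@luckock_step R Im Ip).
Local Notation emp := (Sord0 Im Ip).
Let mSF : measurable (SF : set S) := @measurable_Sfin R Im Ip.
Let Ip0 : Ibar Ip := Ip_Ibar hI.


Lemma le_integral_pos_part d (T : measurableType d) (n : probability T R) (h : T -> R) (v B : R) :
  measurable_fun setT h -> (forall w, `|h w - v| <= B)%R ->
  (v + (\int[n]_w (h w - v))%R)%:E <= \int[n]_w (Num.max 0 (h w))%:E.
Proof.
move=> mh hB.
have md : measurable_fun setT (fun w => h w - v)%R by exact: measurable_funB.
have id : n.-integrable setT (EFin \o (fun w => h w - v)%R).
  by apply: (@integrable_bounded _ _ _ _ _ _ B).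
have iv : n.-integrable setT (EFin \o cst v).
  by apply: (@integrable_bounded _ _ _ _ _ _ `|v|%R) => // u _; exact: lexx.
have -> : (v + (\int[n]_w (h w - v))%R)%:E = \int[n]_w (v + (h w - v))%:E.
  transitivity ((\int[n]_w (v + (h w - v)))%R%:E); last first.
    rewrite /Rintegral fineK//; apply: integrable_fin_num => //.
    exact: (integrableD _ iv id).
  congr EFin; transitivity ((\int[n]_w cst v w) + (\int[n]_w (h w - v)))%R.
    congr (_ + _)%R; rewrite Rintegral_cst//; rewrite -[LHS]mulr1; congr (v * _)%R.
    by rewrite -[LHS]/(fine 1); exact: (congr1 fine (esym (probability_setT n))).
  by rewrite -RintegralD.
apply: le_integral => //.
- exact: (integrableD _ iv id).
- apply: (@integrable_bounded _ _ _ _ _ _ (`|v| + B)%R) => //; first exact: measurable_maxr.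
  move=> w _; have := hB w; have := ler_norm v; have := ler_norm (- v)%R; rewrite normrN.
  have := normr_ge0 v.
  by rewrite !ler_norml; case: (leP 0%R (h w)) => h0 h1 h2 h3 /andP[h4 h5]; apply/andP; split; lra.
- by move=> w _; rewrite lee_fin addrC subrK le_max lexx orbT.
Qed.

(** [G] is the positive part of [h], set to 0 off [Sfin]; this is consistent because [Sfin] and its
    complement are both closed under steps. *)
Lemma potential_not_summable (h : S -> R) (B beta : R) : measurable_fun SF h -> h emp = 0%R ->
  (forall X w, SF X -> `|h (luckock_map w X) - h X| <= B)%R ->
  (forall X, SF X -> 0 <= \int[m]_w (h (luckock_map w X) - h X))%R ->
  (0 < beta <= \int[m]_w (h (luckock_map w emp) - h emp))%R ->
  ~ \sum_(0 <= n <oo) survival m step [set emp] n emp < +oo.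
Proof.
move=> mh h0 hB hd /andP[beta0 hbeta].
have mst X : SF X -> measurable_fun setT (fun w => h (luckock_map w X)).
  move=> SX; apply: measurable_comp mh (measurable_luckock_input ltI X) => //.
  by move=> _ [w _ <-]; exact: Sfin_luckock.
pose G (X : S) : R := if X \in SF then Num.max 0%R (h X) else 0%R.
have GE X : SF X -> G X = Num.max 0%R (h X) by move=> SX; rewrite /G mem_set.
have GN X : ~ SF X -> G X = 0%R by move=> SX; rewrite /G memNset.
have G0 X : (0 <= G X)%R by rewrite /G; case: ifP => // _; rewrite le_max lexx.
have Gemp : G emp = 0%R by rewrite GE ?h0 ?maxxx//; exact: Sfin0.
have stepG X : SF X -> step_op m step (EFin \o G) X = \int[m]_w (Num.max 0%R (h (luckock_map w X)))%:E.
  by move=> SX; apply: eq_integral => w _; rewrite /= GE//; exact: Sfin_luckock.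
have B0 : (0 <= B)%R by apply: le_trans (hB emp point (Sfin0 _ _)).
apply: (@survival_not_summable _ _ _ _ _ m step (measurable_luckock_step ltI)
  _ (@measurable_Sord0 R Im Ip) G emp B beta) => //.
- have -> : G = (fun X => Num.max 0 (h X))%R \_ SF by apply/funext => X; rewrite patchE.
  by apply/(measurable_restrictT _ mSF); exact: measurable_maxr.
- by move=> _ ->.
- move=> w X; have [SX|nX] := pselect (SF X); last first.
    by rewrite !GN ?add0r//; move=> /Sfin_luckock_inv.
  rewrite !GE//; last exact: Sfin_luckock.
  have := hB X w SX; rewrite ler_norml /luckock_step /= => /andP[_ h2].
  by case: (leP 0%R (h X)) => a1; case: (leP 0%R (h (luckock_map w X))) => a2; lra.
- move=> X; have [SX|nX] := pselect (SF X); last by rewrite GN//; apply: step_op_ge0 => Y; rewrite lee_fin.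
  rewrite stepG// GE//; case: (leP 0%R (h X)) => hX; last first.
    by apply: integral_ge0 => w _; rewrite lee_fin le_max lexx.
  apply: le_trans (le_integral_pos_part m (mst X SX) (fun w => hB X w SX)).
  by rewrite lee_fin lerDl hd.
- rewrite stepG; last exact: Sfin0.
  apply: le_trans (le_integral_pos_part m (mst emp (Sfin0 _ _)) (fun w => hB emp w (Sfin0 _ _))).
  by rewrite lee_fin {1}h0 add0r.
Qed.

Let c_gt0 : (0 < fine (mu setT))%R.
Proof. exact: (mu_gt0 ltI lm_noninc lm_gt0 mumE muE). Qed.

Let emp_lists : sells emp = [::] /\ buys emp = [::].
Proof. exact/(Sord0P (Sfin0 Im Ip)). Qed.

Let pot_emp al be : potential lm lp mum mup al be emp = 0%R.
Proof. by case: emp_lists => h1 h2; rewrite /potential /lsum h1 h2 !big_nil addr0. Qed.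

Hypothesis summable : \sum_(0 <= n <oo) survival m step [set emp] n emp < +oo.

Let ci : (0 < (fine (mu setT))^-1)%R. Proof. by rewrite invr_gt0. Qed.

(** If the margin is not positive, [pot_buy] has a nonnegative drift in every finite state, and a
    positive one at the empty book because of the extra term for an empty buy side. *)
Lemma summable_buy_margin : (0 < buy_margin)%R.
Proof.
rewrite ltNge; apply/negP => le0.
have [B _ hB] := potential_lip ltI lm_cont lp_cont lm_noninc lp_nondec lp_gt0 lm_gt0 mumE mupE
  (- Gm Im lm lp mum Ip)%R (slack Im Ip lm lp mup + Gm Im lm lp mum Ip)%R.
have dr := pot_buy_drift ltI lm_cont lp_cont lm_noninc lp_nondec lp_gt0 lm_gt0 mumE mupE mumC mupC muE mE.
have mb := measurable_pot_buy ltI lm_cont lp_cont lm_noninc lp_nondec lp_gt0 lm_gt0 mumE mupE.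
pose al := (lp Im * (slack Im Ip lm lp mup + Gm Im lm lp mum Ip + Gp Im Ip lm lp mup Im))%R.
have al0 : (0 < al)%R.
  rewrite mulr_gt0//; have := slack_Im Im Ip lm lp mup => h.
  have := Gm_ge0 hI lm_noninc lp_nondec lp_gt0 lm_gt0 mum Ip0.
  have lmIm : (0 < lm Im)%R by apply: lt_le_trans lm_gt0 _; apply: lm_noninc.
  have : (0 < (lp Im)^-1 * (lm Im)^-1)%R by rewrite mulr_gt0// invr_gt0.
  lra.
apply: (@potential_not_summable pot_buy B ((fine (mu setT))^-1 * (- buy_margin + al))%R mb
  (pot_emp _ _) hB _ _ summable).
- move=> X SX; rewrite dr// pmulr_rge0// addr_ge0 ?oppr_ge0//; case: ifP => // _; exact: ltW.
- rewrite dr; last exact: Sfin0.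
  have [_ ->] := emp_lists; rewrite eqxx lexx andbT mulr_gt0//.
  by rewrite ltr_wpDl// oppr_ge0.
Qed.

Lemma summable_sell_margin : (0 < sell_margin)%R.
Proof.
rewrite ltNge; apply/negP => le0.
have [B _ hB] := potential_lip ltI lm_cont lp_cont lm_noninc lp_nondec lp_gt0 lm_gt0 mumE mupE
  (slack Im Ip lm lp mup + Gp Im Ip lm lp mup Im)%R (- Gp Im Ip lm lp mup Im)%R.
have dr := pot_sell_drift ltI lm_cont lp_cont lm_noninc lp_nondec lp_gt0 lm_gt0 mumE mupE mumC mupC muE mE.
have mb := measurable_pot_sell ltI lm_cont lp_cont lm_noninc lp_nondec lp_gt0 lm_gt0 mumE mupE.
pose al := (lm Ip * (slack Im Ip lm lp mup + Gp Im Ip lm lp mup Im + Gm Im lm lp mum Ip))%R.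
have al0 : (0 < al)%R.
  rewrite mulr_gt0//; have := slack_Im Im Ip lm lp mup => h.
  have := Gm_ge0 hI lm_noninc lp_nondec lp_gt0 lm_gt0 mum Ip0.
  have lmIm : (0 < lm Im)%R by apply: lt_le_trans lm_gt0 _; apply: lm_noninc.
  have : (0 < (lp Im)^-1 * (lm Im)^-1)%R by rewrite mulr_gt0// invr_gt0.
  lra.
apply: (@potential_not_summable pot_sell B ((fine (mu setT))^-1 * (- sell_margin + al))%R mb
  (pot_emp _ _) hB _ _ summable).
- move=> X SX; rewrite dr// pmulr_rge0// addr_ge0 ?oppr_ge0//; case: ifP => // _; exact: ltW.
- rewrite dr; last exact: Sfin0.
  have [-> _] := emp_lists; rewrite eqxx lexx andbT mulr_gt0//.
  by rewrite ltr_wpDl// oppr_ge0.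
Qed.

End null_model.

(** * The invariant law from excursions *)

Lemma ge0_integral_mrestr d (T : measurableType d) (R : realType)
    (m : {measure set T -> \bar R}) (A : set T) (mA : measurable A) (h : T -> \bar R) :
  measurable_fun setT h -> (forall x, 0 <= h x) ->
  \int[mrestr m mA]_x h x = \int[m]_(x in A) h x.
Proof.
move=> mh h0; rewrite -(setUv A) ge0_integral_setU//=; last 3 first.
- exact: measurableC.
- by rewrite setUv.
- exact/disj_setPCl.
rewrite [X in _ + X]null_set_integral ?adde0//; last 3 first.
- exact: measurableC.
- exact: measurable_funTS.
- by rewrite /= /mrestr setICl measure0.
apply: eq_measure_integral => B mB BA.
by rewrite /= /mrestr (setIidl BA).
Qed.

Section invariant_measure.
Context (R : realType) dE (E : measurableType dE) dZ (Z : measurableType dZ).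
Variables (m : probability E R) (f : E * Z -> Z).
Hypothesis mf : measurable_fun [set: E * Z] f.
Variable z0 : Z.
Hypothesis mz0 : measurable [set z0].
Local Notation nnmfun F := (measurable_fun setT F /\ forall z, 0 <= F z).
Local Notation tab := (taboo_op m f [set z0]).
Local Notation surv := (survival m f [set z0]).
Local Notation Q := (step_op m f).

(** [nu] is the expected occupation measure of one excursion from [z0]: the sum over k of the law of
    the state at time k on the event of no return by time k. It is built on the probability space of
    the inputs, by restriction and pushforward. *)
Lemma exists_taboo_measure d (T : measurableType d) (P : probability T R)
    (W : nat -> {RV P >-> E}) :
  (forall k A, measurable A -> P (W k @^-1` A) = m A) ->
  (forall (F : {fset nat}) (A : nat -> set E), (forall k, measurable (A k)) ->
    P (cylinder W F A) = \prod_(k <- F) P (W k @^-1` A k)) ->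
  exists nu : {measure set Z -> \bar R}, forall F, nnmfun F ->
    \int[nu]_z F z = \sum_(0 <= k <oo) iter k tab F z0.
Proof.
move=> W_law W_indep.
have Z0_indep (F : {fset nat}) (A : nat -> set E) (B : set Z) :
    (forall k, measurable (A k)) -> measurable B ->
    P (cst z0 @^-1` B `&` cylinder W F A) = P (cst z0 @^-1` B) * P (cylinder W F A).
  move=> mA mB; rewrite preimage_cst; case: ifP => _.
    by rewrite setTI probability_setT mul1e.
  by rewrite set0I measure0 mul0e.
have mnh k := measurable_no_hit mf mz0 W (measurable_cst z0) k.
have mch k := measurable_chain mf W (measurable_cst z0) k.
have ex k : exists nu : {measure set Z -> \bar R}, forall F, nnmfun F ->
    \int[nu]_z F z = iter k tab F z0.
  exists (measure_function_pushforward__canonical__measure_function_Measure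
    (mrestr P (mnh k)) (mch k)) => F [mF F0].
  rewrite ge0_integral_pushforward//.
  rewrite preimage_setT ge0_integral_mrestr; [|exact: measurableT_comp|by move=> x; exact: F0].
  rewrite (integral_no_hit mf mz0 (measurable_cst z0) W_law W_indep Z0_indep k (conj mF F0)).
  transitivity (\int[P]_w (cst (iter k tab F z0)) w); first by [].
  by rewrite integral_cst//= probability_setT mule1.
have [nu nuE] := choice ex.
exists (mseries nu 0) => F nF; have [mF F0] := nF.
rewrite ge0_integral_measure_series//; apply: eq_eseriesr => k _; exact: nuE.
Qed.

Hypothesis summable : \sum_(0 <= k <oo) surv k z0 < +oo.
Variable nu : {measure set Z -> \bar R}.
Hypothesis nuE : forall F, nnmfun F -> \int[nu]_z F z = \sum_(0 <= k <oo) iter k tab F z0.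

Let nn1 : nnmfun (cst 1%:E : Z -> \bar R).
Proof. by split. Qed.

Let mean : \bar R := \sum_(0 <= k <oo) surv k z0.

Let s_ge0 k z : 0 <= surv k z. Proof. by case: (nnmfun_survival m mf mz0 k). Qed.

Let mean_shift : mean = 1 + \sum_(0 <= k <oo) surv k.+1 z0.
Proof.
rewrite /mean nneseries_recl//; congr (_ + _).
by rewrite -nneseries_addn// ; apply: eq_eseriesr => k _; rewrite addn1.
Qed.

Lemma taboo_measure_total : nu setT = mean.
Proof.
transitivity (\int[nu]_z (cst 1%:E : Z -> \bar R) z); last exact: nuE.
by rewrite integral_cst// mul1e.
Qed.

Let mean_fin : mean \is a fin_num.
Proof. by rewrite ge0_fin_numE//; exact: nneseries_ge0. Qed.

Let mean_gt0 : 0 < mean.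
Proof.
rewrite mean_shift; apply: (@lt_le_trans _ _ 1) => //.
by rewrite leeDl//; exact: nneseries_ge0.
Qed.

Let nnQ F : nnmfun F -> nnmfun (Q F).
Proof. by move=> [mF F0]; split; [exact: measurable_step_op|move=> z; exact: step_op_ge0]. Qed.

Let ind0 : Z -> \bar R := (cst 1%:E) \_ [set z0].

Let nn0 : nnmfun ind0. Proof. exact: nnmfun_restrict. Qed.

(* Decomposing according to whether the next step enters [z0]. *)
Let step_taboo (F : Z -> \bar R) (r : R) : nnmfun F -> F z0 = r%:E ->
  Q F = tab F \+ (fun z => r%:E * Q ind0 z).
Proof.
move=> nF Fr; have r0 : (0 <= r)%R by rewrite -lee_fin -Fr; case: nF.
have [m0 i0] := nn0; have [mt t0] := nnmfun_restrict (measurableC mz0) nF.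
apply/funext => z /=; rewrite /taboo_op -step_opZ//; rewrite -step_opD//; last 2 first.
- exact: emeasurable_funM.
- by move=> x; rewrite mule_ge0.
congr step_op; apply/funext => x; rewrite /ind0 !patchE.
have [->|nx] := pselect (x = z0).
  by rewrite memNset ?mem_set//= ?add0e ?mule1 ?Fr //; apply.
by rewrite mem_set ?memNset//= mule0 adde0.
Qed.

(** The return probability is 1: the k-th term is the loss of survival between times k and k+1. The
    losses telescope, and the tail can be subtracted because the mean is finite. *)
Let reentry_sum : \sum_(0 <= k <oo) iter k tab (Q ind0) z0 = 1.
Proof.
have n k : nnmfun (iter k tab (Q ind0)) by apply: nnmfun_iter_taboo => //; exact: nnQ.
have e k : surv k z0 = surv k.+1 z0 + iter k tab (Q ind0) z0.
  have Q1 : Q (cst 1%:E) = cst 1%:E by apply/funext => z; rewrite step_op_cst.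
  have := @step_taboo (cst 1%:E) 1 nn1 erefl; rewrite Q1 => h.
  rewrite {1}/survival h -iter_tabooDE//; last 2 first.
  - exact: nnmfun_taboo.
  - by apply: nnmfunZ => //; exact: nnQ.
  by rewrite -iterSr iter_tabooZ// ?mul1e//; exact: nnQ.
have : mean = \sum_(0 <= k <oo) surv k.+1 z0 + \sum_(0 <= k <oo) iter k tab (Q ind0) z0.
  rewrite -nneseriesD//; last by move=> k _ _; case: (n k).
  by apply: eq_eseriesr => k _; exact: e.
rewrite mean_shift addeC => /esym.
have tf : \sum_(0 <= k <oo) surv k.+1 z0 \is a fin_num.
  rewrite ge0_fin_numE; last exact: nneseries_ge0.
  by apply: le_lt_trans summable; rewrite -/mean mean_shift leeDr.
by move/(congr1 (fun x => x - \sum_(0 <= k <oo) surv k.+1 z0)); rewrite addeAC subee// add0e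
  addeAC subee// add0e.
Qed.

(** A step shifts the excursion by one time unit: it drops the initial visit to [z0] and adds the
    final one, which occurs with probability 1. *)
Lemma taboo_measure_invariant F : nnmfun F -> F z0 \is a fin_num ->
  \int[nu]_z Q F z = \int[nu]_z F z.
Proof.
move=> nF Ff; have [mF F0] := nF.
have r0 : (0 <= fine (F z0))%R by rewrite fine_ge0.
have Fr : F z0 = (fine (F z0))%:E by rewrite fineK.
rewrite (nuE nF) nuE; last exact: nnQ.
have n k : nnmfun (iter k tab (Q ind0)) by apply: nnmfun_iter_taboo => //; exact: nnQ.
have nt k : nnmfun (iter k tab F) by exact: nnmfun_iter_taboo.
transitivity (\sum_(0 <= k <oo) (iter k.+1 tab F z0 + (fine (F z0))%:E * iter k tab (Q ind0) z0)).
  apply: eq_eseriesr => k _; rewrite (step_taboo nF Fr) -iter_tabooDE//; last 2 first.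
  - exact: nnmfun_taboo.
  - by apply: nnmfunZ => //; exact: nnQ.
  by rewrite -iterSr iter_tabooZ//; exact: nnQ.
rewrite nneseriesD; last 2 first.
- by move=> k _ _; case: (nt k.+1).
- by move=> k _ _; rewrite mule_ge0//; case: (n k).
rewrite nneseriesZl; last by move=> k _; case: (n k).
rewrite reentry_sum mule1 -Fr [RHS]nneseries_recl//; last by move=> k _; case: (nt k).
rewrite addeC; congr (_ + _).
rewrite -[RHS]nneseries_addn; last by move=> k; have [_ h] := nt k; exact: h.
by apply: eq_eseriesr => k _; rewrite addn1.
Qed.

(** An excursion that starts in a closed set stays there, so the whole mass does. *)
Lemma taboo_measure_closed (A : set Z) : measurable A -> A z0 ->
  (forall w z, A z -> A (f (w, z))) -> nu A = mean.
Proof.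
move=> mA A0 fA; have nA : nnmfun ((cst 1%:E : Z -> \bar R) \_ A) by exact: nnmfun_restrict.
rewrite -[LHS]mul1e -integral_cst// integral_mkcond nuE//.
apply: eq_eseriesr => k _.
suff : forall z, A z -> iter k tab ((cst 1%:E : Z -> \bar R) \_ A) z = surv k z by exact.
rewrite /survival; elim: k => [|k IH] z Az; first by rewrite /= patchE mem_set.
rewrite !iterS; apply: eq_integral => w _; rewrite !patchE; case: ifP => // _.
by apply: IH; exact: fA.
Qed.

Lemma exists_invariant_probability : exists pi : probability Z R,
  [/\ forall F, nnmfun F -> F z0 \is a fin_num -> \int[pi]_z Q F z = \int[pi]_z F z &
      forall A, measurable A -> A z0 -> (forall w z, A z -> A (f (w, z))) -> pi A = 1].
Proof.
pose pi : probability Z R := mnormalize nu (dirac z0).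
have c0 : (0 <= (fine mean)^-1)%R by rewrite invr_ge0 fine_ge0// ltW.
have piE A : pi A = nu A * ((fine mean)^-1)%:E.
  rewrite /pi /= /mnormalize taboo_measure_total gt_eqF//=.
  by move: mean_fin; rewrite fin_numE => /andP[_ /negbTE ->].
have intE F : nnmfun F -> \int[pi]_z F z = ((fine mean)^-1)%:E * \int[nu]_z F z.
  move=> [mF F0]; rewrite -(@ge0_integral_mscale _ _ _ nu _ _ (NngNum c0))//.
  apply: eq_measure_integral => A mA _.
  by transitivity (nu A * ((fine mean)^-1)%:E); [exact: piE|exact: muleC].
exists pi; split.
  by move=> F nF Ff; rewrite !intE//; [rewrite taboo_measure_invariant|exact: nnQ].
move=> A mA A0 fA; rewrite piE taboo_measure_closed//.
by rewrite -(fineK mean_fin) -EFinM mulfV// gt_eqF// fine_gt0// mean_gt0 ltey_eq mean_fin.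
Qed.

End invariant_measure.

(** * Total variation and the coupling inequality *)

(** Grouping the disjoint sets by the sign of p - q turns the sum of absolute values into the
    differences on two events. *)
Lemma le_total_variation d (T : measurableType d) (R : realType)
    (p q : probability T R) (e : \bar R) :
  (forall A, measurable A -> p A <= q A + e) ->
  (forall A, measurable A -> q A <= p A + e) ->
  total_variation_norm (fun A => p A - q A) <= e + e.
Proof.
move=> pq qp; apply: ge_ereal_sup => _ [n [F [mF tF ->]]].
pose b i := (q (F i) <= p (F i)).
(* Sets of the other sign are replaced by [set0], so both families keep the same index set. *)
pose G (c : bool) i := if b i == c then F i else set0.
have mG c i : measurable (G c i) by rewrite /G; case: ifP.
have tG c : trivIset setT (G c).
  apply/trivIsetP => i j _ _ ij; rewrite /G; case: ifP => _; last by rewrite set0I.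
  by case: ifP => _; [move/trivIsetP: tF; apply|rewrite setI0].
have sumG (r : probability T R) c : r (\big[setU/set0]_(i < n) G c i) = \sum_(i < n) r (G c i).
  by rewrite measure_bigsetU//; exact: sub_trivIset (tG c).
have mU c : measurable (\big[setU/set0]_(i < n) G c i) by exact: bigsetU_measurable.
have fin (r : probability T R) A : measurable A -> r A \is a fin_num by exact: fin_num_measure.
have fs (r : probability T R) c i : (fine (r (G c i)))%:E = r (G c i).
  by rewrite fineK// fin.
have subE (c : bool) : \sum_(i < n) (p (G c i) - q (G c i)) =
    p (\big[setU/set0]_(i < n) G c i) - q (\big[setU/set0]_(i < n) G c i).
  rewrite !sumG -fin_num_sumeN; last by move=> i _; exact: fin.
  by rewrite -big_split.
have -> : \sum_(i < n) `|p (F i) - q (F i)| =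
    (p (\big[setU/set0]_(i < n) G true i) - q (\big[setU/set0]_(i < n) G true i)) +
    (q (\big[setU/set0]_(i < n) G false i) - p (\big[setU/set0]_(i < n) G false i)).
  rewrite -subE; have -> : q (\big[setU/set0]_(i < n) G false i) -
      p (\big[setU/set0]_(i < n) G false i) = \sum_(i < n) (q (G false i) - p (G false i)).
    rewrite !sumG -fin_num_sumeN; last by move=> i _; exact: fin.
    by rewrite -big_split.
  rewrite -big_split; apply: eq_bigr => i _; rewrite /= /G.
  have fp := fin p _ (mF i); have fq := fin q _ (mF i).
  case: (boolP (b i)) => bi /=.
    by rewrite !measure0 subee// adde0 gee0_abs// sube_ge0 ?fq.
  rewrite !measure0 subee// add0e -abseN fin_num_oppeB// addeC gee0_abs// sube_ge0 ?fp//.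
  by move: bi; rewrite /b -ltNge => /ltW.
apply: leeD.
  by rewrite leeBlDr ?fin// addeC pq.
by rewrite leeBlDr ?fin// addeC qp.
Qed.

Section coupling_inequality.
Context (R : realType) dE (E : measurableType dE) dZ (Z : measurableType dZ).
Variables (m : probability E R) (f : E * Z -> Z) (f2 : E * (Z * Z) -> Z * Z).
Hypothesis mf : measurable_fun [set: E * Z] f.
Hypothesis mf2 : measurable_fun [set: E * (Z * Z)] f2.
Hypothesis f2E : forall w x y, f2 (w, (x, y)) = (f (w, x), f (w, y)).
Variable z0 : Z.
Hypothesis mD2 : measurable [set (z0, z0)].
Local Notation nnmfun F := (measurable_fun setT F /\ forall z, 0 <= F z).
Local Notation Q := (step_op m f).
Local Notation surv2 := (survival m f2 [set (z0, z0)]).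

Let s_nn k : nnmfun (surv2 k). Proof. exact: nnmfun_survival. Qed.

(* Both copies evolve identically after they have met in [z0]. *)
Lemma coupling_ineq (F : Z -> \bar R) k x y : nnmfun F -> (forall z, F z <= 1) ->
  iter k Q F x <= iter k Q F y + surv2 k (x, y).
Proof.
move=> [mF F0] F1; elim: k x y => [|k IH] x y.
  by rewrite /survival /=; apply: le_trans (F1 x) _; rewrite leeDr.
have [mk k0] := measurable_iter_step_op m mf k mF F0.
have [mS S0] := nnmfun_restrict (measurableC mD2) (s_nn k).
have mx z : measurable_fun setT (fun w => iter k Q F (f (w, z))).
  by apply: (measurableT_comp mk); exact: measurable_step.
have m2 : measurable_fun setT (fun w => (surv2 k \_ (~` [set (z0, z0)])) (f2 (w, (x, y)))).
  by apply: (measurableT_comp mS); exact: measurable_step.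
change (\int[m]_w iter k Q F (f (w, x)) <= \int[m]_w iter k Q F (f (w, y)) +
  \int[m]_w (surv2 k \_ (~` [set (z0, z0)])) (f2 (w, (x, y)))).
rewrite -ge0_integralD//; apply: ge0_le_integral => //.
  exact: emeasurable_funD.
move=> w _; rewrite f2E patchE; have [[-> ->]|nD] := pselect ((f (w, x), f (w, y)) = (z0, z0)).
  by rewrite leeDl//; case: ifP => // _; case: (s_nn k).
rewrite mem_set; first exact: IH.
exact: nD.
Qed.

Variable SF : set Z.
Hypothesis mSF : measurable SF.
Hypothesis SF0 : SF z0.
Hypothesis summable2 : forall x y, SF x -> SF y -> \sum_(0 <= k <oo) surv2 k (x, y) < +oo.

(** [coupling_ineq] is one-sided, so both orders of the pair [x], [z0] are needed for a two-sided
    comparison. *)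
Definition coupling_defect k (x : Z) : \bar R := surv2 k (x, z0) + surv2 k (z0, x).

Let nn_defect k : nnmfun (coupling_defect k).
Proof.
have [mS S0] := s_nn k; split; last by move=> z; exact: adde_ge0.
apply: emeasurable_funD; apply: measurableT_comp => //; exact: measurable_fun_pair.
Qed.

Let surv2_cvg x y : SF x -> SF y -> surv2 k (x, y) @[k --> \oo] --> 0.
Proof.
move=> Sx Sy.
have fS n : (fine (surv2 n (x, y)))%:E = surv2 n (x, y).
  by rewrite fineK// survival_fin_num.
have : cvgn (series (fun n => fine (surv2 n (x, y)))).
  apply: cvg_series_nneseries; first by move=> n; rewrite fine_ge0//; case: (s_nn n).
  by under eq_eseriesr do rewrite fS; exact: summable2.
move=> /cvg_series_cvg_0 h.
apply/fine_cvgP; split; last exact: h.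
by apply: nearW => n; exact: survival_fin_num.
Qed.

(** The defect is at most 2 and, by summability, tends to 0 at each point of [SF]; dominated
    convergence applies. *)
Lemma coupling_defect_cvg (la : probability Z R) : la SF = 1 ->
  \int[la]_x coupling_defect k x @[k --> \oo] --> 0.
Proof.
move=> la1.
have two (x : Z) k : coupling_defect k x <= 2%:E.
  by rewrite (_ : 2%:E = 1 + 1)// /coupling_defect leeD// survival_le1.
have ae0 : \forall x \ae la, setT x -> coupling_defect k x @[k --> \oo] --> (cst 0 x : \bar R).
  exists (~` SF); split; first exact: measurableC.
    by transitivity (1 - la SF); [exact: probability_setC|rewrite la1 subee].
  move=> x /= h Sx; apply: h => _.
  rewrite -[X in _ --> X](adde0 0); apply: cvgeD => //; exact: surv2_cvg.
have i2 : la.-integrable setT (cst 2%:E : Z -> \bar R) by exact: finite_measure_integrable_cst.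
have [_ _] := @dominated_convergence _ _ _ la setT measurableT coupling_defect (cst 0) (cst 2%:E)
  (fun k => (nn_defect k).1) (measurable_cst _) ae0 i2
  (aeW _ (fun x k _ => le_trans (eq_ind_r (fun y => y <= coupling_defect k x) (lexx _)
    (gee0_abs ((nn_defect k).2 x))) (two x k))).
by rewrite integral0.
Qed.

(** Both initial laws are compared with the chain started at [z0]; invariance turns the k-step
    average under [pi] into the integral of [F]. *)
Lemma step_op_close (la pi : probability Z R) (F : Z -> \bar R) k :
  (forall F, nnmfun F -> F z0 \is a fin_num -> \int[pi]_z Q F z = \int[pi]_z F z) ->
  nnmfun F -> (forall z, F z <= 1) ->
  \int[la]_x iter k Q F x <= \int[pi]_x F x +
    (\int[la]_x coupling_defect k x + \int[pi]_x coupling_defect k x) /\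
  \int[pi]_x F x <= \int[la]_x iter k Q F x +
    (\int[la]_x coupling_defect k x + \int[pi]_x coupling_defect k x).
Proof.
move=> inv nF F1; have [mF F0] := nF.
have [mk k0] := measurable_iter_step_op m mf k mF F0.
have [md d0] := nn_defect k.
have le1 j z : iter j Q F z <= 1.
  elim: j z => [|j IH] z; first exact: F1.
  have [mj j0] := measurable_iter_step_op m mf j mF F0.
  rewrite iterS -[leRHS](step_op_cst m f 1 z); apply: le_step_op => //.
have piE : \int[pi]_x F x = \int[pi]_x iter k Q F x.
  elim: (k) => // j ->; rewrite iterS inv//; first exact: measurable_iter_step_op.
  rewrite ge0_fin_numE; first by apply: le_lt_trans (le1 j z0) _; exact: ltry.
  by case: (measurable_iter_step_op m mf j mF F0).
pose c := iter k Q F z0.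
have cstE (r : probability Z R) : \int[r]_x c = c.
  transitivity (\int[r]_x (cst c) x); first by [].
  rewrite integral_cst//; transitivity (c * 1); last exact: mule1.
  by congr (_ * _); exact: probability_setT.
have up (r : probability Z R) : \int[r]_x iter k Q F x <= c + \int[r]_x coupling_defect k x.
  rewrite -{1}(cstE r) -ge0_integralD//; last by move=> x _; exact: k0.
  apply: ge0_le_integral => //.
    exact: emeasurable_funD.
  move=> x _; apply: le_trans (coupling_ineq k x z0 nF F1) _; rewrite leeD2l//.
  by rewrite leeDl//; case: (s_nn k).
have down (r : probability Z R) : c <= \int[r]_x iter k Q F x + \int[r]_x coupling_defect k x.
  rewrite -{1}(cstE r) -ge0_integralD//.
  apply: ge0_le_integral => //; [by move=> x _; exact: k0|exact: emeasurable_funD|].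
  move=> x _; apply: le_trans (coupling_ineq k z0 x nF F1) _; rewrite leeD2l//.
  by rewrite leeDr//; case: (s_nn k).
rewrite piE; split.
  by apply: le_trans (up la) _; rewrite [X in _ <= _ + X]addeC addeA leeD2r// down.
by apply: le_trans (up pi) _; rewrite addeA leeD2r// down.
Qed.

End coupling_inequality.

(** * Signed measures and Luckock's equation *)

Lemma finite_measure_unique d (T : measurableType d) (R : realType) (G : set (set T))
    (m1 m2 : {measure set T -> \bar R}) :
  @measurable _ T = <<s G >> -> setI_closed G -> m1 setT < +oo -> m1 setT = m2 setT ->
  (forall A, G A -> m1 A = m2 A) -> forall A, measurable A -> m1 A = m2 A.
Proof.
move=> mG IG foo eT eG; apply: (measure_unique (G `|` [set setT]) (fun=> setT)) => //.
- apply/seteqP; split=> A.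
    rewrite mG; apply: sub_sigma_algebra2; exact: subsetUl.
  apply: smallest_sub; first by rewrite mG; exact: smallest_sigma_algebra.
  move=> B [GB|->]; last exact: measurableT.
  by rewrite mG; exact: sub_sigma_algebra.
- move=> A B [GA|->] [GB|->]; rewrite ?setTI ?setIT.
  + by left; exact: IG.
  + by left.
  + by left.
  + by right.
- by move=> _; right.
- exact: bigcup_const.
- by move=> A [/eG//|->].
Qed.

(** Moving the negative Jordan part to the other side leaves an equality between finite measures, to
    which the uniqueness theorem applies. *)
Lemma charge_eq_measure d (T : measurableType d) (R : realType) (G : set (set T))
    (nu : {charge set T -> \bar R}) (n : {finite_measure set T -> \bar R}) :
  @measurable _ T = <<s G >> -> setI_closed G -> nu setT = n setT ->
  (forall A, G A -> nu A = n A) -> forall A, measurable A -> nu A = n A.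
Proof.
move=> mG IG eT eG; have [P [N nuPN]] := Hahn_decomposition nu.
pose jp := jordan_pos nuPN; pose jn := jordan_neg nuPN.
have dec A : measurable A -> nu A = jp A - jn A.
  by move=> mA; rewrite (jordan_decomp nuPN mA) /cadd /= cscaleN1.
have finj A : measurable A -> (jp A \is a fin_num) /\ (jn A \is a fin_num).
  by move=> mA; split; exact: fin_num_measure.
have key A : measurable A -> (nu A = n A <-> jn A + n A = jp A).
  move=> mA; have [fp fn] := finj _ mA; rewrite dec//; split=> [<-|<-].
    by rewrite addeC subeK.
  by rewrite addeAC subee// add0e.
have Gm A : G A -> measurable A by move=> GA; rewrite mG; exact: sub_sigma_algebra.
move=> A mA; apply/(key _ mA).
pose s := measure_add jn n.
have sE B : s B = jn B + n B by rewrite /s measure_addE.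
rewrite -sE; apply: (@finite_measure_unique _ _ _ G s jp) => //.
- have lt : jn setT + n setT < +oo.
    rewrite lte_add_pinfty// ltey_eq; first by have [_ ->] := finj _ measurableT.
    by rewrite fin_num_measure.
  exact: (eq_ind_r (fun y => y < +oo) lt (sE setT)).
- by transitivity (jn setT + n setT); [exact: sE|apply/(key _ measurableT)].
- move=> B GB; transitivity (jn B + n B); first exact: sE.
  by apply/(key _ (Gm _ GB)); exact: eG.
Qed.

Section diff_charge.
Context {R : realType} (Im Ip : \bar R).
Hypothesis hI : Im <= Ip.
Local Notation Ibar := (closed_itv Im Ip).

(** Unfolds the choice of a Hahn decomposition once, keeping only the formulas for the two Jordan
    parts. *)
Lemma weighted_chargeP (nu : {charge set \bar R -> \bar R}) :
  exists (P N : set \bar R) (jp jn : {finite_measure set \bar R -> \bar R}),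
    [/\ measurable P /\ measurable N, P `&` N = set0,
        forall A, measurable A -> [/\ nu A = jp A - jn A, jp A = nu (A `&` P) &
          jn A = - nu (A `&` N)] &
        forall g A, weighted_charge Im Ip g nu A =
          \int[jp]_(x in A `&` Ibar) (g x)%:E - \int[jn]_(x in A `&` Ibar) (g x)%:E].
Proof.
rewrite /weighted_charge; case: (cid _) => P exN; case: (cid exN) => N nuPN.
have [[mP _] [mN _] _ PN0] := nuPN.
exists P, N, (jordan_pos nuPN), (jordan_neg nuPN); split => // A mA; split.
- by rewrite (jordan_decomp nuPN mA) /cadd /= cscaleN1.
- by transitivity (crestr0 nu mP A); [exact: jordan_posE|rewrite /crestr0 mem_set].
- transitivity (- crestr0 nu mN A); last by rewrite /crestr0 mem_set.
  by rewrite -(charge.cjordan_negE nuPN); exact: jordan_negE.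
Qed.

Let mI : measurable Ibar := measurable_Ibar Im Ip.

Section atomless.
Variables (F : \bar R -> R) (nu : {charge set \bar R -> \bar R}).
Hypothesis dF : is_diff_charge Im Ip F nu.

Lemma diff_charge_setD1 A x : measurable A -> nu A = nu (A `\ x).
Proof.
have [_ n0 _] := dF; move=> mA; rewrite (chargeDI nu mA (emeasurable_set1 x)).
suff -> : nu (A `&` [set x]) = 0 by rewrite adde0.
have [Ax|nAx] := pselect (A x).
  by rewrite (_ : A `&` [set x] = [set x])//; apply/setIidr => _ ->.
by rewrite (_ : A `&` [set x] = set0) ?charge0//; apply/seteqP; split => // y [Ay /= yx]; rewrite yx in Ay.
Qed.

Lemma diff_charge_Ibar A : measurable A -> nu A = nu (A `&` Ibar).
Proof.
have [_ _ nI] := dF; move=> mA; rewrite (chargeDI nu mA mI) (nI (A `\` Ibar)) ?add0e//.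
  exact: measurableD.
Qed.

Lemma diff_charge_oc A : measurable A -> nu A = nu (A `&` `]Im, Ip]).
Proof.
move=> mA; rewrite diff_charge_Ibar// (@diff_charge_setD1 _ Im); last exact: measurableI.
congr (nu _); apply/seteqP; split=> x.
  move=> [[Ax /closed_itvP/andP[h1 h2]] /eqP xI]; split => //.
  by rewrite /= in_itv /= h2 lt_neqAle eq_sym xI h1.
rewrite /= in_itv /= => -[Ax /andP[h1 h2]]; split.
  by split => //; apply/closed_itvP; rewrite ltW.
by move=> xI; rewrite xI ltxx in h1.
Qed.

Lemma diff_charge_co A : measurable A -> nu A = nu (A `&` `[Im, Ip[).
Proof.
move=> mA; rewrite diff_charge_Ibar// (@diff_charge_setD1 _ Ip); last exact: measurableI.
congr (nu _); apply/seteqP; split=> x.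
  move=> [[Ax /closed_itvP/andP[h1 h2]] /eqP xI]; split => //.
  by rewrite /= in_itv /= h1 lt_neqAle xI h2.
rewrite /= in_itv /= => -[Ax /andP[h1 h2]]; split.
  by split => //; apply/closed_itvP; rewrite h1 ltW.
by move=> xI; rewrite xI ltxx in h2.
Qed.

Lemma diff_charge_co_oc x y : Ibar x -> Ibar y -> x <= y ->
  nu `[x, y[%classic = (F y - F x)%:E.
Proof.
move=> Ix Iy xy; have [n1 n0 _] := dF; rewrite -n1//.
rewrite (@diff_charge_setD1 _ x); last exact: emeasurable_itv.
rewrite [RHS](@diff_charge_setD1 _ y); last exact: emeasurable_itv.
congr (nu _); apply/seteqP; split=> u /=; rewrite !in_itv /=.
  move=> [/andP[h1 h2] /eqP h3]; rewrite ltW// lt_neqAle eq_sym h3 h1; split => //.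
  by move=> e; rewrite e ltxx in h2.
move=> [/andP[h1 h2] /eqP h3]; rewrite ltW// lt_neqAle h3 h2; split => //.
by move=> e; rewrite e ltxx in h1.
Qed.

End atomless.
End diff_charge.

Section monotone_charge.
Context {R : realType} (Im Ip : \bar R).
Hypothesis hI : Im <= Ip.
Local Notation Ibar := (closed_itv Im Ip).
Local Notation wc := (weighted_charge Im Ip).

Let integral0m (m : {finite_measure set \bar R -> \bar R}) (A : set (\bar R)) (g : \bar R -> \bar R) :
  (forall B, measurable B -> m B = 0) -> \int[m]_(x in A) g x = 0.
Proof.
move=> m0; rewrite -[RHS](integral_measure_zero A g); apply: eq_measure_integral => B mB _.
exact: m0.
Qed.

Lemma weighted_charge_ge0 (nu : {charge set \bar R -> \bar R}) :
  (forall A, measurable A -> 0 <= nu A) ->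
  exists ell : {finite_measure set \bar R -> \bar R},
    (forall A, measurable A -> ell A = nu A) /\
    (forall g A, wc g nu A = \int[ell]_(x in A `&` Ibar) (g x)%:E).
Proof.
move=> nu0; have [P [N [jp [jn [[mP mN] _ h hw]]]]] := weighted_chargeP Im Ip nu.
have jn0 A : measurable A -> jn A = 0.
  move=> mA; apply/eqP; rewrite eq_le measure_ge0 andbT.
  by have [_ _ ->] := h _ mA; rewrite oppe_le0 nu0//; exact: measurableI.
exists jp; split=> [A mA|g A]; first by have [-> _ _] := h _ mA; rewrite jn0// sube0.
by rewrite hw (integral0m _ _ jn0) sube0.
Qed.

Lemma weighted_charge_le0 (nu : {charge set \bar R -> \bar R}) :
  (forall A, measurable A -> nu A <= 0) ->
  exists ell : {finite_measure set \bar R -> \bar R},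
    (forall A, measurable A -> ell A = - nu A) /\
    (forall g A, wc g nu A = - \int[ell]_(x in A `&` Ibar) (g x)%:E).
Proof.
move=> nu0; have [P [N [jp [jn [[mP mN] _ h hw]]]]] := weighted_chargeP Im Ip nu.
have jp0 A : measurable A -> jp A = 0.
  move=> mA; apply/eqP; rewrite eq_le measure_ge0 andbT.
  by have [_ -> _] := h _ mA; rewrite nu0//; exact: measurableI.
exists jn; split=> [A mA|g A].
  by have [-> _ _] := h _ mA; rewrite jp0// sub0e oppeK.
by rewrite hw (integral0m _ _ jp0) sub0e.
Qed.

(** Replaces a threshold by a point of [Ibar] without changing the part of its half-line relevant to
    [Ibar], so that the increments of the function can be used. *)
Let clamp (r : \bar R) : \bar R := maxe Im (mine r Ip).

Let clamp_Ibar r : Ibar (clamp r).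
Proof.
apply/closed_itvP; rewrite le_max lexx /= ge_max hI /=.
by rewrite ge_min lexx orbT.
Qed.

Let clamp_Ip r : clamp r <= Ip.
Proof. by have /closed_itvP/andP[] := clamp_Ibar r. Qed.

Let Im0 : Ibar Im := Im_Ibar hI.
Let Ip0 : Ibar Ip := Ip_Ibar hI.

(** The signed measure dlp is [mup] without its atom at [Im], where [mup] has mass [lp Im]. *)
Lemma diff_charge_lp (lp : \bar R -> R) (mup : {finite_measure set \bar R -> \bar R})
    (nu : {charge set \bar R -> \bar R}) :
  (forall x, Ibar x -> mup `[Im, x]%classic = (lp x)%:E) ->
  is_diff_charge Im Ip lp nu -> forall A, measurable A -> nu A = mup (A `&` `]Im, Ip]).
Proof.
move=> mupE dF.
have mD : measurable (`]Im, Ip] : set (\bar R)) by exact: emeasurable_itv.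
have foo : mup `]Im, Ip]%classic < +oo by rewrite ltey_eq fin_num_measure.
pose n : {finite_measure set \bar R -> \bar R} := mfrestr mD foo.
have nE A : n A = mup (A `&` `]Im, Ip]) by [].
suff h : forall A, measurable A -> nu A = n A by [].
have [n1 _ _] := dF.
apply: (@charge_eq_measure _ _ _ (@ErealGenOInfty.G R)).
- exact: ErealGenOInfty.measurableE.
- move=> _ _ [r ->] [s ->]; exists (Num.max r s); apply/seteqP; split=> x /=.
    by rewrite !in_itv /= !andbT EFin_max gt_max => -[-> ->].
  by rewrite !in_itv /= !andbT EFin_max gt_max => /andP[-> ->].
- rewrite nE setTI (diff_charge_oc dF measurableT) setTI.
  by rewrite n1//; rewrite (mup_oc mupE).
- move=> _ [r ->]; rewrite nE (diff_charge_oc dF); last exact: emeasurable_itv.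
  have -> : `]r%:E, +oo[%classic `&` `]Im, Ip]%classic = `]clamp r%:E, Ip]%classic.
    apply/seteqP; split=> x /=; rewrite !in_itv /= andbT gt_max gt_min.
      by move=> [-> /andP[-> ->]].
    by move=> /andP[/andP[-> /orP[->|h]]] h2; [rewrite h2|rewrite ltNge h2 in h].
  by rewrite n1// (mup_oc mupE).
Qed.

Lemma diff_charge_lm (lm : \bar R -> R) (mum : {finite_measure set \bar R -> \bar R})
    (nu : {charge set \bar R -> \bar R}) :
  (forall x, Ibar x -> mum `[x, Ip]%classic = (lm x)%:E) ->
  is_diff_charge Im Ip lm nu -> forall A, measurable A -> nu A = - mum (A `&` `[Im, Ip[).
Proof.
move=> mumE dF.
have mD : measurable (`[Im, Ip[ : set (\bar R)) by exact: emeasurable_itv.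
have foo : mum `[Im, Ip[%classic < +oo by rewrite ltey_eq fin_num_measure.
pose n : {finite_measure set \bar R -> \bar R} := mfrestr mD foo.
have nE A : n A = mum (A `&` `[Im, Ip[) by [].
suff h : forall A, measurable A -> copp nu A = n A.
  by move=> A mA; rewrite -nE -h// /copp /= oppeK.
have n1 := diff_charge_co_oc dF.
apply: (@charge_eq_measure _ _ _ (@ErealGenCInfty.G R)).
- exact: ErealGenCInfty.measurableE.
- move=> _ _ [r ->] [s ->]; exists (Num.max r s); apply/seteqP; split=> x /=.
    by rewrite !in_itv /= !andbT EFin_max ge_max => -[-> ->].
  by rewrite !in_itv /= !andbT EFin_max ge_max => /andP[-> ->].
- transitivity (- nu (setT `&` `[Im, Ip[%classic)).
    by congr (- _); exact: (diff_charge_co dF measurableT).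
  rewrite nE setTI.
  by rewrite n1// (mum_co mumE)// -EFinN opprB.
- move=> _ [r ->]; rewrite nE; transitivity (- nu (`[r%:E, +oo[%classic `&` `[Im, Ip[%classic)).
    by congr (- _); apply: (diff_charge_co dF); exact: emeasurable_itv.
  have -> : `[r%:E, +oo[%classic `&` `[Im, Ip[%classic = `[clamp r%:E, Ip[%classic.
    apply/seteqP; split=> x /=; rewrite !in_itv /= andbT ge_max ge_min.
      by move=> [-> /andP[-> ->]].
    by move=> /andP[/andP[-> /orP[->|h]]] h2; [rewrite h2|rewrite ltNge h in h2].
  by rewrite n1// (mum_co mumE)// -EFinN opprB.
Qed.

End monotone_charge.

Section diff_charge_function.
Context {R : realType} (Im Ip : \bar R).
Hypothesis hI : Im <= Ip.
Local Notation Ibar := (closed_itv Im Ip).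
Variables (F : \bar R -> R) (nu : {charge set \bar R -> \bar R}).
Hypothesis dF : is_diff_charge Im Ip F nu.

(** The Jordan parts present [F] as a difference of nondecreasing functions; boundedness and
    measurability follow from this. *)
Let Fdec : exists jp jn : {finite_measure set \bar R -> \bar R}, forall x, Ibar x ->
  (F x = F Im + (fine (jp `]Im, x]%classic) - fine (jn `]Im, x]%classic)))%R.
Proof.
have [P [N [jp [jn [_ _ h _]]]]] := weighted_chargeP Im Ip nu.
exists jp, jn => x Ix; have [n1 _ _] := dF.
have /closed_itvP/andP[Imx _] := Ix.
have mA : measurable (`]Im, x]%classic : set (\bar R)) by exact: emeasurable_itv.
have := n1 _ _ (Im_Ibar hI) Ix Imx; have [-> _ _] := h _ mA.
rewrite -(fineK (fin_num_measure jp _ mA)) -(fineK (fin_num_measure jn _ mA)) -EFinB => -[->].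
by rewrite addrC subrK.
Qed.

Let mono (m : {finite_measure set \bar R -> \bar R}) x y : x <= y ->
  (fine (m `]Im, x]%classic) <= fine (m `]Im, y]%classic))%R.
Proof.
have mA z : measurable (`]Im, z]%classic : set (\bar R)) by exact: emeasurable_itv.
move=> xy; apply: fine_le; try exact: fin_num_measure.
apply: le_measure; rewrite ?in_setE//.
by apply: subset_itvl; rewrite bnd_simp.
Qed.

Lemma diff_charge_bounded : exists M : R, forall x, Ibar x -> (`|F x| <= M)%R.
Proof.
have [jp [jn h]] := Fdec.
exists (`|F Im| + (fine (jp `]Im, Ip]%classic) + fine (jn `]Im, Ip]%classic)))%R => x Ix.
have /closed_itvP/andP[_ xIp] := Ix.
rewrite (h _ Ix); apply: le_trans (ler_normD _ _) _; rewrite lerD2l.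
apply: le_trans (ler_normB _ _) _.
by rewrite !ger0_norm ?fine_ge0// lerD// mono.
Qed.

Lemma measurable_diff_charge : measurable_fun Ibar F.
Proof.
have [jp [jn h]] := Fdec.
apply: (@eq_measurable_fun _ _ _ _ _ (fun x =>
  F Im + (fine (jp `]Im, x]%classic) - fine (jn `]Im, x]%classic)))%R).
  by move=> x; rewrite in_setE => Ix; rewrite (h _ Ix).
apply: measurable_funD => //; apply: measurable_funB; apply: measurable_nondecr => x y _ _;
  exact: mono.
Qed.

End diff_charge_function.

Section half_equation.
Context {R : realType} (Im Ip : \bar R).
Hypothesis hI : Im <= Ip.
Local Notation Ibar := (closed_itv Im Ip).
Variables (F g w : \bar R -> R) (nu : {charge set \bar R -> \bar R}).
Variables (ell : {finite_measure set \bar R -> \bar R}) (M b B : R).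
Hypothesis dF : is_diff_charge Im Ip F nu.
Hypothesis mg : measurable_fun Ibar g.
Hypothesis mw : measurable_fun Ibar w.
Hypothesis gM : forall x, Ibar x -> (`|g x| <= M)%R.
Hypothesis wB : forall x, Ibar x -> (b <= w x <= B)%R.
Hypothesis b_gt0 : (0 < b)%R.
Hypothesis eqn : forall A, measurable A -> A `<=` Ibar ->
  \int[ell]_(x in A) (g x)%:E + weighted_charge Im Ip w nu A = 0.

Let mI : measurable Ibar := measurable_Ibar Im Ip.

Let M0 : (0 <= M)%R.
Proof. by have := gM (Im_Ibar hI); apply: le_trans. Qed.

Let wnear x : Ibar x -> (`|w x - (b + B) / 2| <= (B - b) / 2)%R.
Proof. by move=> /wB /andP[h1 h2]; rewrite ler_norml; apply/andP; split; lra. Qed.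

Let gint (m : {finite_measure set \bar R -> \bar R}) A : measurable A -> A `<=` Ibar ->
  m.-integrable A (EFin \o g).
Proof.
move=> mA AI; apply: (@integrable_bounded _ _ _ _ _ _ M) => //.
  exact: measurable_funS mg.
by move=> u /AI; exact: gM.
Qed.

Let wint (m : {finite_measure set \bar R -> \bar R}) A : measurable A -> A `<=` Ibar ->
  m.-integrable A (EFin \o w).
Proof.
move=> mA AI; apply: (@integrable_bounded _ _ _ _ _ _ B) => //.
  exact: measurable_funS mw.
by move=> u /AI /wB /andP[h1 h2]; rewrite ger0_norm// (le_trans (ltW b_gt0)).
Qed.

(** The hypothesis reads g d(ell) + w dF = 0. Tested inside a Hahn set of dF it involves only one
    Jordan part, so w >= b and |g| <= M bound that part by M/b times [ell]; the two parts give [K].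
    On []x, y]], freezing [g] and [w] at [x] then costs at most [e] times the masses involved. *)
Lemma half_equation_estimate : exists2 K : R, (0 <= K)%R &
  forall x y, Ibar x -> Ibar y -> x <= y ->
   let dl := fine (ell `]x, y]%classic) in
   (`|F y - F x| <= K * dl)%R /\
   forall e : R, (forall u, (x < u)%E -> (u <= y)%E -> `|g u - g x| <= e /\ `|w u - w x| <= e)%R ->
     (`|w x * (F y - F x) + g x * dl| <= e * ((1 + K) * dl))%R.
Proof.
have [P [N [jp [jn [[mP mN] PN0 h hw]]]]] := weighted_chargeP Im Ip nu.
have eqR A : measurable A -> A `<=` Ibar ->
    (\int[ell]_(x in A) g x + (\int[jp]_(x in A) w x - \int[jn]_(x in A) w x) = 0)%R.
  move=> mA AI; have := eqn mA AI; rewrite hw (setIidl AI).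
  rewrite -[X in X + _]fineK; last exact: (integrable_fin_num mA (gint ell mA AI)).
  rewrite -[X in _ + (X - _)]fineK; last exact: (integrable_fin_num mA (wint jp mA AI)).
  rewrite -[X in _ + (_ - X)]fineK; last exact: (integrable_fin_num mA (wint jn mA AI)).
  by rewrite -EFinB -EFinD => -[].
have null (m : {finite_measure set \bar R -> \bar R}) A : measurable A -> A `<=` Ibar ->
    m A = 0 -> (\int[m]_(x in A) w x = 0)%R.
  move=> mA AI m0; rewrite /Rintegral null_set_integral//.
  by apply/measurable_EFinP; exact: measurable_funS mw.
have gle A : measurable A -> A `<=` Ibar -> (`|\int[ell]_(x in A) g x| <= M * fine (ell A))%R.
  move=> mA AI; have := @Rintegral_near_cst _ _ _ ell A g 0 M mA (measurable_funS mI AI mg).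
  rewrite mul0r subr0; apply=> u /AI; rewrite subr0; exact: gM.
have wge (m : {finite_measure set \bar R -> \bar R}) A : measurable A -> A `<=` Ibar ->
    (b * fine (m A) <= \int[m]_(x in A) w x)%R.
  move=> mA AI; have := @Rintegral_near_cst _ _ _ m A w ((b + B) / 2)%R ((B - b) / 2)%R mA
    (measurable_funS mI AI mw) (fun u Au => wnear (AI _ Au)).
  by rewrite ler_norml => /andP[h1 _]; lra.
have sub A C : measurable A -> measurable C -> (fine (ell (A `&` C)) <= fine (ell A))%R.
  move=> mA mC; apply: fine_le; try by apply: fin_num_measure; rewrite ?in_setE//; exact: measurableI.
  by apply: le_measure; rewrite ?in_setE//; exact: measurableI.
have jpE A : measurable A -> A `<=` Ibar -> (b * fine (jp A) <= M * fine (ell A))%R.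
  move=> mA AI; have mAP : measurable (A `&` P) by exact: measurableI.
  have API : A `&` P `<=` Ibar by move=> u [/AI].
  have -> : jp A = jp (A `&` P).
    by have [_ -> _] := h _ mA; have [_ -> _] := h _ mAP; rewrite -setIA setIid.
  have n0 : jn (A `&` P) = 0.
    by have [_ _ ->] := h _ mAP; rewrite -setIA PN0 setI0 charge0 oppe0.
  have e := eqR _ mAP API; rewrite (null jn _ mAP API n0) subr0 in e.
  have h1 := gle _ mAP API; have h2 := wge jp _ mAP API.
  have h3 : (M * fine (ell (A `&` P)) <= M * fine (ell A))%R by rewrite ler_wpM2l// sub.
  by move: h1; rewrite ler_norml => /andP[h1 _]; lra.
have jnE A : measurable A -> A `<=` Ibar -> (b * fine (jn A) <= M * fine (ell A))%R.
  move=> mA AI; have mAN : measurable (A `&` N) by exact: measurableI.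
  have ANI : A `&` N `<=` Ibar by move=> u [/AI].
  have -> : jn A = jn (A `&` N).
    by have [_ _ ->] := h _ mA; have [_ _ ->] := h _ mAN; rewrite -setIA setIid.
  have n0 : jp (A `&` N) = 0.
    by have [_ -> _] := h _ mAN; rewrite -setIA [N `&` P]setIC PN0 setI0 charge0.
  have e := eqR _ mAN ANI; rewrite (null jp _ mAN ANI n0) sub0r in e.
  have h1 := gle _ mAN ANI; have h2 := wge jn _ mAN ANI.
  have h3 : (M * fine (ell (A `&` N)) <= M * fine (ell A))%R by rewrite ler_wpM2l// sub.
  by move: h1; rewrite ler_norml => /andP[_ h1]; lra.
have K0 : (0 <= 2 * (M / b))%R by rewrite mulr_ge0// divr_ge0// ltW.
exists (2 * (M / b))%R => // x y Ix Iy xy /=.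
have mA : measurable (`]x, y]%classic : set (\bar R)) by exact: emeasurable_itv.
have AI : `]x, y]%classic `<=` Ibar.
  move=> u; rewrite /= in_itv /= => /andP[h1 h2]; apply/closed_itvP.
  have /closed_itvP/andP[l1 _] := Ix; have /closed_itvP/andP[_ l2] := Iy.
  by rewrite (le_trans l1 (ltW h1)) (le_trans h2).
have FE : (F y - F x = fine (jp `]x, y]%classic) - fine (jn `]x, y]%classic))%R.
  have [n1 _ _] := dF; have := n1 _ _ Ix Iy xy; have [-> _ _] := h _ mA.
  rewrite -(fineK (fin_num_measure jp _ mA)) -(fineK (fin_num_measure jn _ mA)) -EFinB.
  by move=> -[->].
have hp : (fine (jp `]x, y]%classic) <= M / b * fine (ell `]x, y]%classic))%R.
  by rewrite mulrAC ler_pdivlMr// mulrC jpE.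
have hn : (fine (jn `]x, y]%classic) <= M / b * fine (ell `]x, y]%classic))%R.
  by rewrite mulrAC ler_pdivlMr// mulrC jnE.
have jp0 : (0 <= fine (jp `]x, y]%classic))%R by rewrite fine_ge0.
have jn0 : (0 <= fine (jn `]x, y]%classic))%R by rewrite fine_ge0.
split.
  by rewrite FE ler_norml; apply/andP; split; lra.
move=> e he.
have e0 u : `]x, y]%classic u -> (`|g u - g x| <= e)%R.
  by rewrite /= in_itv /= => /andP[h1 h2]; have [] := he u h1 h2.
have e1 u : `]x, y]%classic u -> (`|w u - w x| <= e)%R.
  by rewrite /= in_itv /= => /andP[h1 h2]; have [] := he u h1 h2.
have k1 := @Rintegral_near_cst _ _ _ ell _ g (g x) e mA (measurable_funS mI AI mg) e0.
have k2 := @Rintegral_near_cst _ _ _ jp _ w (w x) e mA (measurable_funS mI AI mw) e1.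
have k3 := @Rintegral_near_cst _ _ _ jn _ w (w x) e mA (measurable_funS mI AI mw) e1.
have := eqR _ mA AI; rewrite FE.
(* That [e] is nonnegative can be concluded only if []x, y]] has a point. *)
have [xy0|yx] := ltP x y; last first.
  have -> : `]x, y]%classic = set0 :> set (\bar R).
    by apply/seteqP; split => // u; rewrite /= in_itv /= => /andP[h1 h2]; have := lt_le_trans h1 (le_trans h2 yx); rewrite ltxx.
  by rewrite !measure0 /= subrr !mulr0 addr0 normr0.
have ee : (0 <= e)%R by have [h1 _] := he y xy0 (lexx y); exact: le_trans h1.
move: k1 k2 k3 hp hn jp0 jn0.
move: (fine (jp _)) (fine (jn _)) (fine (ell _)) => p n l.
move: (Rintegral _ _ _) (Rintegral _ _ _) (Rintegral _ _ _) => i1 i2 i3.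
have kk : (e * ((1 + 2 * (M / b)) * l) = e * l + e * (M / b * l) + e * (M / b * l))%R by ring.
move=> k1 k2 k3 hp hn p0 n0 e00.
have hp' : (e * p <= e * (M / b * l))%R by rewrite ler_wpM2l.
have hn' : (e * n <= e * (M / b * l))%R by rewrite ler_wpM2l.
move: k1 k2 k3; rewrite kk !ler_norml mulrBr => /andP[a1 a2] /andP[a3 a4] /andP[a5 a6].
move: hp' hn' a1 a2 a3 a4 a5 a6 e00; rewrite {kk}.
move: (e * (M / b * l))%R (e * p)%R (e * n)%R (e * l)%R (w x * p)%R (w x * n)%R (g x * l)%R.
move=> q1 q2 q3 q4 q5 q6 q7 *; apply/andP; split; lra.
Qed.

End half_equation.

Section luckock.
Context {R : realType} (Im Ip : \bar R) (lm lp : \bar R -> R).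
Hypothesis ltI : Im < Ip.
Let hI : Im <= Ip := ltW ltI.
Local Notation Ibar := (closed_itv Im Ip).
Hypothesis lm_cont : {within Ibar, continuous lm}.
Hypothesis lp_cont : {within Ibar, continuous lp}.
Hypothesis lm_noninc : forall x y, Ibar x -> Ibar y -> x <= y -> (lm y <= lm x)%R.
Hypothesis lp_nondec : forall x y, Ibar x -> Ibar y -> x <= y -> (lp x <= lp y)%R.
Hypothesis lp_gt0 : (0 < lp Im)%R.
Hypothesis lm_gt0 : (0 < lm Ip)%R.
Variables mum mup : {finite_measure set \bar R -> \bar R}.
Hypothesis mumE : forall x, Ibar x -> mum `[x, Ip]%classic = (lm x)%:E.
Hypothesis mupE : forall x, Ibar x -> mup `[Im, x]%classic = (lp x)%:E.
Let Im0 : Ibar Im := Im_Ibar hI.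
Let Ip0 : Ibar Ip := Ip_Ibar hI.
Local Notation dform := (dform Im Ip lm lp).

Let lmp x : Ibar x -> (0 < lm x)%R.
Proof. by move=> Ix; have /andP[h _] := lm_bounds hI lm_noninc Ix; exact: lt_le_trans h. Qed.

Let lpp x : Ibar x -> (0 < lp x)%R.
Proof. by move=> Ix; have /andP[h _] := lp_bounds hI lp_nondec Ix; exact: lt_le_trans h. Qed.

Variables fm fp : \bar R -> R.
Hypothesis sol : luckock_solution Im Ip lm lp fm fp.

(** The two equations become dfp = - (fm / lm) dlp and dfm = - (fp / lp) dlm. As dlm is nonpositive,
    the second enters [half_equation_estimate] with the measure - dlm and the density - fp. *)
Let dforms : dform fp (fun x => - (fm x / lm x))%R (cst 0%R) /\
  dform fm (cst 0%R) (fun x => - (fp x / lp x))%R.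
Proof.
have [_ _ [dlm [dlp [dfm [dfp [[hdlm hdlp] [hdfm hdfp] eqp eqm]]]]] _] := sol.
have lpE := diff_charge_lp hI mupE hdlp.
have lmE := diff_charge_lm hI mumE hdlm.
have lp0 A : measurable A -> 0 <= dlp A by move=> mA; rewrite lpE.
have lm0 A : measurable A -> dlm A <= 0 by move=> mA; rewrite lmE// oppe_le0.
have [ellp [ellpE wp]] := weighted_charge_ge0 Im Ip lp0.
have [ellm [ellmE wm]] := weighted_charge_le0 Im Ip lm0.
have [Mm bm] := diff_charge_bounded hI hdfm; have [Mp bp] := diff_charge_bounded hI hdfp.
have mfm := measurable_diff_charge hI hdfm; have mfp := measurable_diff_charge hI hdfp.
have mlm : measurable_fun Ibar lm := measurable_nonincr lm_noninc.
have mlp : measurable_fun Ibar lp := measurable_nondecr lp_nondec.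
have mfpN : measurable_fun Ibar (\- fp)%R by exact: measurable_funN.
have bpN x : Ibar x -> (`|(\- fp)%R x| <= Mp)%R by move=> Ix; rewrite /= normrN bp.
have eqp' A : measurable A -> A `<=` Ibar ->
    \int[ellp]_(x in A) (fm x)%:E + weighted_charge Im Ip lm dfp A = 0.
  by move=> mA AI; rewrite -(eqp _ mA) wp (setIidl AI).
have eqm' A : measurable A -> A `<=` Ibar ->
    \int[ellm]_(x in A) ((\- fp)%R x)%:E + weighted_charge Im Ip lp dfm A = 0.
  move=> mA AI; rewrite -(eqm _ mA) wm (setIidl AI); congr (_ + _).
  have ifp : ellm.-integrable A (EFin \o fp).
    apply: (@integrable_bounded _ _ _ _ _ _ Mp) => //.
      exact: (measurable_funS (measurable_Ibar Im Ip) AI mfp).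
    by move=> u /AI; exact: bp.
  rewrite -[RHS]mulN1e -(integralZl mA ifp (-1)).
  by apply: eq_integral => x _ /=; rewrite -EFinM mulN1r.
have [Kp Kp0 hp] := half_equation_estimate hI hdfp mfm mlm bm (fun x Ix => lm_bounds hI lm_noninc Ix) lm_gt0 eqp'.
have [Km Km0 hm] := half_equation_estimate hI hdfm mfpN mlp bpN (fun x Ix => lp_bounds hI lp_nondec Ix) lp_gt0 eqm'.
have lE x y : Ibar x -> Ibar y -> x <= y -> fine (ellp `]x, y]%classic) = (lp y - lp x)%R.
  move=> Ix Iy xy; rewrite ellpE; last exact: emeasurable_itv.
  by have [h _ _] := hdlp; rewrite (h _ _ Ix Iy xy).
have mE x y : Ibar x -> Ibar y -> x <= y -> fine (ellm `]x, y]%classic) = (lm x - lm y)%R.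
  move=> Ix Iy xy; rewrite ellmE; last exact: emeasurable_itv.
  by have [h _ _] := hdlm; rewrite (h _ _ Ix Iy xy) -EFinN opprB.
(* All oscillations over []x, y]] are bounded by a multiple of the clock increment; used as [e],
   they make the remainder quadratic. *)
have est x y u : Ibar x -> Ibar y -> x <= y -> x < u -> u <= y ->
    (`|fm u - fm x| <= Km * (lp y - lm y - (lp x - lm x)) /\
    `|fp u - fp x| <= Kp * (lp y - lm y - (lp x - lm x)) /\
    `|lm u - lm x| <= lp y - lm y - (lp x - lm x) /\
    `|lp u - lp x| <= lp y - lm y - (lp x - lm x))%R.
  move=> Ix Iy xy xu uy; have Iu : Ibar u.
    have /closed_itvP/andP[l1 _] := Ix; have /closed_itvP/andP[_ l2] := Iy.
    by apply/closed_itvP; rewrite (le_trans l1 (ltW xu)) (le_trans uy).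
  have [h1 _] := hm _ _ Ix Iu (ltW xu); have [h2 _] := hp _ _ Ix Iu (ltW xu).
  rewrite (mE _ _ Ix Iu (ltW xu)) in h1; rewrite (lE _ _ Ix Iu (ltW xu)) in h2.
  have a1 := lp_nondec Ix Iu (ltW xu); have a2 := lm_noninc Ix Iu (ltW xu).
  have a3 := lp_nondec Iu Iy uy; have a4 := lm_noninc Iu Iy uy.
  split; [|split; [|split]].
  - by apply: le_trans h1 _; rewrite ler_wpM2l//; lra.
  - by apply: le_trans h2 _; rewrite ler_wpM2l//; lra.
  - by rewrite ler_norml; apply/andP; split; lra.
  - by rewrite ler_norml; apply/andP; split; lra.
have Mm0 : (0 <= Mm)%R by apply: le_trans (bm _ Im0).
have Mp0 : (0 <= Mp)%R by apply: le_trans (bp _ Im0).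
have norm_div (z w Z W : R) : (0 < W)%R -> (W <= w)%R -> (`|z| <= Z)%R -> (`|z / w| <= Z / W)%R.
  move=> W0 Ww zZ; have w0 : (0 < w)%R by exact: lt_le_trans Ww.
  rewrite normrM normfV (gtr0_norm w0); apply: ler_pM => //; first by rewrite invr_ge0 ltW.
  by rewrite lef_pV2 ?posrE.
have Lam0 x y : Ibar x -> Ibar y -> x <= y -> (0 <= lp y - lp x <= lp y - lm y - (lp x - lm x))%R /\
    (0 <= lm x - lm y <= lp y - lm y - (lp x - lm x))%R.
  move=> Ix Iy xy; have a1 := lp_nondec Ix Iy xy; have a2 := lm_noninc Ix Iy xy.
  by split; apply/andP; split; lra.
have q1 : (0 <= Mm / lm Ip)%R by rewrite divr_ge0// ltW.
have q2 : (0 <= Mp / lp Im)%R by rewrite divr_ge0// ltW.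
have q3 : (0 <= (1 + Km) * (1 + Kp) / lm Ip)%R by rewrite divr_ge0 ?mulr_ge0 ?addr_ge0// ltW.
have q4 : (0 <= (1 + Kp) * (1 + Km) / lp Im)%R by rewrite divr_ge0 ?mulr_ge0 ?addr_ge0// ltW.
split.
  exists (Mp + Mm / lm Ip + (1 + Km) * (1 + Kp) / lm Ip)%R => [x Ix|x y Ix Iy xy].
    have b1 := bp _ Ix; have /andP[l1 _] := lm_bounds hI lm_noninc Ix.
    have b2 := norm_div _ _ _ _ lm_gt0 l1 (bm _ Ix).
    by rewrite normr0 normrN; split; lra.
  rewrite mul0r subr0; have [_ h] := hp _ _ Ix Iy xy; rewrite (lE _ _ Ix Iy xy) in h.
  set D := (lp y - lm y - (lp x - lm x))%R.
  have [/andP[d0 d1] _] := Lam0 _ _ Ix Iy xy; rewrite -/D in d1.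
  have D0 : (0 <= D)%R by lra.
  have KD : (0 <= Km * D)%R by rewrite mulr_ge0.
  have {}h := h ((1 + Km) * D)%R.
  have /h {}h : forall u, x < u -> u <= y ->
      (`|fm u - fm x| <= (1 + Km) * D /\ `|lm u - lm x| <= (1 + Km) * D)%R.
    move=> u xu uy; have [h1 [_ [h2 _]]] := est _ _ _ Ix Iy xy xu uy.
    by rewrite -/D in h1 h2; split; lra.
  have /andP[l1 _] := lm_bounds hI lm_noninc Ix.
  have -> : (fp y - fp x - - (fm x / lm x) * (lp y - lp x) =
      (lm x * (fp y - fp x) + fm x * (lp y - lp x)) / lm x)%R.
    by field; rewrite gt_eqF// lmp.
  apply: le_trans (norm_div _ _ _ _ lm_gt0 l1 h) _.
  apply: (@le_trans _ _ ((1 + Km) * (1 + Kp) / lm Ip * D ^+ 2)%R); last first.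
    by rewrite ler_wpM2r ?sqr_ge0//; lra.
  have -> : ((1 + Km) * D * ((1 + Kp) * (lp y - lp x)) / lm Ip =
    (1 + Km) * (1 + Kp) / lm Ip * (D * (lp y - lp x)))%R by field; rewrite gt_eqF.
  by rewrite ler_wpM2l// expr2 ler_wpM2l.
exists (Mm + Mp / lp Im + (1 + Kp) * (1 + Km) / lp Im)%R => [x Ix|x y Ix Iy xy].
  have b1 := bm _ Ix; have /andP[l1 _] := lp_bounds hI lp_nondec Ix.
  have b2 := norm_div _ _ _ _ lp_gt0 l1 (bp _ Ix).
  by rewrite normr0 normrN; split; lra.
rewrite mul0r subr0; have [_ h] := hm _ _ Ix Iy xy; rewrite (mE _ _ Ix Iy xy) in h.
set D := (lp y - lm y - (lp x - lm x))%R.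
have [_ /andP[d0 d1]] := Lam0 _ _ Ix Iy xy; rewrite -/D in d1.
have D0 : (0 <= D)%R by lra.
have KD : (0 <= Kp * D)%R by rewrite mulr_ge0.
have {}h := h ((1 + Kp) * D)%R.
have /h {}h : forall u, x < u -> u <= y ->
    (`|(\- fp) u - (\- fp) x| <= (1 + Kp) * D /\ `|lp u - lp x| <= (1 + Kp) * D)%R.
  move=> u xu uy; have [_ [h1 [_ h2]]] := est _ _ _ Ix Iy xy xu uy.
  rewrite -/D in h1 h2; rewrite /= -opprD normrN; split; last by lra.
  by lra.
have /andP[l1 _] := lp_bounds hI lp_nondec Ix.
have -> : (fm y - fm x - - (fp x / lp x) * (lm y - lm x) =
    (lp x * (fm y - fm x) + (\- fp) x * (lm x - lm y)) / lp x)%R.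
  by rewrite /=; field; rewrite gt_eqF// lpp.
apply: le_trans (norm_div _ _ _ _ lp_gt0 l1 h) _.
apply: (@le_trans _ _ ((1 + Kp) * (1 + Km) / lp Im * D ^+ 2)%R); last first.
  by rewrite ler_wpM2r ?sqr_ge0//; lra.
have -> : ((1 + Kp) * D * ((1 + Km) * (lm x - lm y)) / lp Im =
  (1 + Kp) * (1 + Km) / lp Im * (D * (lm x - lm y)))%R by field; rewrite gt_eqF.
by rewrite ler_wpM2l// expr2 ler_wpM2l.
Qed.

(** The product rule gives d(lm fp + lp fm) = 0, and with [k] this constant, d(fm / lm) = k dGm and
    d(fp / lp) = k dGp. The endpoint values fm Ip = 1 = fp Im determine the rest. *)
Lemma luckock_margins : exists c1 c2 : R, [/\ (0 < c1)%R, (0 < c2)%R,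
  (fm Im * c1 = buy_margin Im Ip lm lp mum)%R & (fp Ip * c2 = sell_margin Im Ip lm lp mup)%R].
Proof.
have [dfp dfm] := dforms.
have [_ _ _ [fm1 fp1]] := sol.
have dlm : dform lm (cst 0%R) (cst 1%R) by exact: dform_lm (fun x Ix => ltW (lmp Ix)).
have dlp : dform lp (cst 1%R) (cst 0%R) by exact: dform_lp (fun x Ix => ltW (lpp Ix)).
have dilm := dformV hI lm_noninc lp_nondec dlm lm_gt0
  (fun x Ix => (andP (lm_bounds hI lm_noninc Ix)).1).
have dilp := dformV hI lm_noninc lp_nondec dlp lp_gt0
  (fun x Ix => (andP (lp_bounds hI lp_nondec Ix)).1).
have dM F a b G a' b' : dform F a b -> dform G a' b' ->
    dform (F \* G)%R (fun x => a x * G x + F x * a' x)%R (fun x => b x * G x + F x * b' x)%R.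
  exact: dformM.
have const F : dform F (cst 0%R) (cst 0%R) -> forall x, Ibar x -> F x = F Im.
  exact: dform_const.
pose k x := (lm x * fp x + lp x * fm x)%R.
have kc : forall x, Ibar x -> k x = k Im.
  apply: const; apply: dform_eq (dformD (dM _ _ _ _ _ _ dlm dfp) (dM _ _ _ _ _ _ dlp dfm)) _ _ _ => //= x Ix.
    by field; rewrite gt_eqF// lmp.
  by field; rewrite gt_eqF// lpp.
have dGm' := dGm hI lm_noninc lp_nondec lp_gt0 lm_gt0 mumE.
have dGp' := dGp hI lm_noninc lp_nondec lp_gt0 lm_gt0 mupE.
have c1 : forall x, Ibar x -> (fm x / lm x - k Im * Gm Im lm lp mum x = fm Im / lm Im - k Im * Gm Im lm lp mum Im)%R.
  apply: const; apply: dform_eq (dformD (dM _ _ _ _ _ _ dfm dilm)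
    (dM _ _ _ _ _ _ (dform_cst Im Ip lm lp (- k Im)%R) dGm')) _ _ _ => x Ix /=.
  - by rewrite mulNr.
  - by field; rewrite gt_eqF// lmp.
  - rewrite -(kc x Ix) /k /gm; by field; rewrite !gt_eqF ?lmp ?lpp.
have c2 : forall x, Ibar x -> (fp x / lp x - k Im * Gp Im Ip lm lp mup x = fp Im / lp Im - k Im * Gp Im Ip lm lp mup Im)%R.
  apply: const; apply: dform_eq (dformD (dM _ _ _ _ _ _ dfp dilp)
    (dM _ _ _ _ _ _ (dform_cst Im Ip lm lp (- k Im)%R) dGp')) _ _ _ => x Ix /=.
  - by rewrite mulNr.
  - rewrite -(kc x Ix) /k /gp; by field; rewrite !gt_eqF ?lmp ?lpp.
  - by field; rewrite gt_eqF// lpp.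
have Gm0 := Gm_ge0 hI lm_noninc lp_nondec lp_gt0 lm_gt0 mum Ip0.
have Gp0 := Gp_ge0 hI lm_noninc lp_nondec lp_gt0 lm_gt0 mup Im0.
have e1 := c1 _ Ip0; have e2 := c2 _ Ip0; have e3 := kc _ Ip0.
rewrite Gm_Im fm1 in e1; rewrite Gp_Ip fp1 in e2.
(* Expressing [k] by its value at [Im] and collecting the terms in [fm Im] gives the first factor;
   its value at [Ip] gives the second. *)
exists ((lm Im)^-1 + lp Im * Gm Im lm lp mum Ip)%R, ((lp Ip)^-1 + lm Ip * Gp Im Ip lm lp mup Im)%R.
split.
- by rewrite ltr_pwDl// ?invr_gt0 ?lmp// mulr_ge0// ltW.
- by rewrite ltr_pwDl// ?invr_gt0 ?lpp// mulr_ge0// ltW.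
- have kI : (k Im = lm Im + lp Im * fm Im)%R by rewrite /k fp1 mulr1.
  rewrite /buy_margin; move: e1; rewrite kI mul1r.
  move: (Gm _ _ _ _ _) ((lm Ip)^-1)%R ((lm Im)^-1)%R => G i j e1; rewrite mulrDr; nra.
- have kI : (k Im = lm Ip * fp Ip + lp Ip)%R by rewrite -e3 /k fm1 mulr1.
  rewrite /sell_margin; move: e2; rewrite kI mul1r.
  move: (Gp _ _ _ _ _ _) ((lp Ip)^-1)%R ((lp Im)^-1)%R => G i j e2; rewrite mulrDr; nra.
Qed.

End luckock.

(** * Convergence to the invariant law and conclusion *)

Lemma total_variation_ge0 d (T : measurableType d) (R : realType) (n : set T -> \bar R) :
  0 <= total_variation_norm n.
Proof.
apply: ereal_sup_ubound; exists 0%N, (fun=> set0); split => //.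
  by apply/trivIsetP => i j _ _ _; rewrite set0I.
by rewrite big_ord0.
Qed.

Section convergence.
Context {R : realType} (Im Ip : \bar R).
Hypothesis ltI : Im < Ip.
Local Notation S := (Sord Im Ip).
Local Notation SF := (Sfin Im Ip).
Local Notation E := (\bar R * bool)%type.
Local Notation step := (@luckock_step R Im Ip).
Local Notation emp := (Sord0 Im Ip).
Local Notation D2 := [set (emp, emp)].
Variables (mu : {measure set E -> \bar R}) (m : probability E R).
Hypothesis mE : forall A, measurable A -> m A = normalized mu A.

Let mL : measurable_fun setT step := measurable_luckock_step ltI.
Let mSF : measurable (SF : set S) := @measurable_Sfin R Im Ip.

Lemma independent_cylinder d (T : measurableType d) (P : probability T R)
    (W : nat -> {RV P >-> E}) (X0 : {RV P >-> S}) (F : {fset nat}) (A : nat -> set E) (B : set S) :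
  independent_of_inputs X0 W -> (forall k, measurable (A k)) -> measurable B ->
  P (X0 @^-1` B `&` cylinder W F A) = P (X0 @^-1` B) * P (cylinder W F A).
Proof.
move=> ind mA mB; apply: ind => //.
set G := \bigcup_k _.
apply: (@fin_bigcap_measurable _ (g_sigma_algebraType G)); first exact: finite_fset.
move=> k _; apply: sub_sigma_algebra; exists k => //; exists (A k) => //.
by rewrite setTI.
Qed.

Hypothesis summable2 : forall x y, SF x -> SF y ->
  \sum_(0 <= k <oo) survival m (@coupled_step R Im Ip) D2 k (x, y) < +oo.

Let ind (A : set S) : S -> \bar R := (cst 1%:E : S -> \bar R) \_ A.

Let nn_ind A : measurable A -> measurable_fun setT (ind A) /\ forall z, 0 <= ind A z.
Proof. by move=> mA; apply: nnmfun_restrict => //; split. Qed.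

Let ind_le1 A z : ind A z <= 1.
Proof. by rewrite /ind patchE; case: ifP => // _; rewrite lee_fin. Qed.

Let integral_ind d (T : measurableType d) (n : {measure set T -> \bar R}) (h : T -> S) A :
  measurable_fun setT h -> measurable A -> \int[n]_w ind A (h w) = n (h @^-1` A).
Proof.
move=> mh mA; have mhA : measurable (h @^-1` A).
  by rewrite -[X in measurable X]setTI; exact: mh.
rewrite -[RHS]mul1e -integral_cst// [RHS]integral_mkcond; apply: eq_integral => w _.
by rewrite /ind !patchE; case: (pselect (A (h w))) => hA; [rewrite !mem_set|rewrite !memNset].
Qed.

Section invariant.
Variable pi : probability S R.
Hypothesis pi_inv : forall F : S -> \bar R, measurable_fun setT F /\ (forall z, 0 <= F z) ->
  F emp \is a fin_num -> \int[pi]_z step_op m step F z = \int[pi]_z F z.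
Hypothesis pi_fin : pi SF = 1.

Lemma invariant_law_step : invariant_law mu pi.
Proof.
move=> A mA; transitivity (\int[pi]_X ind A X); last first.
  by rewrite (@integral_ind _ _ pi id).
have fin0 : ind A emp \is a fin_num.
  have [_ n0] := nn_ind mA; rewrite ge0_fin_numE//; apply: le_lt_trans (ind_le1 _ _) _; exact: ltry.
rewrite -(pi_inv (nn_ind mA) fin0).
apply: eq_integral => X _.
have mX : measurable_fun setT (fun w : E => luckock_map w X) by exact: measurable_luckock_input.
rewrite -mE; last by rewrite -[X in measurable X]setTI; exact: mX.
by rewrite -(integral_ind m mX mA).
Qed.

(** By [step_op_close], the laws at time k differ on each event by at most [e k], the defects
    averaged over the initial and the invariant law; the norm is then at most twice [e k]. *)
Lemma process_converges d (T : measurableType d) (P : probability T R)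
    (W : nat -> {RV P >-> E}) (X0 : {RV P >-> S}) :
  iid_inputs mu W -> independent_of_inputs X0 W -> distribution P X0 SF = 1 ->
  (fun k : nat => total_variation_norm
     (fun A => P (process W X0 k @^-1` A) - pi A)) @ \oo --> 0.
Proof.
move=> hW hX0 la1; pose la : probability S R := distribution P X0.
have W_law := inputs_law mE hW.
have W_indep := inputs_indep hW.
have Z0_indep F A B := @independent_cylinder _ _ P W X0 F A B hX0.
pose e k := \int[la]_x coupling_defect m (@coupled_step R Im Ip) emp k x +
  \int[pi]_x coupling_defect m (@coupled_step R Im Ip) emp k x.
have m2 := measurable_coupled_step ltI.
have mD2 := @measurable_coupled_empty R Im Ip.
have e0 : e k @[k --> \oo] --> 0.
  rewrite -[X in _ --> X](adde0 0); apply: cvgeD => //.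
    exact: (coupling_defect_cvg m2 mD2 mSF (Sfin0 Im Ip) summable2 la1).
  exact: (coupling_defect_cvg m2 mD2 mSF (Sfin0 Im Ip) summable2 pi_fin).
have mp k : measurable_fun setT (process W X0 k).
  by rewrite process_chain; exact: measurable_chain.
have lawE k A : measurable A -> P (process W X0 k @^-1` A) = \int[la]_x iter k (step_op m step) (ind A) x.
  move=> mA; have [mi i0] := nn_ind mA.
  rewrite -(integral_ind P (mp k) mA) process_chain.
  rewrite (integral_chain mL (measurable_funPT X0) W_law W_indep Z0_indep k mi i0).
  have [mk k0] := measurable_iter_step_op m mL k mi i0.
  by rewrite ge0_integral_distribution.
apply: (@squeeze_cvge _ _ _ _ (cst 0) _ (fun k => e k + e k)).
- apply: nearW => k; rewrite total_variation_ge0 /=.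
  pose p : probability S R := distribution P (mfun_Sub (mem_set (mp k))).
  have pE A : p A = P (process W X0 k @^-1` A) by [].
  have cl A : measurable A -> p A <= pi A + e k /\ pi A <= p A + e k.
    move=> mA; have nF := nn_ind mA; have F1 := @ind_le1 A.
    have := @step_op_close _ _ _ _ _ m step _ mL m2 (fun _ _ _ => erefl) emp mD2 la pi (ind A) k pi_inv nF F1.
    rewrite -lawE// (_ : \int[pi]_x ind A x = pi A)//.
    exact: (@integral_ind _ _ pi id).
  by apply: (@le_total_variation _ _ _ p pi (e k)) => A mA; have [] := cl A mA.
- exact: cvg_cst.
- by rewrite -[X in _ --> X](adde0 0); apply: cvgeD.
Qed.

End invariant.
End convergence.

Theorem theorem3 (R : realType) (Im Ip : \bar R) (lm lp : \bar R -> R)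
    (hI : Im < Ip)
    (lm_cont : {within closed_itv Im Ip, continuous lm})
    (lp_cont : {within closed_itv Im Ip, continuous lp})
    (lm_ge0 : forall x, closed_itv Im Ip x -> (0 <= lm x)%R)
    (lp_ge0 : forall x, closed_itv Im Ip x -> (0 <= lp x)%R)
    (lm_noninc : forall x y, closed_itv Im Ip x -> closed_itv Im Ip y ->
       x <= y -> (lm y <= lm x)%R)
    (lp_nondec : forall x y, closed_itv Im Ip x -> closed_itv Im Ip y ->
       x <= y -> (lp x <= lp y)%R)
    (lp_gt0 : (0 < lp Im)%R) (lm_gt0 : (0 < lm Ip)%R)
    (mu : {measure set (\bar R * bool) -> \bar R})
    (hmu : is_stigler_luckock_measure Im Ip lm lp mu)
    (d : measure_display) (T : measurableType d) (P : probability T R)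
    (W : nat -> {RV P >-> (\bar R * bool)%type})
    (hW : iid_inputs mu W) :
  (forall fm fp : \bar R -> R, luckock_solution Im Ip lm lp fm fp ->
     (positive_recurrent Im Ip W <-> (0 < Num.min (fm Im) (fp Ip))%R)) /\
  (positive_recurrent Im Ip W ->
   exists nu : probability (Sord Im Ip) R,
     [/\ invariant_law mu nu,
         nu (Sfin Im Ip) = 1 &
         forall (d' : measure_display) (T' : measurableType d')
           (P' : probability T' R)
           (W' : nat -> {RV P' >-> (\bar R * bool)%type})
           (X0 : {RV P' >-> Sord Im Ip}),
           iid_inputs mu W' -> independent_of_inputs X0 W' ->
           distribution P' X0 (Sfin Im Ip) = 1 ->
           (fun k : nat => total_variation_norm
              (fun A => P' (process W' X0 k @^-1` A) - nu A)) @ \oo --> 0]).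
Proof.
have [mum [mup [[mumC mupC] mumE mupE muE]]] := hmu.
(* The law of the first input, which shows that the normalised measure is a probability. *)
pose m : probability (\bar R * bool)%type R := distribution P (W 0%N).
have mE A : measurable A -> m A = normalized mu A by have [h _] := hW; exact: h.
pose step := @luckock_step R Im Ip.
pose surv := survival m step [set Sord0 Im Ip].
have prE : positive_recurrent Im Ip W <-> \sum_(0 <= k <oo) surv k (Sord0 Im Ip) < +oo.
  by rewrite /positive_recurrent (integral_return_time hI mE hW).
have buy_gt0 : positive_recurrent Im Ip W -> (0 < buy_margin Im Ip lm lp mum)%R.
  by move=> /prE; exact: (summable_buy_margin hI lm_cont lp_cont lm_noninc lp_nondec lp_gt0 lm_gt0
    mumE mupE mumC mupC muE mE).
have sell_gt0 : positive_recurrent Im Ip W -> (0 < sell_margin Im Ip lm lp mup)%R.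
  by move=> /prE; exact: (summable_sell_margin hI lm_cont lp_cont lm_noninc lp_nondec lp_gt0 lm_gt0
    mumE mupE mumC mupC muE mE).
have summable2 := summable_coupling hI lm_cont lp_cont lm_noninc lp_nondec lp_gt0 lm_gt0
    mumE mupE mumC mupC muE mE.
split.
  move=> fm fp sol.
  have [c1 [c2 [c10 c20 e1 e2]]] := luckock_margins hI lm_cont lp_cont lm_noninc lp_nondec lp_gt0 lm_gt0 mumE mupE sol.
  rewrite lt_min -(pmulr_lgt0 (fm Im) c10) -(pmulr_lgt0 (fp Ip) c20) e1 e2.
  split=> [pr|/andP[b0 s0]]; first by rewrite buy_gt0 ?sell_gt0.
  (* Two empty books form a diagonal starting point, where the pair series is the survival series of
     one book. *)
  apply/prE; have := summable2 b0 s0 _ _ (Sfin0 Im Ip) (Sfin0 Im Ip).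
  by under eq_eseriesr do rewrite survival_diag.
move=> pr; have sum0 := (prE.1 pr).
have {}summable2 := summable2 (buy_gt0 pr) (sell_gt0 pr).
have mL := measurable_luckock_step hI.
have mz := @measurable_Sord0 R Im Ip.
have [nu nuE] := exists_taboo_measure mL mz (inputs_law mE hW) (inputs_indep hW).
have [pi [pi_inv pi_closed]] := exists_invariant_probability mL mz sum0 nuE.
have piS : pi (Sfin Im Ip) = 1.
  apply: pi_closed; [exact: measurable_Sfin|exact: Sfin0|].
  by move=> w X SX; exact: Sfin_luckock.
exists pi; split => //; first exact: (invariant_law_step hI mE pi_inv).
move=> d' T' P' W' X0 hW' ind X0fin.
exact: (process_converges hI mE summable2 pi_inv piS hW' ind X0fin).
Qed.
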